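(* For every real number $M > 1+\sqrt{2}$ there exists a complete orthonormal system $\Theta=\{\theta_n\}_{n=1}^{\infty}$ in $L^2_{[0,1]}$ which is a Euclidean system and satisfies $$\|\theta_n\|_{L^\infty_{[0,1]}}\le M\qquad\text{for all } n\in\mathbb{N}.$$
   Context: Functions and coefficients are real-valued; $[0,1]$ carries Lebesgue measure. An orthonormal system $\{\varphi_n\}_{n=1}^\infty$ in $L^2_{[0,1]}$ is a convergence system if $\sum_{n=1}^\infty a_n\varphi_n$ converges almost everywhere on $[0,1]$ for every $\{a_n\}_{n=1}^\infty\in l^2$. It is a divergence system if $\sum_{n=1}^\infty a_n\varphi_n$ diverges almost everywhere on $[0,1]$ for every $\{a_n\}_{n=1}^\infty\notin l^2$ (i.e. for almost every $x$ the partial sums do not converge to a finite limit). It is a Euclidean system if it is both a convergence system and a divergence system. Complete means that the closed linear span is all of $L^2_{[0,1]}$. *)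

(* Defs.v *)
From HB Require Import structures.
From mathcomp Require Import all_boot all_order all_algebra.
From mathcomp Require Import all_classical all_reals all_analysis.

Set Implicit Arguments.
Unset Strict Implicit.
Unset Printing Implicit Defensive.

Import Order.TTheory GRing.Theory Num.Theory.
Import numFieldNormedType.Exports.

Local Open Scope classical_set_scope.
Local Open Scope ring_scope.

(* Functions on [0,1] are represented by functions on the whole line; all
   measure-theoretic notions below are taken with respect to the measure
   A |-> lebesgue_measure (A `&` `[0, 1]), so that values outside [0,1] never
   matter. *)
Definition leb01 (R : realType) : {measure set (measurableTypeR R) -> \bar R} :=
  mrestr (@lebesgue_measure R)
    (measurable_itv `[0, 1] : measurable (`[0, 1]%classic : set (measurableTypeR R))).

(* Elements of L^2 and L^oo are represented by everywhere defined Borel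
   functions; systems are indexed from 0. *)
Definition L2 (R : realType) : set (R -> R) :=
  [set f | f \in Lfun (leb01 R) 2%:E].

Definition orthonormal_system (R : realType) (phi : nat -> R -> R) : Prop :=
  (forall n, L2 (phi n)) /\
  (forall m n, \int[leb01 R]_x (phi m x * phi n x) = (m == n)%:R).

Definition linear_span (R : realType) (phi : nat -> R -> R) : set (R -> R) :=
  [set g | exists (N : nat) (c : nat -> R),
             g = (fun x => \sum_(0 <= n < N) c n * phi n x)].

Definition L2_closure (R : realType) (S : set (R -> R)) : set (R -> R) :=
  [set f | L2 f /\ forall e : R, 0 < e ->
     exists2 g, S g & ('N[leb01 R]_2%:E[(fun x => (f x - g x)%:E)] < e%:E)%E].

Definition complete_system (R : realType) (phi : nat -> R -> R) : Prop :=
  L2_closure (linear_span phi) = @L2 R.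

Definition l2 (R : realType) : set (nat -> R) :=
  [set a : R^nat | cvgn (series (fun n => a n ^+ 2))].

(* cvgn is convergence in R, i.e. to a finite limit. *)
Definition convergence_system (R : realType) (phi : nat -> R -> R) : Prop :=
  forall a : nat -> R, l2 a ->
    \forall x \ae leb01 R, cvgn (series (fun n => a n * phi n x)).

Definition divergence_system (R : realType) (phi : nat -> R -> R) : Prop :=
  forall a : nat -> R, ~ l2 a ->
    \forall x \ae leb01 R, ~ cvgn (series (fun n => a n * phi n x)).

Definition euclidean_system (R : realType) (phi : nat -> R -> R) : Prop :=
  convergence_system phi /\ divergence_system phi.

(* Main.v *)
Require Import Defs.
From mathcomp Require Import all_boot all_order all_algebra.
From mathcomp Require Import all_classical all_reals all_analysis.
From mathcomp Require Import measurable_realfun ess_sup_inf.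
From mathcomp Require Import ring lra zify.
Import Order.TTheory GRing.Theory Num.Theory.
Import numFieldNormedType.Exports.
Local Open Scope ring_scope.

Set Implicit Arguments.
Unset Strict Implicit.
Unset Printing Implicit Defensive.

(** The system is built in blocks over a filtration of [[0, 1[]: level [s] cuts
[[0, 1[] into [M s] equal atoms, each of which is cut into [m s] atoms of level
[s + 1], so that the fresh digit is uniform and independent of the past.  The
[s]-th block has [N s] functions [ph_i(past) + ps_i(fresh digit)], where [ps_i]
has mean zero.  Its past part spreads an orthonormal completion [f_c] of the
functions built so far over many coordinates, which makes the system complete
while [f_c] contributes arbitrarily little to each sup norm; the rest of the
function, a Rademacher function plus a Menshov-type correction, is bounded by
2 < 1 + sqrt 2 up to an arbitrarily small error.

For square summable coefficients, a weak type (2,2) maximal inequality inside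
each block and Kolmogorov's inequality across blocks give convergence.

For other coefficients, let [tau s] and [nu s] be the energies of the past and
of the fresh part of the [s]-th block, so that [tau s + nu s] has a divergent
sum.  If the [tau s] with [nu s <= C tau s] have a divergent sum for some [C],
then the Menshov walk (a rearranged Haar system, stopped at a suitable index and
multiplied by a weight which is only just square integrable) makes a partial sum
inside the block exceed 1 with conditional probability at least a constant times
[min 1 (tau s)], whatever the past; so almost surely this happens infinitely
often.  Otherwise the sum of the blocks is essentially a sum of martingale
differences; testing it against its Rademacher part, whose fourth moments are
controlled, the Paley-Zygmund inequality shows that its partial sums almost
surely leave every bounded interval. *)

(** * Averages over finite sets *)

(** The obstacle is the past part. Coefficients may concentrate their energy on the [f_c], which are
    arbitrary orthonormal functions: partial sums over [c] obey no maximal inequality, and nothing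
    forces them to move. Two devices answer this. Every [f_c] is spread over [T * L] coordinates,
    arranged in rounds that run through all [c]; a cut leaves one incomplete round, harmless in mean
    square once [L >= d]. And the coordinates on the [f_c] reappear in a gadget with an independent
    sign for each [c], so that no value of the past can cancel it. The gain of the gadget is that
    its stopped sum exceeds its complete sum by a factor [sqrt n] in mean square. Alone this would
    destroy convergence, for the same [n] enters the maximal inequality. The weight restores the
    balance: its square has tail about [1 / (y * harm)] with [harm] comparable to [n], so a walk of
    energy [n * tau], once weighted, exceeds 1 with probability of order [tau]. Thus the lower bound
    for spikes has the order of the weak type upper bound. The split 4/5, 3/5 keeps a fixed share of
    the fresh energy on plain signs, which have good fourth moments. *)

Section FiniteSums.
Variable R : realType.

Lemma sum_cauchy_schwarz (I : Type) (r : seq I) (P : pred I) (F G : I -> R) :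
  (\sum_(i <- r | P i) F i * G i) ^+ 2 <=
  (\sum_(i <- r | P i) F i ^+ 2) * (\sum_(i <- r | P i) G i ^+ 2).
Proof.
set a := \sum_(i <- r | P i) F i ^+ 2; set c := \sum_(i <- r | P i) G i ^+ 2.
set b := \sum_(i <- r | P i) F i * G i.
have q (x y : R) : 0 <= x ^+ 2 * a + 2 * (x * y) * b + y ^+ 2 * c.
  rewrite /a /b /c !mulr_sumr -!big_split /=; apply: sumr_ge0 => i _.
  by have := sqr_ge0 (x * F i + y * G i); lra.
have a0 : 0 <= a by apply: sumr_ge0 => i _; exact: sqr_ge0.
have c0 : 0 <= c by apply: sumr_ge0 => i _; exact: sqr_ge0.
have := q c (- b); have := q (- b) a.
case: (ltgtP c 0) c0 => // [c0|c0] _; last first.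
  have := q (- b) 1; rewrite c0 expr2 => h1 h2 h3.
  (* With [c = 0] this choice makes the quadratic form equal to [- b ^+ 2], hence [b = 0]. *)
  have := q (- b) (a/2 + 1/2); rewrite c0 => h4; nra.
by move=> _; nra.
Qed.

Lemma sqr_sum_le_card (I : finType) (P : pred I) (F : I -> R) n :
  (#|[pred i | P i & F i != 0%R]| <= n)%N ->
  (\sum_(i | P i) F i) ^+ 2 <= n%:R * \sum_(i | P i) F i ^+ 2.
Proof.
move=> cn.
have -> : \sum_(i | P i) F i = \sum_(i | P i) (F i != 0)%:R * F i.
  by apply: eq_bigr => i _; case: eqVneq => [->|]; rewrite ?mulr0 ?mul1r.
apply: le_trans (sum_cauchy_schwarz _ _ _ _) _.
apply: ler_wpM2r; first by apply: sumr_ge0 => i _; exact: sqr_ge0.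
apply: le_trans (_ : #|[pred i | P i & F i != 0]|%:R <= _); last by rewrite ler_nat.
rewrite -sum1_card natr_sum big_mkcondr /=; apply: ler_sum => i _.
by case: eqVneq => _; rewrite ?expr0n ?expr1n.
Qed.

End FiniteSums.

Section Avg.
Variable R : realType.

Definition avg (T : finType) (f : T -> R) : R := (\sum_x f x) / #|T|%:R.
Definition prob (T : finType) (A : pred T) : R := avg (fun x => (A x)%:R).

Section OneSpace.
Variable T : finType.
Implicit Types f g h : T -> R.

Lemma eq_avg f g : f =1 g -> avg f = avg g.
Proof. by move=> fg; rewrite /avg; under eq_bigr do rewrite fg. Qed.

Lemma avg0 : avg (fun _ : T => 0) = 0.
Proof. by rewrite /avg big1 // mul0r. Qed.

Lemma avgD f g : avg (fun x => f x + g x) = avg f + avg g.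
Proof. by rewrite /avg big_split /= mulrDl. Qed.

Lemma avgZ a f : avg (fun x => a * f x) = a * avg f.
Proof. by rewrite /avg -mulr_sumr mulrA. Qed.

Lemma avgZr a f : avg (fun x => f x * a) = avg f * a.
Proof. by rewrite mulrC -avgZ; apply: eq_avg => x; rewrite mulrC. Qed.

Lemma avgN f : avg (fun x => - f x) = - avg f.
Proof. by rewrite -mulN1r -avgZ; apply: eq_avg => x; rewrite mulN1r. Qed.

Lemma avgB f g : avg (fun x => f x - g x) = avg f - avg g.
Proof. by rewrite avgD avgN. Qed.

Lemma avg_sum (I : Type) (r : seq I) (P : pred I) (F : I -> T -> R) :
  avg (fun x => \sum_(i <- r | P i) F i x) = \sum_(i <- r | P i) avg (F i).
Proof. by rewrite /avg exchange_big /= mulr_suml. Qed.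

Lemma avg_cst a : (0 < #|T|)%N -> avg (fun _ : T => a) = a.
Proof.
move=> T0; rewrite /avg sumr_const -[a *+ _]mulr_natr mulfK // pnatr_eq0.
by rewrite -lt0n.
Qed.

Lemma ler_avg f g : (forall x, f x <= g x) -> avg f <= avg g.
Proof. by move=> fg; apply: ler_wpM2r; [rewrite invr_ge0 | apply: ler_sum]. Qed.

Lemma avg_ge0 f : (forall x, 0 <= f x) -> 0 <= avg f.
Proof. by move=> f0; rewrite -avg0; exact: ler_avg. Qed.

Lemma ler_norm_avg f : `|avg f| <= avg (fun x => `|f x|).
Proof.
rewrite /avg normrM [X in _ * X]ger0_norm ?invr_ge0//.
by apply: ler_wpM2r; [rewrite invr_ge0 | exact: ler_norm_sum].
Qed.

Lemma avg_inj (s : T -> T) f : injective s -> avg (f \o s) = avg f.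
Proof.
move=> s_inj; rewrite /avg; congr (_ / _).
by rewrite [RHS](reindex_inj s_inj).
Qed.

Lemma avg_cauchy_schwarz f g :
  avg (fun x => f x * g x) ^+ 2 <= avg (fun x => f x ^+ 2) * avg (fun x => g x ^+ 2).
Proof.
rewrite /avg expr_div_n mulrACA -expr2 -exprVn.
by apply: ler_wpM2r; [rewrite sqr_ge0 | exact: sum_cauchy_schwarz].
Qed.

Lemma avg_sqr_le f : (0 < #|T|)%N -> avg f ^+ 2 <= avg (fun x => f x ^+ 2).
Proof.
move=> T0; have := avg_cauchy_schwarz f (fun=> 1).
rewrite (eq_avg (g := f)); last by move=> x; rewrite mulr1.
by rewrite expr1n avg_cst // mulr1.
Qed.

Lemma prob_ge0 (A : pred T) : 0 <= prob A.
Proof. by apply: avg_ge0. Qed.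

Lemma le_prob (A B : pred T) : (forall x, A x -> B x) -> prob A <= prob B.
Proof. by move=> AB; apply: ler_avg => x; case: (A x) (AB x) => [->//|_]; case: (B x). Qed.

Lemma markov_avg (f : T -> R) a :
  0 < a -> (forall x, 0 <= f x) -> prob (fun x => a < f x) <= avg f / a.
Proof.
move=> a0 f0; rewrite ler_pdivlMr // -avgZr; apply: ler_avg => x.
by case: ltP => /= [/ltW|]; rewrite ?mul1r ?mul0r.
Qed.

(* Two Cauchy-Schwarz inequalities bound [avg (Y Z)] over [{|Y| > lam}] by
   [(avg Y^2)^(1/2) (avg Z^4)^(1/4) P(|Y| > lam)^(1/4)]. *)
Lemma paley_zygmund (Y Z : T -> R) (a lam : R) :
  0 <= a -> 0 <= lam -> 2 * a <= avg (fun x => Y x * Z x) ->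
  lam * avg (fun x => `|Z x|) <= a ->
  a ^+ 4 <= avg (fun x => Y x ^+ 2) ^+ 2 * avg (fun x => Z x ^+ 4) *
            prob (fun x => lam < `|Y x|).
Proof.
move=> a0 l0 h1 h2; set A := fun x => lam < `|Y x|.
have idA x : ((A x)%:R : R) ^+ 2 = (A x)%:R by case: (A x); rewrite ?expr1n ?expr0n.
set m := avg (fun x => Y x * (Z x * (A x)%:R)).
have am : a <= m.
  have : avg (fun x => Y x * Z x) <= m + lam * avg (fun x => `|Z x|).
    rewrite /m -avgZ -avgD; apply: ler_avg => x; rewrite /A.
    case: ltP => h; rewrite ?mulr1.
      by rewrite lerDl mulr_ge0.
    rewrite !mulr0 add0r (le_trans (ler_norm _)) // normrM.
    by apply: ler_wpM2r.
  lra.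
have m2 : m ^+ 2 <= avg (fun x => Y x ^+ 2) * avg (fun x => (Z x * (A x)%:R) ^+ 2).
  exact: avg_cauchy_schwarz.
have m4 : avg (fun x => (Z x * (A x)%:R) ^+ 2) ^+ 2 <=
    avg (fun x => Z x ^+ 4) * prob A.
  have := avg_cauchy_schwarz (fun x => Z x ^+ 2) (fun x => (A x)%:R).
  under eq_avg do rewrite -[X in _ * X]idA -exprMn.
  under [avg (fun x => (Z x ^+ 2) ^+ 2)]eq_avg do rewrite -exprM.
  by under [avg (fun x => (A x)%:R ^+ 2)]eq_avg do rewrite idA.
have p2 : 0 <= avg (fun x => Y x ^+ 2) by apply: avg_ge0 => x; exact: sqr_ge0.
apply: (@le_trans _ _ (m ^+ 4)); first by apply: lerXn2r; rewrite ?nnegrE// (le_trans a0).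
rewrite (_ : 4 = 2 * 2)%N // exprM.
apply: (@le_trans _ _ ((avg (fun x => Y x ^+ 2) * avg (fun x => (Z x * (A x)%:R) ^+ 2)) ^+ 2)).
  by apply: lerXn2r; rewrite ?nnegrE ?sqr_ge0// mulr_ge0// avg_ge0// => x; exact: sqr_ge0.
by rewrite exprMn -mulrA ler_wpM2l// sqr_ge0.
Qed.

End OneSpace.

Lemma avg_pair (T1 T2 : finType) (f : T1 * T2 -> R) :
  avg f = avg (fun x => avg (fun y => f (x, y))).
Proof.
rewrite /avg card_prod natrM invfM mulrA [LHS]mulrAC; congr (_ / _).
rewrite -mulr_suml pair_bigA /= mulrC [RHS]mulrC.
by congr (_ * _); apply: eq_bigr => -[].
Qed.

Lemma avg_exchange (T1 T2 : finType) (f : T1 -> T2 -> R) :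
  avg (fun x => avg (fun y => f x y)) = avg (fun y => avg (fun x => f x y)).
Proof.
by rewrite /avg -!mulr_suml exchange_big /= mulrAC.
Qed.

Lemma avg_prod (T1 T2 : finType) (f : T1 -> R) (g : T2 -> R) :
  avg (fun z : T1 * T2 => f z.1 * g z.2) = avg f * avg g.
Proof. by rewrite avg_pair /= -avgZr; apply: eq_avg => x; rewrite avgZ. Qed.

(* The stopped process [Z] freezes the partial sums as soon as they leave
   [[-lam, lam]]; its increments stay orthogonal. *)
Lemma kolmogorov (T : finType) (D : nat -> T -> R) (K : nat) (lam : R) :
  0 < lam ->
  (forall k (z : (nat -> R) -> R), (k < K)%N ->
     (forall a b : nat -> R, (forall j, (j < k)%N -> a j = b j) -> z a = z b) ->
     avg (fun x => z (D^~ x) * D k x) = 0) ->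
  prob (fun x => [exists k : 'I_K.+1, lam < `|\sum_(j < k) D j x|]) <=
    (\sum_(j < K) avg (fun x => D j x ^+ 2)) / lam ^+ 2.
Proof.
move=> l0 orth.
pose fix Z k (a : nat -> R) {struct k} : R :=
  if k is k'.+1 then Z k' a + (if lam < `|Z k' a| then 0 else a k') else 0.
have Zloc k a b : (forall j, (j < k)%N -> a j = b j) -> Z k a = Z k b.
  elim: k a b => //= k IH a b ab.
  by rewrite (IH a b) ?ab// => j jk; apply: ab; rewrite ltnS ltnW.
have Zsum k a : Z k a = \sum_(j < k) a j \/ lam < `|Z k a|.
  elim: k => [|k [IH|IH]] /=; first by left; rewrite big_ord0.
    by case: ifPn => h; [right; rewrite addr0|left; rewrite big_ord_recr /= -IH].
  by right; rewrite IH addr0.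
have Zmax k k' a : (k <= k')%N -> lam < `|Z k a| -> Z k' a = Z k a.
  elim: k' => [|k' IH]; first by rewrite leqn0 => /eqP ->.
  rewrite leq_eqVlt => /predU1P[->//|]; rewrite ltnS => kk' h.
  by rewrite /= IH// h addr0.
have E k : (k <= K)%N -> avg (fun x => Z k (D^~ x) ^+ 2) <= \sum_(j < k) avg (fun x => D j x ^+ 2).
  elim: k => [|k IH] kK.
    by rewrite big_ord0 /= (eq_avg (g := fun=> 0)) ?avg0// => x; rewrite expr0n.
  rewrite big_ord_recr /=; apply: le_trans (lerD (IH (ltnW kK)) (lexx _)).
  (* With this [z], [orth] says that the cross term in the square of the stopped sum averages to
     zero. *)
  pose z a := 2 * Z k a * (if lam < `|Z k a| then 0 else 1).
  rewrite -[leRHS]addr0 -[X in _ <= _ + X](orth k z)//; last by move=> a b ab; rewrite /z (Zloc k a b).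
  rewrite -!avgD; apply: ler_avg => x; rewrite /z /=.
  case: ifPn => _; have h := sqr_ge0 (D k x).
    by rewrite addr0; lra.
  by lra.
apply: (@le_trans _ _ (prob (fun x => lam ^+ 2 < Z K (D^~ x) ^+ 2))); last first.
  apply: le_trans (markov_avg _ _) _; [by rewrite exprn_gt0|by move=> x; exact: sqr_ge0|].
  by rewrite ler_wpM2r ?invr_ge0 ?sqr_ge0// E.
apply: le_prob => x /existsP[k hk].
rewrite -[Z K _ ^+ 2]real_normK ?num_real// ltrXn2r//.
by rewrite ?(ltW l0).
rewrite (_ : `|_| = `|Z k (D^~ x)|); first by case: (Zsum k (D^~ x)) => // ->.
congr (`|_|); apply: Zmax; first by rewrite -ltnS.
by case: (Zsum k (D^~ x)) => // ->.
Qed.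

End Avg.

(** * Random signs: moments and a maximal inequality *)

Section Rademacher.
Variables (R : realType) (I : finType).
Local Notation sgn := {ffun I -> bool}.
Implicit Types (r : {ffun I -> bool}) (b c : I -> R).

Definition rsg (t : bool) : R := (-1) ^+ t.
Definition rsum b r : R := \sum_i b i * rsg (r i).
Definition flip (A : pred I) r : sgn := [ffun i => A i (+) r i].

Lemma rsg_flip A r i : rsg (flip A r i) = (if A i then -1 else 1) * rsg (r i).
Proof. by rewrite /rsg ffunE; case: (A i); case: (r i); rewrite ?expr0 ?expr1; ring. Qed.

Lemma sqr_rsg t : rsg t ^+ 2 = 1.
Proof. by rewrite /rsg sqrr_sign. Qed.

Lemma norm_rsg t : `|rsg t| = 1.
Proof. by rewrite /rsg normr_sign. Qed.

Lemma flip_inj A : injective (flip A).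
Proof.
apply: (can_inj (g := flip A)) => r; apply/ffunP => i.
by rewrite !ffunE; case: (A i); case: (r i).
Qed.

Lemma card_sgn_gt0 : (0 < #|{: sgn}|)%N.
Proof. by rewrite card_ffun card_bool expn_gt0. Qed.

(** Flipping the signs in [A] permutes the sample space. Orthogonality of signs is always obtained
    from this. *)
Lemma avg_odd (A : pred I) (g : sgn -> R) : (forall r, g (flip A r) = - g r) -> avg g = 0.
Proof.
move=> gA; have := avg_inj (g : sgn -> R) (@flip_inj A).
by rewrite (eq_avg (g := fun r => - g r)) ?avgN//; lra.
Qed.

Lemma avg_rsg i : avg (fun r : sgn => rsg (r i)) = 0.
Proof. by apply: (@avg_odd (pred1 i)) => r; rewrite rsg_flip /= eqxx; ring. Qed.

Lemma avg_rsg2 i j : avg (fun r : sgn => rsg (r i) * rsg (r j)) = (i == j)%:R.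
Proof.
case: eqVneq => [->|ij].
  under eq_avg do rewrite -expr2 sqr_rsg.
  by rewrite avg_cst// card_sgn_gt0.
apply: (@avg_odd (pred1 i)) => r; rewrite !rsg_flip /= eqxx (eq_sym j) (negPf ij); ring.
Qed.

Lemma rsumD b c r : rsum (fun i => b i + c i) r = rsum b r + rsum c r.
Proof. by rewrite /rsum -big_split; apply: eq_bigr => i _; rewrite mulrDl. Qed.

Lemma rsumZ a b r : rsum (fun i => a * b i) r = a * rsum b r.
Proof. by rewrite /rsum mulr_sumr; apply: eq_bigr => i _; rewrite mulrA. Qed.

Lemma avg_rsum b : avg (rsum b) = 0.
Proof.
by rewrite avg_sum big1 // => i _; rewrite avgZ avg_rsg mulr0.
Qed.

Lemma avg_rsum_mul b c : avg (fun r => rsum b r * rsum c r) = \sum_i b i * c i.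
Proof.
under eq_avg do rewrite mulr_suml.
rewrite avg_sum; apply: eq_bigr => i _.
under eq_avg do rewrite mulr_sumr.
rewrite avg_sum (bigD1 i) //= big1 ?addr0 => [|j ji].
  under eq_avg do rewrite mulrACA.
  by rewrite avgZ avg_rsg2 eqxx mulr1.
under eq_avg do rewrite mulrACA.
by rewrite avgZ avg_rsg2 eq_sym (negPf ji) mulr0.
Qed.

Lemma avg_rsum_sqr b : avg (fun r => rsum b r ^+ 2) = \sum_i b i ^+ 2.
Proof.
by under eq_avg do rewrite expr2; rewrite avg_rsum_mul; under eq_bigr do rewrite -expr2.
Qed.

(** Khinchin's inequality for the exponent 4, by adding one sign at a time: odd powers of the new
    sign average out, and the rest is dominated by the expansion of [3 * (v + x) ^+ 2]. *)
Lemma avg_rsum4 b : avg (fun r => rsum b r ^+ 4) <= 3 * (\sum_i b i ^+ 2) ^+ 2.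
Proof.
pose S (s : seq I) r := \sum_(i <- s) b i * rsg (r i).
have S_flip s i r : i \notin s -> S s (flip (pred1 i) r) = S s r.
  move=> si; apply: eq_big_seq => j js; rewrite rsg_flip /=.
  by case: eqVneq => [ji|]; [rewrite -ji js in si|rewrite mul1r].
have S2 s : uniq s -> avg (fun r => S s r ^+ 2) = \sum_(i <- s) b i ^+ 2.
  elim: s => [_|i s IH /= /andP[si us]].
    by rewrite big_nil (eq_avg (g := fun=> 0)) ?avg0 // => r; rewrite /S big_nil expr0n.
  rewrite big_cons -(IH us) -[b i ^+ 2](avg_cst _ card_sgn_gt0).
  have o : avg (fun r => 2 * b i * (rsg (r i) * S s r)) = 0.
    by apply: (@avg_odd (pred1 i)) => r; rewrite S_flip// rsg_flip /= eqxx; ring.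
  rewrite -[RHS]addr0 -[X in _ = _ + X]o -!avgD.
  by apply: eq_avg => r; rewrite /S big_cons sqrrD exprMn sqr_rsg; ring.
suff H s : uniq s -> avg (fun r => S s r ^+ 4) <= 3 * (\sum_(i <- s) b i ^+ 2) ^+ 2.
  by have := H _ (index_enum_uniq I).
elim: s => [_|i s IH /= /andP[si us]].
  rewrite big_nil (eq_avg (g := fun=> 0)) ?avg0 => [|r]; last by rewrite /S big_nil expr0n.
  by rewrite expr0n mulr0.
have o1 : avg (fun r => 4 * b i * rsg (r i) * S s r ^+ 3 + 4 * b i ^+ 3 * rsg (r i) * S s r) = 0.
  by apply: (@avg_odd (pred1 i)) => r; rewrite S_flip// rsg_flip /= eqxx; ring.
have -> : avg (fun r => S (i :: s) r ^+ 4) =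
    avg (fun r => S s r ^+ 4) + 6 * b i ^+ 2 * avg (fun r => S s r ^+ 2) + b i ^+ 4.
  rewrite -[X in _ + X](avg_cst _ card_sgn_gt0) -avgZ -[RHS]addr0 -[X in _ = _ + X]o1 -!avgD.
  apply: eq_avg => r; rewrite {1}/S big_cons -/(S s r); have h := sqr_rsg (r i).
  have h3 : rsg (r i) ^+ 3 = rsg (r i) by rewrite exprS h mulr1.
  have h4 : rsg (r i) ^+ 4 = 1 by rewrite (exprM _ 2 2) h expr1n.
  transitivity (S s r ^+ 4 + 4 * b i * rsg (r i) * S s r ^+ 3 + 6 * b i ^+ 2 * rsg (r i) ^+ 2 * S s r ^+ 2
     + 4 * b i ^+ 3 * rsg (r i) ^+ 3 * S s r + b i ^+ 4 * rsg (r i) ^+ 4); first by ring.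
  by rewrite h h3 h4; ring.
rewrite S2// big_cons; have := IH us; set v := \sum_(j <- s) _ => h.
have v0 : 0 <= v by apply: sumr_ge0 => j _; exact: sqr_ge0.
have -> : b i ^+ 4 = (b i ^+ 2) ^+ 2 by rewrite -exprM.
have := sqr_ge0 (b i); set x := b i ^+ 2 => x0.
by have := sqr_ge0 x; nra.
Qed.

Lemma big_lev_lt (lev : I -> nat) (k : nat) (F : I -> R) :
  \sum_(j < k) \sum_(i | lev i == j :> nat) F i = \sum_(i | (lev i < k)%N) F i.
Proof.
transitivity (\sum_(j < k) \sum_i if lev i == j :> nat then F i else 0).
  by apply: eq_bigr => j _; rewrite big_mkcond.
rewrite exchange_big /= [RHS]big_mkcond; apply: eq_bigr => i _.
case: ifPn => ik; last first.
  by rewrite big1// => j _; case: eqP => // ij; rewrite ij ltn_ord in ik.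
rewrite (bigD1 (Ordinal ik)) //= eqxx big1 ?addr0// => j ji.
by case: eqP => // ij; rewrite -val_eqE /= ij eqxx in ji.
Qed.

(** All indices of one level enter together. Flipping every sign of level [k] negates the [k]-th
    increment and fixes the earlier ones, which is the orthogonality required by [kolmogorov]. It
    serves twice in [weak_type]: with [code] as level, and with the node [k] alone. *)
Lemma rademacher_maximal (lev : I -> nat) K b (lam : R) : 0 < lam ->
  prob R (fun r : sgn => [exists k : 'I_K.+1,
      lam < `|\sum_(i | (lev i < k)%N) b i * rsg (r i)|]) <=
    (\sum_i b i ^+ 2) / lam ^+ 2.
Proof.
move=> l0; pose D j r := \sum_(i | lev i == j) b i * rsg (r i).
have D_flip j k r : D j (flip (fun i => lev i == k) r) = (if j == k then -1 else 1) * D j r.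
  rewrite /D mulr_sumr; apply: eq_bigr => i /eqP ij; rewrite rsg_flip ij; ring.
have D2 j : avg (fun r => D j r ^+ 2) = \sum_(i | lev i == j) b i ^+ 2.
  transitivity (\sum_i (if lev i == j then b i else 0) ^+ 2).
    rewrite -avg_rsum_sqr; apply: eq_avg => r; congr (_ ^+ 2).
    by rewrite /D big_mkcond; apply: eq_bigr => i _; case: ifP; rewrite ?mul0r.
  by rewrite [RHS]big_mkcond; apply: eq_bigr => i _; case: ifP; rewrite ?expr0n.
apply: le_trans (le_trans (kolmogorov (D := D) (K := K) l0 _) _).
- apply: le_prob => r /existsP[k]; rewrite -big_lev_lt => h; by apply/existsP; exists k.
- move=> k z kK zloc; apply: (@avg_odd (fun i => lev i == k)) => r.
  rewrite D_flip eqxx mulN1r mulrN; congr (- (_ * _)); apply: zloc => j jk.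
  by rewrite D_flip ltn_eqF// mul1r.
- rewrite ler_wpM2r ?invr_ge0 ?sqr_ge0//.
  under eq_bigr do rewrite D2.
  rewrite big_lev_lt [leRHS](bigID (fun i => (lev i < K)%N)) /= lerDl.
  by apply: sumr_ge0 => i _; exact: sqr_ge0.
Qed.

End Rademacher.

(** * Menshov's gadget *)
Section Gadget.
Variable R : realType.

(* An orthonormal system [h] with few nonzero terms at each point, and a stopping
   index [m] at which all the stopped integrals equal [g], of the order of
   [(n / T)^(1/2)]. *)
Record gadget (n T : nat) (X : finType) (h : nat -> X -> R) (m : X -> nat) (g : R) : Prop := {
  gadget_card : (0 < #|X|)%N;
  gadget_m : forall x, (m x <= T)%N;
  gadget_avg0 : forall k, (k < T)%N -> avg (h k) = 0;
  gadget_ortho : forall k l, (k < T)%N -> (l < T)%N ->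
    avg (fun x => h k x * h l x) = (k == l)%:R;
  gadget_few : forall x, (\sum_(k < T) (h k x != 0%R) <= n)%N;
  gadget_stop : forall k, (k < T)%N -> avg (fun x => h k x * (k < m x)%:R) = g;
  gadget_size : 4 * T%:R * g ^+ 2 = n%:R }.

Lemma avg_bool (f : bool -> R) : avg f = (f true + f false) / 2.
Proof. by rewrite /avg card_bool big_bool. Qed.

Lemma avg_prod3 (T1 T2 T3 : finType) (f : T1 -> R) (g : T2 -> R) (h : T3 -> R) :
  avg (fun z : T1 * T2 * T3 => f z.1.1 * g z.1.2 * h z.2) = avg f * avg g * avg h.
Proof.
rewrite (avg_prod (fun z : T1 * T2 => f z.1 * g z.2) h); congr (_ * _).
exact: avg_prod.
Qed.

Lemma avg_pred1 (T : finType) (a : T) : avg (fun z : T => (z == a)%:R) = #|T|%:R^-1 :> R.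
Proof. by rewrite /avg (bigD1 a)//= eqxx big1 ?addr0 ?mul1r// => i /negPf ->. Qed.

Lemma gadget1 : gadget 1 1 (fun (_ : nat) b => rsg R b) (fun b : bool => ~~ b) (1/2).
Proof.
split => //.
- by rewrite card_bool.
- by case.
- by move=> k _; rewrite avg_bool /rsg; lra.
- case=> // -[]// _ _; rewrite eqxx.
  by under eq_avg do rewrite -expr2 sqr_rsg; rewrite avg_cst ?card_bool.
- by move=> x; rewrite big_ord1; case: (_ != _).
- by case=> // _; rewrite avg_bool /rsg /=; lra.
- by lra.
Qed.

(* The in-order traversal of a dyadic Haar tree: left subtree, root, right
   subtree; the root is split into [T0] orthogonal copies of equal height so
   that all the [g] agree. *)
Lemma gadgetS n T X h m (T0 : nat) (g : R) : @gadget n T X h m g -> (0 < T0)%N ->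
  (0 < g) -> 2 * T0%:R * g ^+ 2 = 1 ->
  exists h' m', @gadget n.+1 (T + (T0 + T)) (bool * X * 'I_T0)%type h' m' (g / Num.sqrt 2).
Proof.
move=> [X0 mT h0 hh few stop size] T00 g0 T0g.
have s2 : Num.sqrt 2 ^+ 2 = 2 :> R by rewrite sqr_sqrtr.
have s0 : 0 < Num.sqrt 2 :> R by rewrite sqrtr_gt0.
have st : Num.sqrt T0%:R ^+ 2 = T0%:R :> R by rewrite sqr_sqrtr.
have cT : #|'I_T0|%:R = T0%:R :> R by rewrite card_ord.
have cT0 : T0%:R != 0 :> R by rewrite pnatr_eq0 -lt0n.
have I0 : (0 < #|'I_T0|)%N by rewrite card_ord.
(* Indices run through the left subtree, the [T0] roots and the right subtree. [A] selects the half
   of the space ([sqrt 2] restores the norm), [B] is the smaller gadget, and [C] gives the roots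
   disjoint supports, so that only one of them counts at each point. *)
pose A (k : nat) (b : bool) : R := if (k < T)%N then Num.sqrt 2 * (~~ b)%:R else
  if (k < T + T0)%N then - rsg R b else Num.sqrt 2 * b%:R.
pose B (k : nat) (x : X) : R := if (k < T)%N then h k x else
  if (k < T + T0)%N then 1 else h (k - (T + T0))%N x.
pose C (k : nat) (z : 'I_T0) : R := if (k < T)%N then 1 else
  if (k < T + T0)%N then Num.sqrt T0%:R * (z == k - T :> nat)%N%:R else 1.
pose h' k (y : bool * X * 'I_T0) := A k y.1.1 * B k y.1.2 * C k y.2.
(* On the left half the walk stops within the left subtree, before any root. On the right half it
   passes the left functions, which vanish there, and all the roots, which are nonnegative there. *)
pose m' (y : bool * X * 'I_T0) := ((if y.1.1 then T + T0 else 0) + m y.1.2)%N.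
have hk1 k : (k < T)%N -> avg (fun x => h k x * 1) = 0.
  by move=> kT; under eq_avg do rewrite mulr1; exact: h0.
have h1k k : (k < T)%N -> avg (fun x => 1 * h k x) = 0.
  by move=> kT; under eq_avg do rewrite mul1r; exact: h0.
have avgz k : (T <= k)%N -> (k < T + T0)%N -> avg (fun z : 'I_T0 => (z == k - T :> nat)%N%:R) = T0%:R^-1 :> R.
  move=> Tk kT; have lk : (k - T < T0)%N by lia.
  rewrite -cT -(avg_pred1 (Ordinal lk)); apply: eq_avg => z.
  by rewrite -val_eqE.
have orth k l : (k <= l)%N -> (l < T + (T0 + T))%N ->
    avg (fun y => h' k y * h' l y) = (k == l)%:R.
  move=> kl lT; pose fA b := A k b * A l b; pose fB x := B k x * B l x.
  pose fC z := C k z * C l z.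
  transitivity (avg fA * avg fB * avg fC).
    by rewrite -avg_prod3; apply: eq_avg => y; rewrite /h' /fA /fB /fC; ring.
  rewrite /fA /fB /fC /A /B /C {fA fB fC}.
  case: (ltnP k T) => kT; case: (ltnP l T) => lT1; try (case: (ltnP k (T + T0)) => kT2; try lia); try (case: (ltnP l (T + T0)) => lT2; try lia).
  - rewrite hh// avg_cst// avg_bool /= mulr1.
    rewrite (_ : _ * (1 * 1) = Num.sqrt 2 ^+ 2 / 2 * (k == l)%:R); last by field.
    by rewrite s2 divff ?mul1r ?pnatr_eq0.
  - by rewrite hk1// mulr0 mul0r; case: eqP => //; lia.
  - by rewrite avg_bool /=; rewrite !(mulr0, mul0r, addr0, add0r); case: eqP => //; lia.
  - rewrite avg_bool avg_cst// /rsg /=.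
    case: eqVneq => [<-|kl'].
      under eq_avg do rewrite mulrACA -!expr2 st -natrX mulrC.
      rewrite avgZr (eq_avg (g := fun z : 'I_T0 => (z == k - T :> nat)%N%:R)) => [|z]; last by case: eqP.
      by rewrite avgz// mulVf// expr0 expr1 /=; lra.
    under [X in _ * X]eq_avg => z.
      rewrite mulrACA -natrM (_ : (_ * _)%N = 0%N) ?mulr0; last first.
        by case: eqP => //; case: eqP => //; lia.
      over.
    by rewrite avg0 mulr0.
  - by rewrite h1k; [rewrite mulr0 mul0r; apply/esym; case: eqP => //; lia|lia].
  - rewrite hh; [|lia..].
    rewrite avg_cst// avg_bool /= mulr1 (_ : (_ == _) = (k == l)); last by apply/eqP/eqP; lia.
    rewrite (_ : _ * (1 * 1) = Num.sqrt 2 ^+ 2 / 2 * (k == l)%:R); last by field.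
    by rewrite s2 divff ?mul1r ?pnatr_eq0.
exists h', m'; split.
- by rewrite !card_prod card_bool card_ord !muln_gt0 X0 T00.
- by move=> [[b x] z]; rewrite /m' /=; have := mT x; case: b; lia.
- move=> k kT; rewrite /h' avg_prod3 /A /B.
  case: ltnP => k1; first by rewrite h0// mulr0 mul0r.
  case: ltnP => k2; first by rewrite avg_bool /rsg /=; ring.
  by rewrite h0; [rewrite mulr0 mul0r|lia].
- move=> k l kT lT; case: (leqP k l) => kl; first exact: orth.
  rewrite eq_sym -(orth l k (ltnW kl) kT); apply: eq_avg => y; exact: mulrC.
- move=> -[[b x] z]; rewrite big_split_ord /= big_split_ord /= /h' /A /B /C /=.
  under eq_bigr => i _ do rewrite ltn_ord mulr1.
  have e1 (i : 'I_T0) : (T + i < T)%N = false by lia.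
  have e2 (i : 'I_T0) : (T + i < T + T0)%N = true by have := ltn_ord i; lia.
  have f1 (i : 'I_T) : (T + (T0 + i) < T)%N = false by lia.
  have f2 (i : 'I_T) : (T + (T0 + i) < T + T0)%N = false by lia.
  have f3 (i : 'I_T) : (T + (T0 + i) - (T + T0))%N = i by lia.
  under [X in (_ + (X + _))%N]eq_bigr => i _ do rewrite e1 e2 addKn.
  under [X in (_ + (_ + X))%N]eq_bigr => i _ do rewrite f1 f2 f3 mulr1.
  have mid : (\sum_(i < T0) ((- rsg R b * 1 * (Num.sqrt T0%:R * (z == i)%:R))%R != 0%R) <= 1)%N.
    apply: (@leq_trans (\sum_(i < T0) (z == i))); last first.
      by rewrite (bigD1 z)//= eqxx big1// => i; rewrite eq_sym => /negPf ->.
    apply: leq_sum => i _; case: (eqVneq z i) => _; first exact: leq_b1.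
    by rewrite mulr0 mulr0 eqxx.
  have side (c : bool) : (\sum_(i < T) ((Num.sqrt 2 * c%:R * h i x)%R != 0%R) <= if c then n else 0)%N.
    case: c; last by rewrite big1// => i _; rewrite /= mulr0 mul0r eqxx.
    apply: leq_trans (few x); apply: leq_sum => i _.
    by case: (eqVneq (h i x) 0) => [->|_]; [rewrite mulr0 eqxx|exact: leq_b1].
  by have := side b; have := side (~~ b); move: mid; case: (b) => /= p1 p2 p3; [apply: (leq_trans (leq_add p2 (leq_add p1 p3)))|apply: (leq_trans (leq_add p2 (leq_add p1 p3)))]; lia.
- move=> k kT.
  (* A stopped root function has mean [1 / (2 sqrt T0)], which is the required [g / sqrt 2] exactly
     when [2 * T0 * g^2 = 1]. *)
  have asg : Num.sqrt T0%:R * Num.sqrt 2 * g = 1.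
    apply/eqP; rewrite -sqrp_eq1 ?mulr_ge0 ?sqrtr_ge0// ?(ltW g0)//.
    by rewrite !exprMn st s2; apply/eqP; rewrite -[RHS]T0g; ring.
  have gs : g / Num.sqrt 2 = Num.sqrt 2 / 2 * g.
    apply: (mulIf (lt0r_neq0 s0)); rewrite divfK ?gt_eqF//.
    by rewrite [RHS](_ : _ = Num.sqrt 2 ^+ 2 / 2 * g); [rewrite s2; field|ring].
  have [kT1|kT1] := ltnP k T.
    transitivity (avg (fun b : bool => Num.sqrt 2 * (~~ b)%:R) *
        avg (fun x => h k x * (k < m x)%:R) * avg (fun z : 'I_T0 => 1 : R)).
      rewrite -avg_prod3; apply: eq_avg => -[[b x] z].
      rewrite /h' /m' /A /B /C /= kT1; case: b => /=; last by rewrite add0n; ring.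
      by rewrite !(mulr0, mul0r).
    by rewrite stop// avg_bool avg_cst// gs /= !(mulr0, mulr1, add0r).
  have [kT2|kT2] := ltnP k (T + T0).
    transitivity (avg (fun b : bool => b%:R : R) *
        avg (fun x : X => 1 : R) * avg (fun z : 'I_T0 => Num.sqrt T0%:R * (z == k - T :> nat)%N%:R)).
      rewrite -avg_prod3; apply: eq_avg => -[[b x] z].
      rewrite /h' /m' /A /B /C /= ltnNge kT1 /= kT2 /rsg; case: b => /=.
        by rewrite (_ : (k < _)%N = true); [rewrite expr1 /=; ring|lia].
      by rewrite (_ : (k < _)%N = false) ?mulr0 ?mul0r//; have := mT x; lia.
    rewrite avg_cst// avgZ avgz// avg_bool /=.
    have a0 : Num.sqrt T0%:R != 0 :> R by rewrite sqrtr_eq0 -ltNge ltr0n.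
    have ai : (Num.sqrt T0%:R)^-1 = Num.sqrt 2 * g :> R.
      by apply: (mulfI a0); rewrite divff// mulrA asg.
    have -> : Num.sqrt T0%:R / T0%:R = Num.sqrt 2 * g :> R.
      by rewrite -{2}st expr2 invfM mulrA divff// mul1r ai.
    by rewrite gs; ring.
  transitivity (avg (fun b : bool => Num.sqrt 2 * b%:R) *
      avg (fun x => h (k - (T + T0))%N x * (k - (T + T0) < m x)%N%:R) * avg (fun z : 'I_T0 => 1 : R)).
    rewrite -avg_prod3; apply: eq_avg => -[[b x] z].
    rewrite /h' /m' /A /B /C /= ltnNge kT1 /= ltnNge kT2; case: b => /=.
      by rewrite ltn_subLR; [ring|lia].
    by rewrite !(mulr0, mul0r).
  by rewrite stop; [rewrite avg_bool avg_cst// gs /= !(mulr0, mulr1, addr0)|lia].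
- rewrite !natrD mulrDr mulrDl expr_div_n s2; have : T0%:R * g ^+ 2 = 1/2 by lra.
  rewrite -[n.+1]addn1 natrD -size; lra.
Qed.

(** Each application of [gadgetS] halves [g^2], so the number of root copies has to double;
    [2 * 2^(n+1) * g^2 = 1] is the invariant. *)
Lemma menshov_gadget n : exists (T : nat) (X : finType) (h : nat -> X -> R) (m : X -> nat) (g : R),
  [/\ (0 < T)%N, 0 < g & gadget n.+1 T h m g].
Proof.
suff [T [X [h [m [g [T0 g0 gsize G]]]]]] : exists (T : nat) (X : finType) (h : nat -> X -> R) (m : X -> nat) (g : R),
    [/\ (0 < T)%N, 0 < g, 2 * (2 ^ n.+1)%:R * g ^+ 2 = 1 & gadget n.+1 T h m g].
  by exists T, X, h, m, g.
elim: n => [|n [T [X [h [m [g [T0 g0 gsize G]]]]]]].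
  exists 1%N, bool, (fun (_ : nat) b => rsg R b), (fun b : bool => ~~ b), (1/2).
  by split; [by []|lra|rewrite expn1; lra|exact: gadget1].
have e0 : (0 < 2 ^ n.+1)%N by rewrite expn_gt0.
have [h' [m' G']] := gadgetS G e0 g0 gsize.
exists (T + (2 ^ n.+1 + T))%N, (bool * X * 'I_(2 ^ n.+1))%type, h', m', (g / Num.sqrt 2).
split => //; [by rewrite addn_gt0 T0|by rewrite divr_gt0// sqrtr_gt0|].
by rewrite expnS natrM expr_div_n sqr_sqrtr// -[RHS]gsize; field.
Qed.

End Gadget.

(** * Orthonormal expansions and sums cut inside a round *)

Section Rounds.
Variable R : realType.

Lemma avg_fst (T1 T2 : finType) (f : T1 -> R) : (0 < #|T2|)%N ->
  avg (fun z : T1 * T2 => f z.1) = avg f.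
Proof. by move=> T20; rewrite avg_pair; apply: eq_avg => x /=; exact: avg_cst. Qed.

Lemma avg_snd (T1 T2 : finType) (f : T2 -> R) : (0 < #|T1|)%N ->
  avg (fun z : T1 * T2 => f z.2) = avg f.
Proof. by move=> T10; rewrite avg_pair /= avg_cst. Qed.

Lemma avg_ortho (J X : finType) (H : J -> X -> R) (a b : J -> R) :
  (forall i j, avg (fun x => H i x * H j x) = (i == j)%:R) ->
  avg (fun x => (\sum_i a i * H i x) * (\sum_i b i * H i x)) = \sum_i a i * b i.
Proof.
move=> flat_walk; under eq_avg do rewrite mulr_suml.
rewrite avg_sum; apply: eq_bigr => i _; under eq_avg do rewrite mulr_sumr.
rewrite avg_sum (bigD1 i)//= big1 ?addr0 => [|j ji].
  by under eq_avg do rewrite mulrACA; rewrite avgZ flat_walk eqxx mulr1.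
by under eq_avg do rewrite mulrACA; rewrite avgZ flat_walk eq_sym (negPf ji) mulr0.
Qed.

Lemma avg_ortho_sqr (J X : finType) (H : J -> X -> R) (a : J -> R) :
  (forall i j, avg (fun x => H i x * H j x) = (i == j)%:R) ->
  avg (fun x => (\sum_i a i * H i x) ^+ 2) = \sum_i a i ^+ 2.
Proof.
by move=> flat_walk; under eq_avg do rewrite expr2; rewrite avg_ortho.
Qed.

Lemma sqr_sum2_le (a b : R) : (a + b) ^+ 2 <= 2 * a ^+ 2 + 2 * b ^+ 2.
Proof. by have := sqr_ge0 (a - b); lra. Qed.

(* Cutting a double sum at an arbitrary place leaves a number of complete
   rounds, handled by Cauchy-Schwarz in the number of rounds, and a part of a
   single round. *)
Lemma cut_rounds (P : finType) (rho : P -> nat) (d : nat) (w : P -> 'I_d -> R) (G : 'I_d -> R) m :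
  injective rho ->
  (\sum_p \sum_(c < d) (if (rho p * d + c < m)%N then w p c else 0) * G c) ^+ 2 <=
  2 * #|P|%:R * (\sum_p (\sum_c w p c * G c) ^+ 2) +
  2 * (\sum_p \sum_(c < d) w p c ^+ 2) * (\sum_c G c ^+ 2).
Proof.
move=> rho_inj.
pose S p := \sum_(c < d) (if (rho p * d + c < m)%N then w p c else 0) * G c.
pose a p := if (rho p < m %/ d)%N then \sum_c w p c * G c else 0.
pose b p := if rho p == (m %/ d)%N then S p else 0.
have SE p : S p = a p + b p.
  rewrite /a /b; case: (ltngtP (rho p) (m %/ d)) => h; rewrite ?addr0 ?add0r//.
    apply: eq_bigr => c _; have d0 : (0 < d)%N by case: (d) c => [[]|].
    rewrite (_ : (_ < m)%N = true)//; have := ltn_ord c; have := leq_divM m d.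
    have : ((rho p).+1 * d <= m %/ d * d)%N by rewrite leq_mul2r h orbT.
    rewrite mulSn; lia.
  apply: big1 => c _; have d0 : (0 < d)%N by case: (d) c => [[]|].
  rewrite (_ : (_ < m)%N = false) ?mul0r//; have := ltn_ceil m d0.
  have : ((m %/ d).+1 * d <= rho p * d)%N by rewrite leq_mul2r h orbT.
  lia.
rewrite (eq_bigr (fun p => a p + b p)); last by move=> p _; exact: SE.
rewrite big_split /=; apply: le_trans (sqr_sum2_le _ _) _; rewrite -!mulrA -!mulrDr.
apply: ler_wpM2l => //; apply: lerD.
  apply: le_trans (sqr_sum_le_card (n := #|P|) _) _; first exact: max_card.
  apply: ler_wpM2l => //; apply: ler_sum => p _; rewrite /a.
  by case: ifP => // _; rewrite expr0n sqr_ge0.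
apply: le_trans (sqr_sum_le_card (n := 1) _) _.
  apply/card_le1_eqP => p q; rewrite !inE /b.
  case: (rho p =P (m %/ d)%N) => [hp _|_]; last by rewrite eqxx.
  case: (rho q =P (m %/ d)%N) => [hq _|_]; last by rewrite eqxx.
  by apply/rho_inj; rewrite hp hq.
rewrite mul1r mulr_suml; apply: ler_sum => p _; rewrite /b; case: ifP => _; last first.
  by rewrite expr0n /= mulr_ge0// sumr_ge0// => i _; exact: sqr_ge0.
apply: le_trans (sum_cauchy_schwarz _ _ _ _) _; apply: ler_wpM2r.
  by rewrite sumr_ge0// => i _; exact: sqr_ge0.
apply: ler_sum => c _; case: ifP => // _; rewrite expr0n; exact: sqr_ge0.
Qed.

End Rounds.

(** * The block functions *)
Section Coordinates.
Variables (R : realType) (T L d : nat).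
Hypotheses (T_gt0 : (0 < T)%N) (L_gt0 : (0 < L)%N).

(* A vector [u] of the block has coordinates [u (k, p, c)].  The block maps it to
     sum_c t_c f_c + sum_i b_i r_i + (3/5) W sum_c gamma_c sum_k y_kc h_k
   with independent signs [r], [gamma], weight [W] and gadget [h], where
   [t_c] = [tc u c] are the coordinates on the old functions and the remaining
   energy is split between [bb u] and [yk u] by (4/5)^2 + (3/5)^2 = 1. *)
Definition index := ('I_T * 'I_L * 'I_d)%type.
Implicit Types (u : index -> R) (k : 'I_T) (p : 'I_L) (c : 'I_d).

Definition sT : R := (Num.sqrt T%:R)^-1.
Definition sL : R := (Num.sqrt L%:R)^-1.
(** Coordinates with respect to unit vectors: [vk] along the normalized sum over the rounds of node
    [k], [tc] along the normalized sum over all nodes and rounds; [yk] is the component of [vk]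
    orthogonal to [tc]. *)
Definition vk u k c : R := sL * \sum_p u (k, p, c).
Definition tc u c : R := sT * \sum_k vk u k c.
Definition yk u k c : R := vk u k c - sT * tc u c.
(** The components [vk] are removed and 4/5 of [yk] is put back; [tc] and the remaining 3/5 of [yk]
    go to the other two parts of the block. *)
Definition bb u (i : index) : R :=
  u i - sL * (vk u i.1.1 i.2 - 4/5 * yk u i.1.1 i.2).

Lemma sT2 : sT ^+ 2 * T%:R = 1.
Proof. by rewrite /sT exprVn sqr_sqrtr// mulVf// pnatr_eq0 -lt0n. Qed.

Lemma sL2 : sL ^+ 2 * L%:R = 1.
Proof. by rewrite /sL exprVn sqr_sqrtr// mulVf// pnatr_eq0 -lt0n. Qed.

Lemma sT_gt0 : 0 < sT. Proof. by rewrite invr_gt0 sqrtr_gt0 ltr0n. Qed.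
Lemma sL_gt0 : 0 < sL. Proof. by rewrite invr_gt0 sqrtr_gt0 ltr0n. Qed.

Lemma sum_index (F : index -> R) : \sum_i F i = \sum_k \sum_c \sum_p F (k, p, c).
Proof.
transitivity (\sum_k \sum_p \sum_c F (k, p, c)).
  rewrite pair_bigA /= [RHS](eq_bigr (fun kp : 'I_T * 'I_L => \sum_c F (kp, c))); last by case.
  by rewrite pair_bigA /=; apply: eq_bigr => -[[]].
by apply: eq_bigr => k _; rewrite exchange_big.
Qed.

Lemma sum_u u k c : \sum_p u (k, p, c) = sL * L%:R * vk u k c.
Proof. by rewrite /vk mulrA (mulrAC _ L%:R) -expr2 sL2 mul1r. Qed.

Lemma sum_vk u c : \sum_k vk u k c = sT * T%:R * tc u c.
Proof. by rewrite /tc mulrA (mulrAC _ T%:R) -expr2 sT2 mul1r. Qed.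

Lemma sum_yk2 u c : \sum_k yk u k c ^+ 2 = \sum_k vk u k c ^+ 2 - tc u c ^+ 2.
Proof.
transitivity (\sum_k (vk u k c ^+ 2 + (- (2 * sT * tc u c) * vk u k c + (sT * tc u c) ^+ 2))).
  by apply: eq_bigr => k _; rewrite /yk; ring.
rewrite !big_split /= -mulr_sumr sum_vk sumr_const card_ord -[_ *+ T]mulr_natr.
transitivity (\sum_k vk u k c ^+ 2 + (- (2 * (sT ^+ 2 * T%:R) * tc u c ^+ 2) + (sT ^+ 2 * T%:R) * tc u c ^+ 2)).
  by ring.
by rewrite sT2; ring.
Qed.

Lemma sum_bb2 u k c :
  \sum_p bb u (k, p, c) ^+ 2 = \sum_p u (k, p, c) ^+ 2 - vk u k c ^+ 2 + 16/25 * yk u k c ^+ 2.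
Proof.
pose a := vk u k c - 4/5 * yk u k c.
transitivity (\sum_p (u (k, p, c) ^+ 2 + (- (2 * sL * a) * u (k, p, c) + (sL * a) ^+ 2))).
  by apply: eq_bigr => p _; rewrite /bb /= -/a; ring.
rewrite !big_split /= -mulr_sumr sum_u sumr_const card_ord -[_ *+ L]mulr_natr.
transitivity (\sum_p u (k, p, c) ^+ 2 + (- (2 * (sL ^+ 2 * L%:R) * a * vk u k c) + (sL ^+ 2 * L%:R) * a ^+ 2)).
  by ring.
by rewrite sL2 /a; field.
Qed.

Lemma energy u : \sum_i u i ^+ 2 =
  \sum_c tc u c ^+ 2 + (\sum_i bb u i ^+ 2 + 9/25 * \sum_c \sum_k yk u k c ^+ 2).
Proof.
rewrite !sum_index exchange_big /= [X in _ + (X + _)]exchange_big /=.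
rewrite mulr_sumr -!big_split /=; apply: eq_bigr => c _.
under [X in _ + (X + _)]eq_bigr do rewrite sum_bb2.
rewrite big_split /= sumrB -mulr_sumr; have := sum_yk2 u c; lra.
Qed.

Lemma sum_vk2_le u k c : vk u k c ^+ 2 <= \sum_p u (k, p, c) ^+ 2.
Proof.
rewrite -subr_ge0 (_ : _ - _ = \sum_p (u (k, p, c) - sL * vk u k c) ^+ 2).
  by apply: sumr_ge0 => p _; exact: sqr_ge0.
transitivity (\sum_p (u (k, p, c) ^+ 2 + (- (2 * sL * vk u k c) * u (k, p, c) + (sL * vk u k c) ^+ 2))); last first.
  by apply: eq_bigr => p _; ring.
rewrite !big_split /= -mulr_sumr sum_u sumr_const card_ord -[_ *+ L]mulr_natr.
transitivity (\sum_p u (k, p, c) ^+ 2 + (- (2 * (sL ^+ 2 * L%:R) * vk u k c ^+ 2) + (sL ^+ 2 * L%:R) * vk u k c ^+ 2)).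
  by rewrite sL2; ring.
by ring.
Qed.

Lemma sum_vk2 u : \sum_k \sum_c vk u k c ^+ 2 <= \sum_i u i ^+ 2.
Proof.
rewrite sum_index; apply: ler_sum => k _; apply: ler_sum => c _; exact: sum_vk2_le.
Qed.

Lemma sum_bb2_ge0 u : 0 <= \sum_i bb u i ^+ 2.
Proof. by apply: sumr_ge0 => i _; exact: sqr_ge0. Qed.

Lemma sum_yk2_ge0 u : 0 <= \sum_c \sum_k yk u k c ^+ 2.
Proof. by do 2 (apply: sumr_ge0 => ? _); exact: sqr_ge0. Qed.

Lemma sum_tc2 u : \sum_c tc u c ^+ 2 <= \sum_i u i ^+ 2.
Proof. by rewrite energy; have := sum_bb2_ge0 u; have := sum_yk2_ge0 u; lra. Qed.

(** The [yk] share alone contributes [(4/5)^2] of the energy of [yk] to [bb]. Hence the sign part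
    holds a fixed proportion of the fresh energy, wherever that energy sits. *)
Lemma sum_bb2_lower u : 16/25 * (\sum_i bb u i ^+ 2 + 9/25 * \sum_c \sum_k yk u k c ^+ 2)
  <= \sum_i bb u i ^+ 2.
Proof.
suff : 16/25 * \sum_c \sum_k yk u k c ^+ 2 <= \sum_i bb u i ^+ 2.
  by have := sum_yk2_ge0 u; lra.
rewrite sum_index exchange_big /= mulr_sumr; apply: ler_sum => k _.
rewrite mulr_sumr; apply: ler_sum => c _.
by rewrite sum_bb2; have := sum_vk2_le u k c; lra.
Qed.

(* The vector representing the [c]-th old function. *)
Definition ac c (i : index) : R := sT * sL * (i.2 == c)%:R.

Lemma vk_ac c k c' : vk (ac c) k c' = sT * (c' == c)%:R.
Proof.
rewrite /vk /ac /= sumr_const card_ord -[_ *+ L]mulr_natr.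
by transitivity (sL ^+ 2 * L%:R * (sT * (c' == c)%:R)); [ring|rewrite sL2 mul1r].
Qed.

Lemma tc_ac c c' : tc (ac c) c' = (c' == c)%:R.
Proof.
rewrite /tc (eq_bigr (fun=> sT * (c' == c)%:R)) => [|k _]; last exact: vk_ac.
rewrite sumr_const card_ord -[_ *+ T]mulr_natr.
by transitivity (sT ^+ 2 * T%:R * (c' == c)%:R); [ring|rewrite sT2 mul1r].
Qed.

Lemma yk_ac c k c' : yk (ac c) k c' = 0.
Proof. by rewrite /yk vk_ac tc_ac subrr. Qed.

Lemma bb_ac c i : bb (ac c) i = 0.
Proof. by rewrite /bb yk_ac vk_ac /ac; ring. Qed.

Lemma vkD u v k c : vk (fun i => u i + v i) k c = vk u k c + vk v k c.
Proof. by rewrite /vk big_split mulrDr. Qed.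
Lemma vkZ a u k c : vk (fun i => a * u i) k c = a * vk u k c.
Proof. by rewrite /vk -mulr_sumr mulrCA. Qed.
Lemma tcD u v c : tc (fun i => u i + v i) c = tc u c + tc v c.
Proof. by rewrite /tc -mulrDr -big_split /=; under eq_bigr do rewrite vkD. Qed.
Lemma tcZ a u c : tc (fun i => a * u i) c = a * tc u c.
Proof. by rewrite /tc mulrCA; congr (_ * _); rewrite mulr_sumr; apply: eq_bigr => k _; rewrite vkZ. Qed.
Lemma ykD u v k c : yk (fun i => u i + v i) k c = yk u k c + yk v k c.
Proof. by rewrite /yk vkD tcD; ring. Qed.
Lemma ykZ a u k c : yk (fun i => a * u i) k c = a * yk u k c.
Proof. by rewrite /yk vkZ tcZ; ring. Qed.
Lemma bbD u v i : bb (fun i => u i + v i) i = bb u i + bb v i.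
Proof. by rewrite /bb ykD vkD; ring. Qed.
Lemma bbZ a u i : bb (fun i => a * u i) i = a * bb u i.
Proof. by rewrite /bb ykZ vkZ; ring. Qed.

End Coordinates.

(** * Moments of the fresh part of a block *)

Section BlockFunctions.
Variables (R : realType) (T L d D n : nat) (X : finType).
Variables (h : nat -> X -> R) (m : X -> nat) (g : R).
Hypotheses (T_gt0 : (0 < T)%N) (L_gt0 : (0 < L)%N) (D_gt0 : (0 < D)%N).
Hypothesis G : gadget n T h m g.
Local Notation I := (index T L d).
Implicit Types (u : I -> R).

Definition noise := ({ffun I -> bool} * {ffun 'I_d -> bool} * 'I_D * X)%type.

Definition harm : R := \sum_(w < D) w.+1%:R^-1.
(* [avg weight^2 = 1], but [weight] exceeds [x] with probability of order
   [1 / (x^2 harm)] as long as [x] is below [(D / harm)^(1/2)]. *)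
Definition weight (w : 'I_D) : R := Num.sqrt (D%:R / w.+1%:R / harm).
Definition yh u (x : X) (c : 'I_d) : R := \sum_k yk u k c * h k x.
Definition psi u (z : noise) : R :=
  rsum (bb u) z.1.1.1 + 3/5 * weight z.1.2 * rsum (yh u z.2) z.1.1.2.

Let X_gt0 : (0 < #|X|)%N := gadget_card G.
Let ID_gt0 : (0 < #|'I_D|)%N. Proof. by rewrite card_ord. Qed.

Lemma card_noise : #|{: noise}| = (2 ^ (T * L * d) * 2 ^ d * D * #|X|)%N.
Proof. by rewrite !card_prod !card_ffun !card_prod !card_ord card_bool. Qed.

Lemma card_noise_gt0 : (0 < #|{: noise}|)%N.
Proof. by rewrite card_noise !muln_gt0 !expn_gt0 D_gt0 X_gt0. Qed.

Lemma harm_gt0 : 0 < harm.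
Proof.
rewrite /harm; case: D D_gt0 => // D' _; rewrite big_ord_recl /=.
rewrite ltr_pwDl ?invr_gt0 ?ltr0n//; apply: sumr_ge0 => i _; by rewrite invr_ge0.
Qed.

Lemma weight_sqr w : weight w ^+ 2 = D%:R / w.+1%:R / harm.
Proof. by rewrite sqr_sqrtr// !divr_ge0// ltW// harm_gt0. Qed.

Lemma avg_weight_sqr : avg (fun w => weight w ^+ 2) = 1.
Proof.
under eq_avg do rewrite weight_sqr; rewrite avgZr.
rewrite /avg -mulr_sumr -/harm card_ord.
by field; rewrite gt_eqF ?harm_gt0// pnatr_eq0 -lt0n.
Qed.

Lemma avg_noise (F : noise -> R) :
  avg F = avg (fun w => avg (fun x => avg (fun r => avg (fun ga => F (r, ga, w, x))))).
Proof.
rewrite avg_pair avg_pair avg_pair.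
transitivity (avg (fun r => avg (fun w => avg (fun x => avg (fun ga => F (r, ga, w, x)))))).
  apply: eq_avg => r; rewrite avg_exchange; apply: eq_avg => w.
  exact: avg_exchange.
by rewrite avg_exchange; apply: eq_avg => w; rewrite avg_exchange.
Qed.

Lemma avg_two_rsums (J K : finType) (a : J -> R) (b : K -> R) q :
  avg (fun r => avg (fun ga => (rsum a r + q * rsum b ga) ^+ 2)) =
  \sum_i a i ^+ 2 + q ^+ 2 * \sum_j b j ^+ 2.
Proof.
transitivity (avg (fun r => rsum a r ^+ 2 + q ^+ 2 * \sum_j b j ^+ 2)); last first.
  by rewrite avgD avg_rsum_sqr avg_cst// card_sgn_gt0.
apply: eq_avg => r; rewrite -[rsum a r ^+ 2](@avg_cst _ {ffun K -> bool}) ?card_sgn_gt0//.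
rewrite -avg_rsum_sqr -avgZ -avgD -[RHS]addr0 -(mulr0 (2 * rsum a r * q)) -(avg_rsum b) -avgZ -avgD.
by apply: eq_avg => ga; ring.
Qed.

Lemma avg_two_rsums_mul (J K : finType) (a : J -> R) (b : K -> R) q :
  avg (fun r => avg (fun ga => rsum a r * (rsum a r + q * rsum b ga))) = \sum_i a i ^+ 2.
Proof.
rewrite -avg_rsum_sqr; apply: eq_avg => r.
rewrite avgZ avgD avgZ avg_rsum mulr0 addr0 avg_cst ?card_sgn_gt0//.
Qed.

Lemma gadget_ortho_ord (i j : 'I_T) : avg (fun x => h i x * h j x) = (i == j)%:R.
Proof. by rewrite (gadget_ortho G). Qed.

Lemma avg_psi u : avg (psi u) = 0.
Proof.
rewrite avg_noise -(avg0 R 'I_D); apply: eq_avg => w; rewrite -(avg0 R X); apply: eq_avg => x.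
rewrite /psi /= -(avg_rsum (bb u)); apply: eq_avg => r.
by rewrite avgD avgZ avg_rsum mulr0 addr0 avg_cst// card_sgn_gt0.
Qed.

Lemma avg_psi2 u : avg (fun z => psi u z ^+ 2) =
  \sum_i bb u i ^+ 2 + 9/25 * \sum_c \sum_k yk u k c ^+ 2.
Proof.
rewrite avg_noise /psi /=.
transitivity (avg (fun w => avg (fun x : X =>
    \sum_i bb u i ^+ 2 + (3/5 * weight w) ^+ 2 * \sum_c yh u x c ^+ 2))).
  by apply: eq_avg => w; apply: eq_avg => x; rewrite avg_two_rsums.
transitivity (avg (fun w : 'I_D => \sum_i bb u i ^+ 2 + weight w ^+ 2 * (9/25 * \sum_c \sum_k yk u k c ^+ 2))).
  apply: eq_avg => w; rewrite avgD avg_cst//; congr (_ + _).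
  rewrite avgZ avg_sum (_ : \sum_i _ = \sum_c \sum_k yk u k c ^+ 2); first by field.
  by apply: eq_bigr => c _; apply: avg_ortho_sqr; exact: gadget_ortho_ord.
by rewrite avgD avg_cst// avgZr avg_weight_sqr mul1r.
Qed.

Lemma avg_rsum_noise (F : R -> R) (b : I -> R) :
  avg (fun z : noise => F (rsum b z.1.1.1)) = avg (fun r => F (rsum b r)).
Proof.
rewrite (avg_fst (fun z : {ffun I -> bool} * {ffun 'I_d -> bool} * 'I_D => F (rsum b z.1.1)))//.
rewrite (avg_fst (fun z : {ffun I -> bool} * {ffun 'I_d -> bool} => F (rsum b z.1)))//.
by rewrite (avg_fst (fun z : {ffun I -> bool} => F (rsum b z))) ?card_sgn_gt0.
Qed.

(** The test function is the sign part of [psi] alone: the gadget part carries [weight], whose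
    fourth moment grows with [D]. *)
Lemma psi_test u : let vv := avg (fun z => psi u z ^+ 2) in
  exists Y : noise -> R, [/\ avg Y = 0,
    16/25 * vv <= avg (fun z => Y z * psi u z),
    avg (fun z => Y z ^+ 2) <= vv & avg (fun z => Y z ^+ 4) <= 3 * vv ^+ 2].
Proof.
move=> vv; have vvE : vv = \sum_i bb u i ^+ 2 + 9/25 * \sum_c \sum_k yk u k c ^+ 2 := avg_psi2 u.
have b0 := sum_bb2_ge0 u; have y0 := sum_yk2_ge0 u.
exists (fun z => rsum (bb u) z.1.1.1); split.
- by rewrite (avg_rsum_noise id) avg_rsum.
- rewrite avg_noise /psi /= vvE; apply: (@le_trans _ _ (\sum_i bb u i ^+ 2)).
    exact: sum_bb2_lower.
  under eq_avg do under eq_avg do rewrite avg_two_rsums_mul.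
  by rewrite !avg_cst.
- rewrite (avg_rsum_noise (fun t => t ^+ 2)) avg_rsum_sqr vvE; lra.
- rewrite (avg_rsum_noise (fun t => t ^+ 4)); apply: le_trans (avg_rsum4 _) _.
  by rewrite ler_wpM2l// lerXn2r ?nnegrE// vvE; lra.
Qed.

End BlockFunctions.

(** * The weak type inequality inside a block *)
Section WeakType.
Variables (R : realType) (T L d D n : nat) (X : finType).
Variables (h : nat -> X -> R) (m : X -> nat) (g : R).
Hypotheses (T_gt0 : (0 < T)%N) (L_gt0 : (0 < L)%N) (D_gt0 : (0 < D)%N).
Hypothesis G : gadget n T h m g.
Variables (Om : finType) (f : 'I_d -> Om -> R).
Hypothesis Om_gt0 : (0 < #|Om|)%N.
Hypothesis f_ortho : forall c c', avg (fun om => f c om * f c' om) = (c == c')%:R.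
Hypotheses (dL : (d <= L)%N) (harm_ge : n%:R <= 2 * harm R D).
Local Notation I := (index T L d).
Local Notation noise := (noise T L d D X).
Local Notation sT := (sT R T).
Local Notation sL := (sL R L).
Local Notation ac := (@ac R T L d).
Implicit Types (u : I -> R).

Definition ph u (om : Om) : R := \sum_c tc u c * f c om.
(** The order of the functions within the block: node, then round, then old function. A cut leaves
    complete rounds, in which every [c] occurs once, and a piece of a single round; the piece can be
    estimated only crudely, because the [f c] are arbitrary. *)
Definition code (i : I) : nat := ((i.1.1 * L + i.1.2) * d + i.2)%N.
Definition cut u (M : nat) (i : I) : R := if (code i < M)%N then u i else 0.

Definition ek (k : 'I_T) (c : 'I_d) (i : I) : R := sL * ((i.1.1 == k) && (i.2 == c))%:R.
Definition gbar k c (r : {ffun I -> bool}) : R := rsum (ek k c) r.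
Definition residual (y : Om * noise) (c : 'I_d) : R :=
  f c y.1 - 4/5 * rsum (ac c) y.2.1.1.1
  - 3/5 * weight R y.2.1.2 * (\sum_(k < T) sT * h k y.2.2) * rsg R (y.2.1.1.2 c).

Lemma avg_ph2 u : avg (fun om => ph u om ^+ 2) = \sum_c tc u c ^+ 2.
Proof. exact: avg_ortho_sqr. Qed.

Lemma sum_ek u k c : \sum_i u i * ek k c i = vk u k c.
Proof.
rewrite sum_index (bigD1 k)//= (bigD1 c)//= [X in _ + X + _]big1 => [|c' c'c]; last first.
  by apply: big1 => p _; rewrite /ek /= eqxx (negPf c'c) /= !mulr0.
rewrite [X in _ + X]big1 => [|k' k'k]; last first.
  by apply: big1 => c' _; apply: big1 => p _; rewrite /ek /= (negPf k'k) /= !mulr0.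
rewrite !addr0 /vk mulr_sumr; apply: eq_bigr => p _.
by rewrite /ek /= !eqxx mulr1 mulrC.
Qed.

Lemma vk_ek k c k' c' : vk (ek k c) k' c' = ((k == k') && (c == c'))%:R.
Proof.
rewrite /vk /ek /= sumr_const card_ord -[_ *+ L]mulr_natr (eq_sym k) (eq_sym c).
by transitivity (sL ^+ 2 * L%:R * ((k' == k) && (c' == c))%:R); [ring|rewrite sL2// mul1r].
Qed.

Lemma gbar_ortho k c c' : avg (fun r => gbar k c r * gbar k c' r) = (c == c')%:R.
Proof. by rewrite avg_rsum_mul sum_ek vk_ek eqxx. Qed.

Lemma rsumB (J : finType) (a b : J -> R) r : rsum (fun i => a i - b i) r = rsum a r - rsum b r.
Proof. by rewrite /rsum -sumrB; apply: eq_bigr => i _; rewrite mulrBl. Qed.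

Lemma rsum_ek (a : 'I_T -> 'I_d -> R) r :
  rsum (fun i => sL * a i.1.1 i.2) r = \sum_k \sum_c a k c * gbar k c r.
Proof.
rewrite /rsum sum_index; apply: eq_bigr => k _; apply: eq_bigr => c _.
rewrite /gbar /rsum sum_index (bigD1 k)//= (bigD1 c)//= [X in _ + X + _]big1 => [|c' c'c]; last first.
  by apply: big1 => p _; rewrite /ek /= eqxx (negPf c'c) /= mulr0 mul0r.
rewrite [X in _ + X]big1 => [|k' k'k]; last first.
  by apply: big1 => c' _; apply: big1 => p _; rewrite /ek /= (negPf k'k) /= mulr0 mul0r.
rewrite !addr0 mulr_sumr; apply: eq_bigr => p _.
by rewrite /ek /= !eqxx /=; ring.
Qed.

Lemma rsum_ac (a : 'I_d -> R) (r : {ffun I -> bool}) :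
  \sum_c a c * rsum (ac c) r = \sum_k \sum_c (sT * a c) * gbar k c r.
Proof.
rewrite -rsum_ek /rsum; under eq_bigr do rewrite mulr_sumr.
rewrite exchange_big /=; apply: eq_bigr => i _.
rewrite (bigD1 i.2)//= big1 ?addr0 => [|c ci]; last by rewrite /ac eq_sym (negPf ci) mulr0 mul0r mulr0.
by rewrite /ac eqxx mulr1; ring.
Qed.

(** Passing from [bb] and [yk] to [u], [vk] and [tc] makes each term a sum over coordinates whose
    cut can be estimated. All that multiplies an old coordinate [tc u c] is collected in [residual];
    [1/5] is [1 - 4/5]. *)
Lemma theta_decomp u y : ph u y.1 + psi h u y.2 =
  rsum u y.2.1.1.1 - 1/5 * (\sum_k \sum_c vk u k c * gbar k c y.2.1.1.1)
  + 3/5 * weight R y.2.1.2 * (\sum_(k < T) h k y.2.2 * \sum_c vk u k c * rsg R (y.2.1.1.2 c))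
  + \sum_c tc u c * residual y c.
Proof.
move: y => [om [[[r ga] w] x]]; rewrite /ph /psi /=.
have -> : rsum (bb u) r = rsum u r - (\sum_k \sum_c vk u k c * gbar k c r)
   + 4/5 * (\sum_k \sum_c vk u k c * gbar k c r)
   - 4/5 * (\sum_c tc u c * rsum (ac c) r).
  rewrite rsumB (rsum_ek (fun k c => vk u k c - 4/5 * yk u k c)) rsum_ac.
  rewrite -!addrA; congr (_ + _); rewrite !mulr_sumr -!sumrN -!big_split /=; apply: eq_bigr => k _.
  rewrite !mulr_sumr -!sumrN -!big_split /=; apply: eq_bigr => c _; rewrite /yk; ring.
have -> : rsum (yh h u x) ga = (\sum_(k < T) h k x * \sum_c vk u k c * rsg R (ga c))
   - (\sum_(k < T) sT * h k x) * \sum_c tc u c * rsg R (ga c).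
  under eq_bigr do rewrite mulr_sumr.
  rewrite exchange_big mulr_sumr -sumrB /=; apply: eq_bigr => c _.
  rewrite /yh !mulr_suml -sumrB; apply: eq_bigr => k _; rewrite /yk; ring.
have -> : \sum_c tc u c * residual (om, (r, ga, w, x)) c = \sum_c tc u c * f c om
    - 4/5 * (\sum_c tc u c * rsum (ac c) r)
    - 3/5 * weight R w * (\sum_(k < T) sT * h k x) * (\sum_c tc u c * rsg R (ga c)).
  rewrite /residual /=; set H := \sum_(k < T) _.
  by rewrite !mulr_sumr -!sumrB; apply: eq_bigr => c _; ring.
by lra.
Qed.

Lemma rho1_inj (k : nat) : injective (fun p : 'I_L => (k * L + p)%N).
Proof. by move=> p q /addnI /val_inj. Qed.

Lemma rho2_inj : injective (fun kp : 'I_T * 'I_L => (kp.1 * L + kp.2)%N).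
Proof.
move=> [k p] [k' p'] /= e.
have e1 : k = k' :> nat.
  by have := congr1 (fun j => j %/ L)%N e; rewrite !divnMDl// !divn_small// !addn0.
by move: e; rewrite e1 => /addnI /val_inj ->; move/val_inj: e1 => ->.
Qed.

(** The right-hand side of [cut_rounds], rescaled. It does not depend on the place of the cut, so it
    majorizes a maximal function. *)
Definition round_bound (A : finType) (K : R) (w : A -> 'I_d -> R) (F : 'I_d -> R) : R :=
  K * (2 * #|A|%:R * (\sum_p (\sum_c w p c * F c) ^+ 2) +
    2 * (\sum_p \sum_(c < d) w p c ^+ 2) * (\sum_c F c ^+ 2)).

Lemma vk_cut_le u M k (F : 'I_d -> R) : (\sum_c vk (cut u M) k c * F c) ^+ 2 <=
  round_bound (sL ^+ 2) (fun p c => u (k, p, c)) F.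
Proof.
rewrite /round_bound; have := @cut_rounds R 'I_L (fun p => k * L + p)%N d (fun p c => u (k, p, c)) F M (@rho1_inj k).
move=> le; have := ler_wpM2l (sqr_ge0 sL) le; apply: le_trans.
rewrite -exprMn mulr_sumr [X in _ <= X ^+ 2](_ : _ = \sum_c vk (cut u M) k c * F c)//.
under eq_bigr do rewrite mulr_sumr.
rewrite exchange_big /=; apply: eq_bigr => c _.
rewrite /vk mulrAC mulr_sumr; apply: eq_bigr => p _; rewrite /cut /code /=.
by case: ifP => _; ring.
Qed.

Lemma tc_cut_le u M (F : 'I_d -> R) : (\sum_c tc (cut u M) c * F c) ^+ 2 <=
  round_bound (sT ^+ 2 * sL ^+ 2) (fun (kp : 'I_T * 'I_L) c => u (kp, c)) F.
Proof.
rewrite /round_bound; have := @cut_rounds R _ _ d (fun (kp : 'I_T * 'I_L) c => u (kp, c)) F M rho2_inj.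
have K0 : 0 <= sT ^+ 2 * sL ^+ 2 by rewrite mulr_ge0 ?sqr_ge0.
move=> le; have := ler_wpM2l K0 le; apply: le_trans.
rewrite -!exprMn mulr_sumr [X in _ <= X ^+ 2](_ : _ = \sum_c tc (cut u M) c * F c)//.
under eq_bigr do rewrite mulr_sumr.
rewrite exchange_big /=; apply: eq_bigr => c _.
transitivity (\sum_k \sum_p sT * sL * (cut u M (k, p, c) * F c)).
  by rewrite pair_bigA /=; apply: eq_bigr => -[k p] _; rewrite /cut /code /=.
rewrite /tc mulrAC mulr_sumr; apply: eq_bigr => k _.
by rewrite /vk -mulr_sumr -mulr_suml; ring.
Qed.

(** Complete rounds cost the mean square bound [a]. The incomplete round costs [\sum_c F c ^+ 2], of
    mean at most [a * d], and the factor [K = 1 / #|A|] absorbs this [d] because there are at least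
    [d] rounds. *)
Lemma avg_round_bound (Y : finType) (A : finType) (K a : R) (w : A -> 'I_d -> R) (F : Y -> 'I_d -> R) :
  (0 < #|Y|)%N -> K * #|A|%:R = 1 -> (d <= #|A|)%N -> 0 <= a -> 0 <= K ->
  (forall b : 'I_d -> R, avg (fun y => (\sum_c b c * F y c) ^+ 2) <= a * \sum_c b c ^+ 2) ->
  avg (fun y => round_bound K w (F y)) <= 4 * a * \sum_p \sum_c w p c ^+ 2.
Proof.
move=> Y0 KA dA a0 K0 HF; set W := \sum_p _.
have W0 : 0 <= W by do 2 (apply: sumr_ge0 => ? _); exact: sqr_ge0.
rewrite /round_bound avgZ avgD avgZ avgZ !avg_sum -/W.
have l1 : \sum_p avg (fun y => (\sum_c w p c * F y c) ^+ 2) <= a * W.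
  by rewrite /W mulr_sumr; apply: ler_sum => p _; exact: HF.
have l2 : \sum_c avg (fun y => F y c ^+ 2) <= a * d%:R.
  rewrite -[d%:R]mulr_natr mul1r -[in d%:R](card_ord d) -sumr_const mulr_sumr.
  apply: ler_sum => c _; have := HF (fun c' => (c' == c)%:R).
  rewrite (bigD1 c)//= big1 => [|c' /negPf ->]; last by rewrite expr0n.
  rewrite eqxx expr1n addr0 mulr1 => hc; apply: le_trans hc.
  rewrite le_eqVlt; apply/orP; left; apply/eqP; apply: eq_avg => y.
  by rewrite (bigD1 c)//= eqxx mul1r big1 ?addr0// => c' /negPf ->; rewrite mul0r.
have l3 : K * d%:R <= 1 by rewrite -[leRHS]KA ler_wpM2l// ler_nat.
set S1 := \sum_p avg _ in l1 *; set S2 := \sum_c avg _ in l2 *.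
have e1 : K * (2 * #|A|%:R * S1) <= 2 * (a * W).
  by rewrite (_ : _ * _ = 2 * (K * #|A|%:R * S1)); [rewrite KA mul1r ler_wpM2l|ring].
have e2 : K * (2 * W * S2) <= 2 * (a * W).
  rewrite (_ : _ * _ = 2 * (W * (K * S2))); last by ring.
  rewrite ler_wpM2l// mulrC ler_wpM2r//; apply: le_trans (ler_wpM2l K0 l2) _.
  by rewrite mulrCA -[leRHS]mulr1 ler_wpM2l.
by rewrite mulrDr; have := lerD e1 e2; lra.
Qed.

Let noise_gt0 : (0 < #|{: noise}|)%N. Proof. by apply: card_noise_gt0; [exact: D_gt0|exact: G]. Qed.
Let X_gt0 : (0 < #|X|)%N := gadget_card G.

Lemma avg_signs (F : {ffun I -> bool} -> R) : avg (fun y : Om * noise => F y.2.1.1.1) = avg F.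
Proof.
rewrite (avg_snd (fun z : noise => F z.1.1.1))//.
rewrite (avg_fst (fun z : {ffun I -> bool} * {ffun 'I_d -> bool} * 'I_D => F z.1.1))//.
rewrite (avg_fst (fun z : {ffun I -> bool} * {ffun 'I_d -> bool} => F z.1)) ?card_ord//.
by rewrite avg_fst// card_sgn_gt0.
Qed.

(** The three terms of [residual] have mean squares 1, 16/25 and 9/25 times the energy of [b]; the
    square of a sum of three terms costs a factor 3, whence [3 * 2 = 6]. *)
Lemma avg_residual (b : 'I_d -> R) :
  avg (fun y => (\sum_c b c * residual y c) ^+ 2) <= 6 * \sum_c b c ^+ 2.
Proof.
pose P (y : Om * noise) := \sum_c b c * f c y.1.
pose Q (y : Om * noise) := rsum (fun i : I => sT * sL * b i.2) y.2.1.1.1.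
pose H (x : X) := \sum_(k < T) sT * h k x.
pose S (y : Om * noise) := weight R y.2.1.2 * H y.2.2 * rsum b y.2.1.1.2.
have E y : \sum_c b c * residual y c = P y - 4/5 * Q y - 3/5 * S y.
  rewrite /residual /P /S -/(H y.2.2).
  have -> : Q y = \sum_c b c * rsum (ac c) y.2.1.1.1.
    rewrite rsum_ac /Q -(rsum_ek (fun _ c => sT * b c)).
    by rewrite /rsum; apply: eq_bigr => i _; ring.
  rewrite (_ : rsum b y.2.1.1.2 = \sum_c b c * rsg R (y.2.1.1.2 c))//.
  by move: (H y.2.2) => Hx; rewrite !mulr_sumr -!sumrB; apply: eq_bigr => c _; ring.
have le y : (\sum_c b c * residual y c) ^+ 2 <= 3 * (P y ^+ 2 + (16/25 * Q y ^+ 2 + 9/25 * S y ^+ 2)).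
  rewrite E; have := sqr_ge0 (P y + 4/5 * Q y); have := sqr_ge0 (P y + 3/5 * S y).
  by have := sqr_ge0 (4/5 * Q y - 3/5 * S y); lra.
apply: le_trans (ler_avg le) _.
rewrite avgZ !avgD !avgZ.
have -> : avg (fun y => P y ^+ 2) = \sum_c b c ^+ 2.
  by rewrite (avg_fst (fun om => (\sum_c b c * f c om) ^+ 2))// avg_ortho_sqr.
have -> : avg (fun y => Q y ^+ 2) = \sum_c b c ^+ 2.
  rewrite (avg_signs (fun r => rsum _ r ^+ 2)) avg_rsum_sqr sum_index.
  have TL : sT ^+ 2 * T%:R * (sL ^+ 2 * L%:R) = 1 by rewrite sT2// sL2// mulr1.
  under eq_bigr do under eq_bigr do rewrite /= sumr_const card_ord -[_ *+ L]mulr_natr.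
  rewrite sumr_const card_ord -[_ *+ T]mulr_natr mulr_suml; apply: eq_bigr => c _ /=.
  by transitivity (sT ^+ 2 * T%:R * (sL ^+ 2 * L%:R) * b c ^+ 2); [ring|rewrite TL mul1r].
have -> : avg (fun y => S y ^+ 2) = \sum_c b c ^+ 2.
  rewrite (avg_snd (fun z : noise => (weight R z.1.2 * H z.2 * rsum b z.1.1.2) ^+ 2))//.
  rewrite (_ : avg _ = avg (fun w : 'I_D => avg (fun x : X => weight R w ^+ 2 * H x ^+ 2 * \sum_c b c ^+ 2))); last first.
    rewrite avg_noise; apply: eq_avg => w; apply: eq_avg => x; rewrite -avg_rsum_sqr -avgZ /=.
    by rewrite avg_cst ?card_sgn_gt0//; apply: eq_avg => ga; rewrite !exprMn.
  have flat_walk : avg (fun x => H x ^+ 2) = 1.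
    rewrite avg_ortho_sqr; last exact: (gadget_ortho_ord G).
    by rewrite sumr_const card_ord -[_ *+ T]mulr_natr sT2.
  transitivity (avg (fun w : 'I_D => weight R w ^+ 2 * (\sum_c b c ^+ 2))).
    apply: eq_avg => w; rewrite (eq_avg (g := fun x => weight R w ^+ 2 * (\sum_c b c ^+ 2) * H x ^+ 2)); last by move=> x; rewrite mulrAC.
    by rewrite avgZ flat_walk mulr1.
  by rewrite avgZr avg_weight_sqr// mul1r.
by have : 0 <= \sum_c b c ^+ 2; [apply: sumr_ge0 => c _; exact: sqr_ge0|lra].
Qed.

Definition QB u (r : {ffun I -> bool}) : R :=
  \sum_k round_bound (sL ^+ 2) (fun p c => u (k, p, c)) (gbar k ^~ r).
Definition VV u (x : X) (ga : {ffun 'I_d -> bool}) : R :=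
  \sum_(k < T) h k x ^+ 2 * round_bound (sL ^+ 2) (fun p c => u (k, p, c)) (fun c => rsg R (ga c)).
Definition QG u (y : Om * noise) : R :=
  round_bound (sT ^+ 2 * sL ^+ 2) (fun (kp : 'I_T * 'I_L) c => u (kp, c)) (residual y).

Lemma round_bound_ge0 (A : finType) (K : R) (w : A -> 'I_d -> R) (F : 'I_d -> R) :
  0 <= K -> 0 <= round_bound K w F.
Proof.
move=> K0; rewrite /round_bound mulr_ge0// addr_ge0// !mulr_ge0// ?sumr_ge0// => i _;
  by rewrite ?sqr_ge0// sumr_ge0// => j _; rewrite sqr_ge0.
Qed.

(** The complete nodes form a partial sum of a sign series, controlled by the maximal inequality;
    the node being cut is controlled by [QB]; later nodes vanish. *)
Lemma node_sum_cut u M (r : {ffun I -> bool}) (lam : R) : 0 <= lam -> (M <= T * L * d)%N ->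
  (forall k : 'I_T.+1, `|\sum_(i : I | (i.1.1 < k)%N) sL * vk u i.1.1 i.2 * rsg R (r i)| <= lam) ->
  QB u r <= lam ^+ 2 ->
  `|\sum_k \sum_c vk (cut u M) k c * gbar k c r| <= 2 * lam.
Proof.
move=> lam0 MT h1 h2; pose k0 := (M %/ (L * d))%N.
have k0T : (k0 < T.+1)%N.
  rewrite ltnS /k0; case: (posnP (L * d)%N) => [->|Ld0]; first by rewrite divn0.
  by rewrite -(mulnK T Ld0) leq_div2r// mulnA.
pose S k := \sum_c vk (cut u M) k c * gbar k c r.
have Slt (k : 'I_T) : (k < k0)%N -> S k = \sum_c vk u k c * gbar k c r.
  move=> kk0; apply: eq_bigr => c _; congr (_ * _); congr (_ * _).
  apply: eq_bigr => p _; rewrite /cut /code /= (_ : (_ < M)%N = true)//.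
  have := leq_divM M (L * d); rewrite -/k0.
  have := ltn_ord p; have := ltn_ord c; nia.
have Sgt (k : 'I_T) : (k0 < k)%N -> S k = 0.
  move=> kk0; apply: big1 => c _; rewrite /vk big1 ?mulr0 ?mul0r// => p _.
  rewrite /cut /code /= (_ : (_ < M)%N = false)//.
  have Ld0 : (0 < L * d)%N by rewrite muln_gt0 L_gt0; case: (d) c => [[]|].
  by have := ltn_ceil M Ld0; rewrite -/k0; nia.
have -> : \sum_k S k = \sum_(k < T | (k < k0)%N) S k + \sum_(k < T | k == k0 :> nat) S k.
  rewrite (bigID (fun k : 'I_T => (k < k0)%N)) /=; congr (_ + _).
  rewrite [LHS]big_mkcond [RHS]big_mkcond; apply: eq_bigr => k _.
  by case: (ltngtP k k0) => //= /Sgt ->.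
apply: le_trans (ler_normD _ _) _; rewrite mulrDl mul1r; apply: lerD.
  rewrite (_ : \sum_(k < T | _) _ = \sum_(i : I | (i.1.1 < k0)%N) sL * vk u i.1.1 i.2 * rsg R (r i)).
    exact: (h1 (Ordinal k0T)).
  rewrite [RHS]big_mkcond [LHS]big_mkcond /=.
  transitivity (rsum (fun i : I => sL * (if (i.1.1 < k0)%N then vk u i.1.1 i.2 else 0)) r); last first.
    by apply: eq_bigr => i _; case: ifP => //; rewrite mulr0 mul0r.
  rewrite (rsum_ek (fun (k : 'I_T) c => if (k < k0)%N then vk u k c else 0)).
  apply: eq_bigr => k _; case: ifP => [/Slt //|_]; rewrite big1// => c _; exact: mul0r.
rewrite -[lam]ger0_norm// -ler_sqr ?nnegrE// !real_normK ?num_real//.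
apply: le_trans h2; apply: le_trans (sqr_sum_le_card (n := 1) _) _.
  apply/card_le1_eqP => k k'; rewrite !inE /= => /andP[/eqP e _] /andP[/eqP e' _].
  by apply/val_inj; rewrite /= e e'.
rewrite mul1r big_mkcond; apply: ler_sum => k _.
by case: ifP => _; [exact: vk_cut_le|apply: round_bound_ge0; exact: sqr_ge0].
Qed.

(** At most [n] of the [h k x] are nonzero, so Cauchy-Schwarz costs a factor [n]. The weight pays
    for it in [weak_type]. *)
Lemma tree_sum_cut u M x (ga : {ffun 'I_d -> bool}) :
  (\sum_(k < T) h k x * \sum_c vk (cut u M) k c * rsg R (ga c)) ^+ 2 <= n%:R * VV u x ga.
Proof.
apply: le_trans (sqr_sum_le_card (n := n) _) _.
  apply: leq_trans (gadget_few G x); rewrite -sum1_card big_mkcond /=.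
  apply: leq_sum => k _; rewrite !inE.
  by case: (eqVneq (h k x) 0) => [->|_]; [rewrite mul0r eqxx|case: ifP].
rewrite ler_wpM2l//; apply: ler_sum => k _; rewrite exprMn ler_wpM2l ?sqr_ge0//.
exact: vk_cut_le.
Qed.

(** The four terms of [theta_decomp] get the budget [1/5 + (1/5) * 2 + 1/5 + 1/5 = 1], in units of
    [lam]. *)
Lemma cut_bound u M (y : Om * noise) (lam : R) : 0 < lam -> (M <= T * L * d)%N ->
  (forall k : 'I_(T * L * d).+1,
    `|\sum_(i | (code i < k)%N) u i * rsg R (y.2.1.1.1 i)| <= lam / 5) ->
  (forall k : 'I_T.+1,
    `|\sum_(i : I | (i.1.1 < k)%N) sL * vk u i.1.1 i.2 * rsg R (y.2.1.1.1 i)| <= lam) ->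
  QB u y.2.1.1.1 <= lam ^+ 2 ->
  9 * n%:R * weight R y.2.1.2 ^+ 2 * VV u y.2.2 y.2.1.1.2 <= lam ^+ 2 ->
  25 * QG u y <= lam ^+ 2 ->
  `|ph (cut u M) y.1 + psi h (cut u M) y.2| <= lam.
Proof.
move=> lam0 MT h1 h2 h3 h4 h5; rewrite theta_decomp.
have l5 : 0 <= lam / 5 by rewrite divr_ge0// ltW.
have a1 : `|rsum (cut u M) y.2.1.1.1| <= lam / 5.
  have := h1 (Ordinal (MT : (M < (T * L * d).+1)%N)); rewrite big_mkcond /=.
  rewrite (_ : \sum_i _ = rsum (cut u M) y.2.1.1.1)//.
  by apply: eq_bigr => i _; rewrite /cut; case: ifP; rewrite ?mul0r.
have a2 := node_sum_cut (ltW lam0) MT h2 h3.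
have a3 : `|3/5 * weight R y.2.1.2 * (\sum_(k < T) h k y.2.2 * \sum_c vk (cut u M) k c * rsg R (y.2.1.1.2 c))| <= lam / 5.
  rewrite -[lam / 5]ger0_norm// -ler_sqr ?nnegrE// !real_normK ?num_real//.
  rewrite !exprMn; have := tree_sum_cut u M y.2.2 y.2.1.1.2.
  set s := _ ^+ 2; set V := VV _ _ _ in h4 * => sV.
  have w0 := sqr_ge0 (weight R y.2.1.2).
  have := ler_wpM2l w0 sV; nra.
have a4 : `|\sum_c tc (cut u M) c * residual y c| <= lam / 5.
  rewrite -[lam / 5]ger0_norm// -ler_sqr ?nnegrE// !real_normK ?num_real//.
  by have := tc_cut_le u M (residual y); rewrite -/(QG u y) exprMn; nra.
move: a1 a2 a3 a4; rewrite !ler_norml => /andP[? ?] /andP[? ?] /andP[? ?] /andP[? ?].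
by apply/andP; split; lra.
Qed.

Lemma prob_lt_ord (B : R) : 0 <= B -> prob R (fun w : 'I_D => w.+1%:R < B) <= B / D%:R.
Proof.
move=> B0; rewrite /prob /avg card_ord ler_wpM2r ?invr_ge0//.
suff H k : \sum_(w < k) ((w.+1%:R < B)%R%:R : R) <= B by exact: H.
elim: k => [|k IH]; first by rewrite big_ord0.
case: (ltP k.+1%:R B) => kB; last first.
  by rewrite big_ord_recr /= ltNge kB addr0.
apply: le_trans (ltW kB); have -> : k.+1%:R = \sum_(w < k.+1) 1 :> R by rewrite sumr_const card_ord.
by apply: ler_sum => w _; case: (_ < _).
Qed.

Lemma avg_QB u : avg (QB u) <= 4 * \sum_i u i ^+ 2.
Proof.
rewrite avg_sum sum_index mulr_sumr; apply: ler_sum => k _.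
rewrite exchange_big /=.
have := @avg_round_bound _ 'I_L (sL ^+ 2) 1 (fun p c => u (k, p, c)) (fun r c => gbar k c r) (@card_sgn_gt0 I).
rewrite mulr1; apply; rewrite ?card_ord ?sL2 ?sqr_ge0// => b.
by rewrite mul1r (avg_ortho_sqr (H := gbar k))// => c c'; exact: gbar_ortho.
Qed.

Lemma avg_VV u : avg (fun x => avg (VV u x)) <= 4 * \sum_i u i ^+ 2.
Proof.
apply: (@le_trans _ _ (\sum_k avg (fun ga : {ffun 'I_d -> bool} => round_bound (sL ^+ 2) (fun p c => u (k, p, c)) (fun c => rsg R (ga c))))).
  rewrite le_eqVlt; apply/orP; left; apply/eqP.
  under eq_avg => x.
    rewrite /VV avg_sum; under eq_bigr do rewrite avgZ; over.
  rewrite avg_sum; apply: eq_bigr => k _; rewrite avgZr.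
  under eq_avg do rewrite expr2.
  by rewrite (gadget_ortho_ord G) eqxx mul1r.
rewrite sum_index mulr_sumr; apply: ler_sum => k _; rewrite exchange_big /=.
have := @avg_round_bound _ 'I_L (sL ^+ 2) 1 (fun p c => u (k, p, c)) (fun (ga : {ffun 'I_d -> bool}) c => rsg R (ga c)) (@card_sgn_gt0 'I_d).
rewrite mulr1; apply; rewrite ?card_ord ?sL2 ?sqr_ge0// => b.
by rewrite mul1r -avg_rsum_sqr.
Qed.

Lemma avg_QG u : avg (QG u) <= 24 * \sum_i u i ^+ 2.
Proof.
have K0 : 0 <= sT ^+ 2 * sL ^+ 2 by rewrite mulr_ge0 ?sqr_ge0.
have Y0 : (0 < #|{: Om * noise}|)%N by rewrite card_prod muln_gt0 Om_gt0.
have := @avg_round_bound _ ('I_T * 'I_L)%type (sT ^+ 2 * sL ^+ 2) 6 (fun kp c => u (kp, c)) residual Y0.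
have -> : \sum_i u i ^+ 2 = \sum_p \sum_c u (p, c) ^+ 2.
  by rewrite pair_bigA; apply: eq_bigr => -[].
rewrite (_ : 4 * 6 = 24) -?natrM//; apply => //; last exact: avg_residual.
  by rewrite card_prod !card_ord natrM mulrACA sT2// sL2// mulr1.
by rewrite card_prod !card_ord (leq_trans dL)// leq_pmull.
Qed.

(** A union bound over the five ways in which [cut_bound] can fail, none of which involves the cut.
    Their constants 25, 1, 4, 72 and 600 add up to 702. *)
Theorem weak_type u (lam : R) : 0 < lam ->
  prob R (fun y : Om * noise => [exists k : 'I_(T * L * d).+1,
     lam < `|ph (cut u k) y.1 + psi h (cut u k) y.2|]) <=
  730 * (\sum_i u i ^+ 2) / lam ^+ 2.
Proof.
move=> lam0; set U := \sum_i u i ^+ 2.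
have lam2 : 0 < lam ^+ 2 by rewrite exprn_gt0.
pose P1 (r : {ffun I -> bool}) := [exists k : 'I_(T * L * d).+1, lam / 5 < `|\sum_(i | (code i < k)%N) u i * rsg R (r i)|].
pose P2 (r : {ffun I -> bool}) := [exists k : 'I_T.+1,
   lam < `|\sum_(i : I | (i.1.1 < k)%N) sL * vk u i.1.1 i.2 * rsg R (r i)|].
pose P3 (r : {ffun I -> bool}) := lam ^+ 2 < QB u r.
pose E4 (z : noise) := lam ^+ 2 < 9 * n%:R * weight R z.1.2 ^+ 2 * VV u z.2 z.1.1.2.
pose E5 (y : Om * noise) := lam ^+ 2 / 25 < QG u y.
have e1 : prob R (fun y : Om * noise => P1 y.2.1.1.1) <= 25 * U / lam ^+ 2.
  rewrite /prob (avg_signs (fun r => (P1 r)%:R)).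
  apply: le_trans (@rademacher_maximal _ _ code (T * L * d) u (lam / 5) _) _.
    by rewrite divr_gt0.
  by rewrite expr_div_n invf_div mulrCA -mulrA -natrX.
have e2 : prob R (fun y : Om * noise => P2 y.2.1.1.1) <= U / lam ^+ 2.
  rewrite /prob (avg_signs (fun r => (P2 r)%:R)).
  apply: le_trans (@rademacher_maximal _ _ (fun i : I => i.1.1) T (fun i => sL * vk u i.1.1 i.2) lam lam0) _.
  rewrite ler_wpM2r ?invr_ge0 ?(ltW lam2)//; apply: le_trans (sum_vk2 L_gt0 u).
  rewrite sum_index; apply: ler_sum => k _; apply: ler_sum => c _ /=.
  rewrite sumr_const card_ord -[_ *+ L]mulr_natr exprMn.
  by rewrite -mulrA mulrC -mulrA [L%:R * _]mulrC sL2// mulr1.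
have e3 : prob R (fun y : Om * noise => P3 y.2.1.1.1) <= 4 * U / lam ^+ 2.
  rewrite /prob (avg_signs (fun r => (P3 r)%:R)).
  apply: le_trans (markov_avg lam2 _) _ => [r|].
    by apply: sumr_ge0 => k _; apply: round_bound_ge0; exact: sqr_ge0.
  by rewrite ler_wpM2r ?invr_ge0 ?(ltW lam2)// avg_QB.
have V0 x ga : 0 <= VV u x ga.
  by apply: sumr_ge0 => k _; rewrite mulr_ge0 ?sqr_ge0// round_bound_ge0// sqr_ge0.
(* For fixed [x] and [ga] the event says that [w.+1] is less than [9 n D VV / (harm * lam^2)]; the
   hypothesis [n <= 2 * harm] cancels the factor [n] of [tree_sum_cut]. *)
have e4 : prob R (fun y : Om * noise => E4 y.2) <= 72 * U / lam ^+ 2.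
  rewrite /prob (avg_snd (fun z : noise => (E4 z)%:R))// avg_noise.
  apply: (@le_trans _ _ (avg (fun x => avg (fun ga => 18 * VV u x ga / lam ^+ 2)))); last first.
    under eq_avg do rewrite avgZr avgZ; rewrite avgZr avgZ ler_wpM2r ?invr_ge0 ?(ltW lam2)//.
    by have := avg_VV u; rewrite -/U; lra.
  rewrite avg_exchange; apply: ler_avg => x.
  rewrite (eq_avg (g := fun w : 'I_D => avg (fun ga : {ffun 'I_d -> bool} =>
      (lam ^+ 2 < 9 * n%:R * weight R w ^+ 2 * VV u x ga)%R%:R))); last first.
    by move=> w; rewrite /E4 /= avg_cst ?card_sgn_gt0.
  rewrite avg_exchange; apply: ler_avg => ga.
  have D0 : 0 < D%:R :> R by rewrite ltr0n.
  set B := 18 * VV u x ga / lam ^+ 2.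
  have B0 : 0 <= B by rewrite divr_ge0 ?mulr_ge0// ltW.
  apply: (@le_trans _ _ (prob R (fun w : 'I_D => w.+1%:R < B * D%:R))); last first.
    by apply: le_trans (prob_lt_ord _) _; [rewrite mulr_ge0// ltW|rewrite mulfK// gt_eqF].
  apply: le_prob => w; rewrite weight_sqr// => hw.
  have hh := @harm_gt0 R _ D_gt0.
  have w0 : 0 < w.+1%:R :> R by rewrite ltr0n.
  rewrite /B mulrAC ltr_pdivlMr// -ltr_pdivlMl//.
  apply: lt_le_trans hw _; rewrite mulrC.
  have q : n%:R / harm R D <= 2 by rewrite ler_pdivrMr.
  rewrite (_ : VV u x ga * _ = 9 * VV u x ga * D%:R * w.+1%:R^-1 * (n%:R / harm R D)); last by ring.
  rewrite (_ : w.+1%:R^-1 * _ = 9 * VV u x ga * D%:R * w.+1%:R^-1 * 2); last by ring.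
  by rewrite ler_wpM2l// !mulr_ge0 ?invr_ge0// ltW.
have e5 : prob R E5 <= 600 * U / lam ^+ 2.
  have l0 : 0 < lam ^+ 2 / 25 by rewrite divr_gt0.
  apply: le_trans (markov_avg l0 _) _ => [y|].
    by apply: round_bound_ge0; rewrite mulr_ge0 ?sqr_ge0.
  rewrite invf_div mulrA ler_wpM2r ?invr_ge0 ?(ltW lam2)//.
  by have := avg_QG u; rewrite -/U; lra.
apply: (@le_trans _ _ (prob R (fun y : Om * noise => P1 y.2.1.1.1) + prob R (fun y : Om * noise => P2 y.2.1.1.1)
   + prob R (fun y : Om * noise => P3 y.2.1.1.1) + prob R (fun y : Om * noise => E4 y.2) + prob R E5)); last first.
  have : 702 * U / lam ^+ 2 <= 730 * U / lam ^+ 2.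
    rewrite ler_wpM2r ?invr_ge0 ?(ltW lam2)// ler_wpM2r ?ler_nat//.
    by apply: sumr_ge0 => i _; exact: sqr_ge0.
  lra.
rewrite /prob -!avgD; apply: ler_avg => y.
case: existsP => [[k hk]|_]; last by rewrite !addr_ge0.
suff : P1 y.2.1.1.1 || P2 y.2.1.1.1 || P3 y.2.1.1.1 || E4 y.2 || E5 y.
  by case: (P1 _); case: (P2 _); case: (P3 _); case: (E4 _); case: (E5 _) => //= _; lra.
apply: contraLR hk; rewrite !negb_or => /andP[/andP[/andP[/andP[n1 n2] n3] n4] n5].
rewrite -leNgt; apply: cut_bound => //.
- by rewrite -ltnS.
- by move=> j; move: n1; rewrite negb_exists => /forallP/(_ j); rewrite -leNgt.
- by move=> j; move: n2; rewrite negb_exists => /forallP/(_ j); rewrite -leNgt.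
- by rewrite leNgt.
- by rewrite leNgt.
- by move: n5; rewrite /E5 -leNgt ler_pdivlMr// mulrC.
Qed.

End WeakType.

Lemma ltn_round (K N e c : nat) : (c < e)%N -> (K * e + c < N * e)%N = (K < N)%N.
Proof.
move=> ce; case: (ltnP K N) => KN.
  have : (K.+1 * e <= N * e)%N by rewrite leq_mul2r KN orbT.
  by rewrite mulSn; lia.
have : (N * e <= K * e)%N by rewrite leq_mul2r KN orbT.
by lia.
Qed.

(** * Spikes inside a block *)
Section Spike.
Variables (R : realType) (T L d D n : nat) (X : finType).
Variables (h : nat -> X -> R) (m : X -> nat) (g : R).
Hypotheses (T_gt0 : (0 < T)%N) (L_gt0 : (0 < L)%N) (D_gt0 : (0 < D)%N) (n_gt0 : (0 < n)%N).
Hypothesis G : gadget n T h m g.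
Hypothesis g_gt0 : 0 < g.
Variables (Om : finType) (f : 'I_d -> Om -> R).
Hypothesis harm_le : harm R D <= n%:R.
Local Notation I := (index T L d).
Local Notation noise := (noise T L d D X).
Local Notation sT := (sT R T).
Local Notation sL := (sL R L).
Implicit Types (u : I -> R).

Let X_gt0 : (0 < #|X|)%N := gadget_card G.

(** If [|t| >= 1], then [|a + t| >= 1] or [|a - t| >= 1], and both are equally likely. This makes
    the spike insensitive to the value [a] of everything else. *)
Lemma prob_symmetric (J : finType) (b : J -> R) (a q : R) :
  prob R (fun r => 1 <= `|q * rsum b r|) / 2 <= prob R (fun r => 1 <= `|a + q * rsum b r|).
Proof.
have flipE r : rsum b (flip predT r) = - rsum b r.
  by rewrite /rsum -sumrN; apply: eq_bigr => i _; rewrite rsg_flip /=; ring.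
have : prob R (fun r => 1 <= `|a + q * rsum b r|) = prob R (fun r => 1 <= `|a - q * rsum b r|).
  rewrite /prob -(avg_inj _ (@flip_inj _ predT)); apply: eq_avg => r /=.
  by rewrite flipE mulrN.
have : prob R (fun r => 1 <= `|q * rsum b r|) <=
    prob R (fun r => 1 <= `|a + q * rsum b r|) + prob R (fun r => 1 <= `|a - q * rsum b r|).
  rewrite /prob -avgD; apply: ler_avg => r.
  have : 1 <= `|q * rsum b r| -> (1 <= `|a + q * rsum b r|) || (1 <= `|a - q * rsum b r|).
    move=> hq; case: (leP 1 `|a + q * rsum b r|) => //= h1.
    rewrite leNgt; apply/negP => h2; move: hq; rewrite leNgt => /negP; apply.
    by move: h1 h2; rewrite !ltr_norml => /andP[? ?] /andP[? ?]; apply/andP; split; lra.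
  case: (1 <= `|q * _|) => [/(_ isT)|_]; last by rewrite addr_ge0.
  by case/orP => ->; rewrite ?lerDl ?lerDr.
by lra.
Qed.

Lemma prob_le_ord (B : R) : 1 <= B ->
  Num.min 1 (B / D%:R) / 2 <= prob R (fun w : 'I_D => w.+1%:R <= B).
Proof.
move=> B1; have D0 : 0 < D%:R :> R by rewrite ltr0n.
have [DB|BD] := leP D%:R B.
  rewrite (_ : prob _ _ = 1).
    have : Num.min 1 (B / D%:R) <= 1 by rewrite ge_min lexx.
    lra.
  rewrite /prob -[RHS](@avg_cst _ 'I_D) ?card_ord//; apply: eq_avg => w.
  by rewrite (le_trans _ DB)// ler_nat.
pose t := Num.truncn B.
have /andP[tB Bt] : t%:R <= B < t.+1%:R by apply: truncn_itv; lra.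
have tD : (t <= D)%N by rewrite -(ler_nat R) (le_trans tB)// ltW.
have t1 : 1 <= t%:R :> R by rewrite ler1n; move: (le_lt_trans B1 Bt); rewrite ltr1n.
apply: (@le_trans _ _ (t%:R / D%:R)); last first.
  rewrite /prob /avg card_ord ler_wpM2r ?invr_ge0//.
  have -> : t%:R = \sum_(w < D) (w < t)%N%:R :> R.
    rewrite -natr_sum; congr (_%:R).
    suff H k : (\sum_(w < k) (w < t)%N)%N = minn k t by rewrite H (minn_idPr tD).
    by elim: k => [|k IH]; rewrite ?big_ord0 ?min0n// big_ord_recr /= IH; lia.
  apply: ler_sum => w _; case: ltnP => // wt.
  by rewrite (le_trans _ tB)// ler_nat.
apply: (@le_trans _ _ (B / D%:R / 2)); first by rewrite ler_wpM2r ?invr_ge0// ge_min lexx orbT.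
rewrite -mulrA [_ * 2^-1]mulrC mulrA ler_wpM2r ?invr_ge0//.
by move: Bt; rewrite -natr1; lra.
Qed.

Definition flat_walk (x : X) : R := \sum_(k < T) sT * h k x.
Definition stopped u (x : X) : I -> R := cut u (m x * (L * d)).

Lemma stoppedE u x i : stopped u x i = if (i.1.1 < m x)%N then u i else 0.
Proof.
rewrite /stopped /cut /code mulnA; congr (if _ then _ else _).
by rewrite !ltn_round.
Qed.

Lemma vk_stopped u x k c : vk (stopped u x) k c = if (k < m x)%N then vk u k c else 0.
Proof.
rewrite /vk; under eq_bigr do rewrite stoppedE /=.
by case: ifP => // _; rewrite big1 ?mulr0.
Qed.

Lemma yh_stopped u x c : yh h (stopped u x) x c =
  \sum_(k < T) vk u k c * (h k x * (k < m x)%N%:R) - tc (stopped u x) c * flat_walk x.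
Proof.
rewrite /flat_walk mulr_sumr -sumrB; apply: eq_bigr => k _; rewrite /yk vk_stopped.
by case: ifP => _; rewrite /=; ring.
Qed.

Lemma avg_flat_walk_sqr : avg (fun x => flat_walk x ^+ 2) = 1.
Proof.
rewrite avg_ortho_sqr; last exact: (gadget_ortho_ord G).
by rewrite sumr_const card_ord -[_ *+ T]mulr_natr sT2.
Qed.

Lemma sum_stopped_le u x : \sum_i stopped u x i ^+ 2 <= \sum_i u i ^+ 2.
Proof.
by apply: ler_sum => i _; rewrite stoppedE; case: ifP => // _; rewrite expr0n; exact: sqr_ge0.
Qed.

(** Since the stopped integral is the same [g] for all [k], only [\sum_k vk u k c] matters, that is
    [tc]. By [gadget_size] the gain is [sqrt n / 2], although the complete walk has norm 1: this is
    Menshov's effect. *)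
Lemma avg_drift u : avg (fun x => \sum_c tc u c * (\sum_(k < T) vk u k c * (h k x * (k < m x)%N%:R))) =
  Num.sqrt n%:R / 2 * \sum_c tc u c ^+ 2.
Proof.
have gs : g * (sT * T%:R) = Num.sqrt n%:R / 2.
  have l0 : 0 <= g * (sT * T%:R) by rewrite !mulr_ge0// ltW// sT_gt0.
  have r0 : 0 <= Num.sqrt n%:R / 2 :> R by rewrite divr_ge0 ?sqrtr_ge0.
  apply/eqP; rewrite -(@eqrXn2 _ 2)// !exprMn sqr_sqrtr// -(gadget_size G).
  by apply/eqP; transitivity (sT ^+ 2 * T%:R * (g ^+ 2 * T%:R)); [ring|rewrite sT2//; field].
rewrite avg_sum mulr_sumr; apply: eq_bigr => c _; rewrite avgZ avg_sum.
rewrite (eq_bigr (fun k => vk u k c * g)) => [|k _]; last by rewrite avgZ (gadget_stop G).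
by rewrite -mulr_suml sum_vk// -gs; ring.
Qed.

(** Subtracting [sT * tc] in [yk] costs an error of at most [sqrt (2 C) * tau], by Cauchy-Schwarz
    and the norm 1 of [flat_walk]. The condition [32 * C <= n] makes it at most half of the
    drift. *)
Lemma avg_yh_tc u (C : R) : 1 <= C -> 32 * C <= n%:R ->
  \sum_i u i ^+ 2 <= 2 * C * \sum_c tc u c ^+ 2 ->
  Num.sqrt n%:R / 4 * \sum_c tc u c ^+ 2 <=
    avg (fun x => \sum_c tc u c * yh h (stopped u x) x c).
Proof.
move=> C1 Cn uC; set tau := \sum_c tc u c ^+ 2 in uC *.
have tau0 : 0 <= tau by apply: sumr_ge0 => c _; exact: sqr_ge0.
pose q := Num.sqrt (2 * C).
have q2 : q ^+ 2 = 2 * C by rewrite sqr_sqrtr// mulr_ge0// (le_trans _ C1).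
have q0 : 0 <= q by exact: sqrtr_ge0.
have qs : q <= Num.sqrt n%:R / 4.
  rewrite -ler_sqr ?nnegrE// ?divr_ge0 ?sqrtr_ge0// expr_div_n q2 sqr_sqrtr//.
  by lra.
pose e x := \sum_c tc u c * tc (stopped u x) c.
have -> : avg (fun x => \sum_c tc u c * yh h (stopped u x) x c) =
   Num.sqrt n%:R / 2 * tau - avg (fun x => e x * flat_walk x).
  rewrite -avg_drift -avgB; apply: eq_avg => x; rewrite /e mulr_suml -sumrB.
  by apply: eq_bigr => c _; rewrite yh_stopped; ring.
have eq x : `|e x| <= q * tau.
  rewrite -[q * tau]ger0_norm ?mulr_ge0// -ler_sqr ?nnegrE// !real_normK ?num_real//.
  apply: le_trans (sum_cauchy_schwarz _ _ _ _) _; rewrite exprMn q2 -/tau expr2 mulrA mulrC.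
  rewrite ler_wpM2r//; apply: le_trans uC; apply: le_trans (sum_stopped_le u x).
  exact: sum_tc2.
have H1 : avg (fun x => `|flat_walk x|) <= 1.
  rewrite -[leRHS]ger0_norm// -[leLHS]ger0_norm ?avg_ge0// -ler_sqr ?nnegrE// !real_normK ?num_real//.
  rewrite expr1n -avg_flat_walk_sqr; apply: le_trans (avg_sqr_le _ X_gt0) _.
  by apply: ler_avg => x; rewrite real_normK ?num_real.
have : `|avg (fun x => e x * flat_walk x)| <= q * tau.
  apply: le_trans (ler_norm_avg _) _.
  apply: (@le_trans _ _ (avg (fun x => q * tau * `|flat_walk x|))).
    by apply: ler_avg => x; rewrite normrM ler_wpM2r.
  by rewrite avgZ -[leRHS]mulr1 ler_wpM2l// mulr_ge0.
rewrite ler_norml => /andP[_ he].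
have : q * tau <= Num.sqrt n%:R / 4 * tau by rewrite ler_wpM2r.
lra.
Qed.

(** The factor [n], again from the few nonzero terms, is the square of the gain in [avg_drift]; so
    Paley-Zygmund loses no power of [n]. *)
Lemma avg_yh2 u : avg (fun x => \sum_c yh h (stopped u x) x c ^+ 2) <= 4 * n%:R * \sum_i u i ^+ 2.
Proof.
set U := \sum_i u i ^+ 2.
pose F x := \sum_c (\sum_(k < T) vk u k c * (h k x * (k < m x)%N%:R)) ^+ 2.
have Fle : avg F <= n%:R * U.
  apply: (@le_trans _ _ (avg (fun x => n%:R * \sum_c \sum_(k < T) vk u k c ^+ 2 * h k x ^+ 2))).
    apply: ler_avg => x; rewrite mulr_sumr; apply: ler_sum => c _.
    apply: le_trans (sqr_sum_le_card (n := n) _) _.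
      apply: leq_trans (gadget_few G x); rewrite -sum1_card big_mkcond /=.
      apply: leq_sum => k _; rewrite !inE.
      by case: (eqVneq (h k x) 0) => [->|_]; [rewrite mul0r mulr0 eqxx|case: ifP].
    rewrite ler_wpM2l//; apply: ler_sum => k _; rewrite [X in X <= _]exprMn.
    case: (k < m x)%N; first by rewrite mulr1.
    by rewrite mulr0 expr0n mulr0; apply: mulr_ge0; exact: sqr_ge0.
  rewrite avgZ ler_wpM2l// avg_sum; apply: le_trans (sum_vk2 L_gt0 u).
  rewrite [leRHS]exchange_big /=; apply: ler_sum => c _; rewrite avg_sum; apply: ler_sum => k _.
  by rewrite avgZ; under eq_avg do rewrite expr2; rewrite (gadget_ortho_ord G) eqxx mulr1.
have U0 : 0 <= U by apply: sumr_ge0 => i _; exact: sqr_ge0.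
have n1 : 1 <= n%:R :> R by rewrite (ler_nat R 1).
apply: (@le_trans _ _ (avg (fun x => 2 * F x + 2 * (U * flat_walk x ^+ 2)))); last first.
  rewrite avgD !avgZ avg_flat_walk_sqr mulr1.
  have : U <= n%:R * U by rewrite ler_peMl.
  lra.
apply: ler_avg => x; apply: (@le_trans _ _ (2 * F x + 2 * (\sum_c tc (stopped u x) c ^+ 2 * flat_walk x ^+ 2))).
  rewrite /F !mulr_sumr -big_split /=; apply: ler_sum => c _; rewrite yh_stopped.
  set a := \sum_(k < T) _; have := sqr_ge0 (a + tc (stopped u x) c * flat_walk x); rewrite -exprMn; lra.
rewrite lerD2l ler_wpM2l// -mulr_suml ler_wpM2r ?sqr_ge0//.
by apply: le_trans (sum_stopped_le u x); exact: sum_tc2.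
Qed.

(** [paley_zygmund] against the sign sum with coefficients [tc]. It gives the probability
    [1 / (2^12 * 192 * C^2)], and [192 <= 2^8]. *)
Lemma spike_walk u (C : R) : 1 <= C -> 32 * C <= n%:R ->
  \sum_i u i ^+ 2 <= 2 * C * \sum_c tc u c ^+ 2 -> 0 < \sum_c tc u c ^+ 2 ->
  (1/2) ^+ 20 / C ^+ 2 <= prob R (fun z : X * {ffun 'I_d -> bool} =>
     Num.sqrt n%:R / 8 * Num.sqrt (\sum_c tc u c ^+ 2) < `|rsum (yh h (stopped u z.1) z.1) z.2|).
Proof.
move=> C1 Cn uC; set tau := \sum_c tc u c ^+ 2 in uC * => tau0.
set s := Num.sqrt n%:R; have s2 : s ^+ 2 = n%:R by rewrite sqr_sqrtr.
have s0 : 0 <= s by exact: sqrtr_ge0.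
set t := Num.sqrt tau; have t2 : t ^+ 2 = tau by rewrite sqr_sqrtr// ltW.
have t0 : 0 <= t by exact: sqrtr_ge0.
have C0 : 0 < C by rewrite (lt_le_trans _ C1).
have n0 : 0 < n%:R :> R by rewrite ltr0n.
pose Y (z : X * {ffun 'I_d -> bool}) := rsum (yh h (stopped u z.1) z.1) z.2.
pose Z (z : X * {ffun 'I_d -> bool}) := rsum (tc u) z.2.
have a0 : 0 <= s / 8 * tau by rewrite mulr_ge0 ?divr_ge0// ltW.
have l0 : 0 <= s / 8 * t by rewrite mulr_ge0 ?divr_ge0.
have YZ : 2 * (s / 8 * tau) <= avg (fun z => Y z * Z z).
  rewrite avg_pair (eq_avg (g := fun x => \sum_c tc u c * yh h (stopped u x) x c)); last first.
    by move=> x; rewrite /Y /Z /= avg_rsum_mul; apply: eq_bigr => c _; rewrite mulrC.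
  apply: le_trans (avg_yh_tc C1 Cn uC); rewrite -/s -/tau; lra.
have sgn0 := @card_sgn_gt0 'I_d.
have Z2 : avg (fun z => Z z ^+ 2) = tau by rewrite (avg_snd (fun r => rsum (tc u) r ^+ 2))// avg_rsum_sqr.
have Zabs : s / 8 * t * avg (fun z => `|Z z|) <= s / 8 * tau.
  rewrite -mulrA ler_wpM2l ?divr_ge0// -t2 expr2 ler_wpM2l//.
  rewrite -[t]ger0_norm// -[leLHS]ger0_norm ?avg_ge0// -ler_sqr ?nnegrE// !real_normK ?num_real//.
  rewrite t2 -Z2; apply: le_trans (avg_sqr_le _ _) _; first by rewrite card_prod muln_gt0 X_gt0.
  by apply: ler_avg => z; rewrite real_normK ?num_real.
have Y2 : avg (fun z => Y z ^+ 2) <= 8 * n%:R * C * tau.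
  rewrite avg_pair /Y /=; under eq_avg do rewrite avg_rsum_sqr.
  apply: le_trans (avg_yh2 u) _; rewrite -/tau.
  by have := ler_wpM2l (ltW n0) uC; lra.
have Y20 : 0 <= avg (fun z => Y z ^+ 2) by apply: avg_ge0 => z; exact: sqr_ge0.
have Z4 : avg (fun z => Z z ^+ 4) <= 3 * tau ^+ 2.
  rewrite (avg_snd (fun r => rsum (tc u) r ^+ 4))//; exact: avg_rsum4.
have Z40 : 0 <= avg (fun z => Z z ^+ 4).
  by apply: avg_ge0 => z; rewrite (exprM _ 2 2) sqr_ge0.
have := paley_zygmund a0 l0 YZ Zabs; rewrite -/(Y _).
set P := prob _ _ => PZ; have P0 : 0 <= P by exact: prob_ge0.
have {}PZ : (s / 8 * tau) ^+ 4 <= (8 * n%:R * C * tau) ^+ 2 * (3 * tau ^+ 2) * P.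
  apply: le_trans PZ _; rewrite ler_wpM2r// ler_pM ?sqr_ge0// lerXn2r ?nnegrE//.
  by rewrite !mulr_ge0// ltW.
have e1 : (s / 8 * tau) ^+ 4 = (1/2) ^+ 12 * (n%:R ^+ 2 * tau ^+ 4).
  by rewrite -s2; field.
have e2 : (8 * n%:R * C * tau) ^+ 2 * (3 * tau ^+ 2) * P = 192 * (C ^+ 2 * P) * (n%:R ^+ 2 * tau ^+ 4) by ring.
move: PZ; rewrite e1 e2 ler_pM2r; last by rewrite mulr_gt0// exprn_gt0.
rewrite ler_pdivrMr ?exprn_gt0// (exprD _ 12 8) => PZ.
have : 0 <= C ^+ 2 * P by rewrite mulr_ge0// sqr_ge0.
have -> : (1/2) ^+ 8 = 1/256 :> R by field.
rewrite [P * _]mulrC; move: PZ; set e := (1/2) ^+ 12; lra.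
Qed.

(** The sum is cut at the stopping index of the gadget, after [m x] nodes of [L * d] coordinates. A
    spike needs a large walk, a large weight and, by [prob_symmetric], a favourable sign; the bounds
    [2^-20 / C^2], [2^-9 * min 1 tau] and [1/2] are multiplied. *)
Lemma spike u (C : R) om : 1 <= C -> 32 * C <= n%:R ->
  \sum_i u i ^+ 2 <= 2 * C * \sum_c tc u c ^+ 2 ->
  178 <= D%:R * \sum_c tc u c ^+ 2 ->
  (1/2) ^+ 30 / C ^+ 2 * Num.min 1 (\sum_c tc u c ^+ 2) <=
  prob R (fun z : noise => [exists k : 'I_(T * L * d).+1,
     1 <= `|ph f (cut u k) om + psi h (cut u k) z|]).
Proof.
move=> C1 Cn uC; set tau := \sum_c tc u c ^+ 2 in uC * => Dtau.
have D0 : 0 < D%:R :> R by rewrite ltr0n.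
have tau0 : 0 < tau by rewrite -(pmulr_rgt0 _ D0) (lt_le_trans _ Dtau).
have C0 : 0 < C by rewrite (lt_le_trans _ C1).
set lam := Num.sqrt n%:R / 8 * Num.sqrt tau.
have lam0 : 0 <= lam by rewrite mulr_ge0 ?divr_ge0 ?sqrtr_ge0.
have lam2 : lam ^+ 2 = n%:R * tau / 64.
  by rewrite exprMn expr_div_n !sqr_sqrtr ?(ltW tau0)//; field.
have PW := spike_walk C1 Cn uC tau0; rewrite -/tau -/lam in PW.
have hh := @harm_gt0 R _ D_gt0.
have Pw : (1/2) ^+ 9 * Num.min 1 tau <= prob R (fun w : 'I_D => 1 <= 3/5 * weight R w * lam).
  (* Here [9/1600 = (3/5)^2 / 64]: since [harm <= n], every [w] with [w.+1 <= D * tau * 9/1600] has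
     a sufficient weight. The threshold 178 ensures that there is at least one. *)
  have B1 : 1 <= D%:R * tau * (9/1600) by lra.
  apply: (@le_trans _ _ (Num.min 1 (D%:R * tau * (9/1600) / D%:R) / 2)).
    rewrite (_ : _ / D%:R = 9/1600 * tau); last by field; rewrite gt_eqF.
    have -> : (1/2) ^+ 9 = 1/512 :> R by field.
    by rewrite !minEle; case: (leP 1 tau) => ?; case: (leP 1 (9/1600 * tau)) => ?; lra.
  apply: le_trans (prob_le_ord B1) _; apply: le_prob => w hw.
  have w0 : 0 < w.+1%:R :> R by rewrite ltr0n.
  have W0 : 0 <= 3/5 * weight R w * lam.
    by apply: mulr_ge0 => //; apply: mulr_ge0; [rewrite divr_ge0|exact: sqrtr_ge0].
  rewrite -(@expr_ge1 _ 2)// exprMn lam2 exprMn weight_sqr//.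
  have q : 1 <= n%:R / harm R D by rewrite ler_pdivlMr// mul1r.
  apply: (@le_trans _ _ (D%:R * tau * (9/1600) / w.+1%:R)); first by rewrite ler_pdivlMr// mul1r.
  rewrite (_ : _ * (n%:R * tau / 64) = D%:R * tau * (9/1600) / w.+1%:R * (n%:R / harm R D)); last first.
    by field; rewrite (gt_eqF hh) addrC natr1 (gt_eqF w0).
  apply: ler_peMr; last exact: q.
  apply: divr_ge0; last exact: ltW.
  by apply: mulr_ge0; [apply: mulr_ge0; exact: ltW|lra].
have kT x : (m x * (L * d) < (T * L * d).+1)%N.
  by rewrite ltnS -mulnA leq_mul2r (gadget_m G) orbT.
apply: (@le_trans _ _ (prob R (fun w : 'I_D => 1 <= 3/5 * weight R w * lam) *
   prob R (fun z : X * {ffun 'I_d -> bool} => lam < `|rsum (yh h (stopped u z.1) z.1) z.2|) / 2)).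
  have h0 : 0 <= 1/2 :> R by lra.
  have e0 : 0 <= (1/2) ^+ 20 / C ^+ 2 by rewrite divr_ge0 ?sqr_ge0// exprn_ge0.
  have m0 : 0 <= (1/2) ^+ 9 * Num.min 1 tau.
    by rewrite mulr_ge0 ?exprn_ge0// le_min ler01 ltW.
  have := ler_pM m0 e0 Pw PW.
  have -> : (1/2) ^+ 30 / C ^+ 2 * Num.min 1 tau =
     ((1/2) ^+ 9 * Num.min 1 tau) * ((1/2) ^+ 20 / C ^+ 2) / 2.
    by rewrite (exprD _ 9 21) (exprS _ 20); ring.
  by lra.
rewrite /prob avg_noise -avg_prod -avgZr avg_pair; apply: ler_avg => w.
rewrite avg_pair; apply: ler_avg => x /=.
rewrite -[leLHS](@avg_cst _ {ffun I -> bool}) ?card_sgn_gt0//; apply: ler_avg => r.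
(* With [w], [x] and [r] fixed, everything but the gadget is a constant, and the signs [ga] are
   still free. *)
pose a := ph f (stopped u x) om + rsum (bb (stopped u x)) r.
apply: (@le_trans _ _ (prob R (fun ga => 1 <= `|a + 3/5 * weight R w * rsum (yh h (stopped u x) x) ga|))).
  apply: le_trans (prob_symmetric _ _ _); rewrite avgZr ler_wpM2r ?invr_ge0//.
  apply: ler_avg => ga; case: (leP 1 _) => hw /=; last by rewrite mul0r.
  rewrite mul1r.
  have W0 : 0 <= 3/5 * weight R w by apply: mulr_ge0; [rewrite divr_ge0|exact: sqrtr_ge0].
  rewrite normrM (ger0_norm W0); case: ltP => //= hl.
  have -> // : 1 <= 3 / 5 * weight R w * `|rsum (yh h (stopped u x) x) ga|.
  by apply: le_trans hw _; apply: ler_wpM2l => //; exact: ltW.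
apply: le_prob => ga hga; apply/existsP; exists (Ordinal (kT x)).
by rewrite /psi /= addrA.
Qed.

End Spike.

(** * Existence of blocks *)
Section Linearity.
Variables (R : realType) (T L d D : nat) (X : finType) (h : nat -> X -> R).
Local Notation I := (index T L d).
Local Notation sT := (sT R T).
Local Notation sL := (sL R L).
Implicit Types (u : I -> R).

Definition delta (i : nat) (j : I) : R := (code j == i)%:R.

Lemma code_inj : injective (@code T L d).
Proof.
move=> [[k p] c] [[k' p'] c']; rewrite /code /= => e.
have d0 : (0 < d)%N by case: (d) c {e c'} => [[]|].
have e1 : (k * L + p)%N = (k' * L + p')%N.
  by have := congr1 (fun j => j %/ d)%N e; rewrite !divnMDl// !divn_small// !addn0.
have L0 : (0 < L)%N by case: (L) p {e e1 p'} => [[]|].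
have e2 : k = k' :> nat.
  by have := congr1 (fun j => j %/ L)%N e1; rewrite !divnMDl// !divn_small// !addn0.
move: e e1; rewrite e2 => + /addnI /val_inj e3; rewrite e3 => /addnI /val_inj ->.
by move/val_inj: e2 => ->.
Qed.

Lemma sum_mul_ord (A B : nat) (F : nat -> R) :
  \sum_(a < A) \sum_(b < B) F (a * B + b)%N = \sum_(i < A * B) F i.
Proof.
elim: A => [|A IH]; first by rewrite mul0n !big_ord0.
by rewrite big_ord_recr /= IH mulSnr big_split_ord.
Qed.

Lemma sum_code (F : nat -> R) : \sum_(j : I) F (code j) = \sum_(i < T * L * d) F i.
Proof.
rewrite -sum_mul_ord -(sum_mul_ord T L (fun a => \sum_(b < d) F (a * d + b)%N)).
by rewrite pair_bigA /= pair_bigA; apply: eq_bigr => -[[k p] c].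
Qed.

Lemma sum_delta (v : I -> R) i : \sum_j v j * delta (code i) j = v i.
Proof.
rewrite (bigD1 i)//= /delta eqxx mulr1 big1 ?addr0// => j ji.
by rewrite (inj_eq code_inj) (negPf ji) mulr0.
Qed.

Lemma linear_sum (Phi : (I -> R) -> R) :
  (forall u v, Phi (fun j => u j + v j) = Phi u + Phi v) ->
  (forall a u, Phi (fun j => a * u j) = a * Phi u) ->
  (forall u v, u =1 v -> Phi u = Phi v) ->
  forall u, Phi u = \sum_j u j * Phi (delta (code j)).
Proof.
move=> PD PZ Pe u.
have P0 : Phi (fun=> 0) = 0.
  by rewrite -[RHS](mul0r (Phi u)) -PZ; apply: Pe => j; rewrite mul0r.
have H (s : seq I) : Phi (fun j => \sum_(i <- s) u i * delta (code i) j) =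
    \sum_(i <- s) u i * Phi (delta (code i)).
  elim: s => [|i s IH]; first by rewrite big_nil -[RHS]P0; apply: Pe => j; rewrite big_nil.
  by rewrite big_cons -IH -PZ -PD; apply: Pe => j; rewrite big_cons.
rewrite -H; apply: Pe => j; rewrite -[LHS](sum_delta u j).
by apply: eq_bigr => i _; rewrite /delta eq_sym.
Qed.

Lemma eq_vk u v k c : u =1 v -> vk u k c = vk v k c.
Proof. by move=> uv; rewrite /vk; under eq_bigr do rewrite uv. Qed.
Lemma eq_tc u v c : u =1 v -> tc u c = tc v c.
Proof. by move=> uv; rewrite /tc; congr (_ * _); apply: eq_bigr => k _; exact: eq_vk. Qed.
Lemma eq_yk u v k c : u =1 v -> yk u k c = yk v k c.
Proof. by move=> uv; rewrite /yk (eq_vk _ _ uv) (eq_tc _ uv). Qed.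
Lemma eq_bb u v i : u =1 v -> bb u i = bb v i.
Proof. by move=> uv; rewrite /bb (eq_vk _ _ uv) (eq_yk _ _ uv) uv. Qed.

Lemma eq_psi u v (z : noise T L d D X) : u =1 v -> psi h u z = psi h v z.
Proof.
move=> uv; rewrite /psi /rsum; congr (_ + _ * _); first by apply: eq_bigr => i _; rewrite (eq_bb _ uv).
by apply: eq_bigr => c _; congr (_ * _); apply: eq_bigr => k _; rewrite (eq_yk _ _ uv).
Qed.

Lemma psi_linear u (z : noise T L d D X) : psi h u z = \sum_j u j * psi h (delta (code j)) z.
Proof.
apply: (linear_sum (Phi := fun u => psi h u z)) => [{}u v|a {}u|{}u v]; last exact: eq_psi.
- rewrite /psi; have -> : rsum (bb (fun j => u j + v j)) z.1.1.1 = rsum (bb u) z.1.1.1 + rsum (bb v) z.1.1.1.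
    by rewrite -rsumD; apply: eq_bigr => i _; rewrite bbD.
  have -> : rsum (yh h (fun j => u j + v j) z.2) z.1.1.2 = rsum (yh h u z.2) z.1.1.2 + rsum (yh h v z.2) z.1.1.2.
    rewrite -rsumD; apply: eq_bigr => c _; congr (_ * _); rewrite /yh -big_split.
    by apply: eq_bigr => k _; rewrite ykD mulrDl.
  by ring.
- rewrite /psi; have -> : rsum (bb (fun j => a * u j)) z.1.1.1 = a * rsum (bb u) z.1.1.1.
    by rewrite -rsumZ; apply: eq_bigr => i _; rewrite bbZ.
  have -> : rsum (yh h (fun j => a * u j) z.2) z.1.1.2 = a * rsum (yh h u z.2) z.1.1.2.
    rewrite -rsumZ; apply: eq_bigr => c _; congr (_ * _); rewrite /yh mulr_sumr.
    by apply: eq_bigr => k _; rewrite ykZ mulrA.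
  by ring.
Qed.

Lemma ph_linear (Om : finType) (f : 'I_d -> Om -> R) u om : ph f u om = \sum_j u j * ph f (delta (code j)) om.
Proof.
apply: (linear_sum (Phi := fun u => ph f u om)) => [{}u v|a {}u|{}u v uv]; rewrite /ph.
- by rewrite -big_split; apply: eq_bigr => c _; rewrite tcD mulrDl.
- by rewrite mulr_sumr; apply: eq_bigr => c _; rewrite tcZ mulrA.
- by apply: eq_bigr => c _; rewrite (eq_tc _ uv).
Qed.

Lemma sum_cut_code (u : nat -> R) (Phi : nat -> R) k : (k <= T * L * d)%N ->
  \sum_(i < k) u i * Phi i = \sum_(j : I) cut (fun j => u (code j)) k j * Phi (code j).
Proof.
move=> kN; rewrite (sum_code (fun i => (if (i < k)%N then u i else 0) * Phi i)).
rewrite (big_ord_widen _ (fun i => u i * Phi i) kN) big_mkcond /=.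
by apply: eq_bigr => i _; case: ifP; rewrite ?mul0r.
Qed.

Lemma cut_full u : cut u (T * L * d) =1 u.
Proof.
move=> j; rewrite /cut (_ : (_ < _)%N = true)// /code.
by case: j => [[k p] c] /=; rewrite ltn_round// ltn_round// ltn_ord.
Qed.

End Linearity.

(** * Sup norm of the block functions *)

Section Sup.
Variables (R : realType) (T L d D n : nat) (X : finType).
Variables (h : nat -> X -> R) (m : X -> nat) (g : R).
Hypotheses (T_gt0 : (0 < T)%N) (L_gt0 : (0 < L)%N).
Variables (Om : finType) (f : 'I_d -> Om -> R).
Local Notation I := (index T L d).
Local Notation sT := (sT R T).
Local Notation sL := (sL R L).
Local Notation dlt := (@delta R T L d).

Lemma ek_delta (k : 'I_T) (c : 'I_d) (i : I) : vk (dlt (code i)) k c = ek R k c i.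
Proof.
rewrite -sum_ek (bigD1 i)//= /delta eqxx mul1r big1 ?addr0// => j ji.
by rewrite (inj_eq (@code_inj _ _ _)) (negPf ji) mul0r.
Qed.

Lemma tc_delta (c : 'I_d) (i : I) : tc (dlt (code i)) c = sT * sL * (i.2 == c)%:R.
Proof.
rewrite /tc (bigD1 i.1.1)//= big1 => [|k ki]; last by rewrite ek_delta /ek eq_sym (negPf ki) mulr0.
by rewrite addr0 ek_delta /ek eqxx /= mulrA.
Qed.

Lemma gbar_le (k : 'I_T) (c : 'I_d) (r : {ffun I -> bool}) : `|gbar R k c r| <= sL * L%:R :> R.
Proof.
rewrite /gbar /rsum sum_index (bigD1 k)//= (bigD1 c)//= [X in _ + X + _]big1 => [|c' c'c]; last first.
  by apply: big1 => p _; rewrite /ek /= eqxx (negPf c'c) /= mulr0 mul0r.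
rewrite [X in _ + X]big1 => [|k' k'k]; last first.
  by apply: big1 => c' _; apply: big1 => p _; rewrite /ek /= (negPf k'k) /= mulr0 mul0r.
rewrite !addr0; apply: le_trans (ler_norm_sum _ _ _) _.
rewrite (eq_bigr (fun=> sL)); last first.
  move=> p _; rewrite normrM norm_rsg /ek /= !eqxx /= !mulr1 ger0_norm// ltW//.
  exact: sL_gt0.
by rewrite sumr_const card_ord -[_ *+ L]mulr_natr.
Qed.

Lemma rsum_ac_le (c : 'I_d) (r : {ffun I -> bool}) : `|rsum (@ac R T L d c) r| <= sT * sL * (T * L)%:R :> R.
Proof.
rewrite /rsum; apply: le_trans (ler_norm_sum _ _ _) _.
rewrite sum_index exchange_big (bigD1 c)//= [X in _ + X]big1 => [|c' c'c]; last first.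
  by apply: big1 => k _; apply: big1 => p _; rewrite /ac /= (negPf c'c) !mulr0 mul0r normr0.
rewrite addr0 (eq_bigr (fun=> sT * sL * L%:R)); last first.
  move=> k _; rewrite (eq_bigr (fun=> sT * sL)); last first.
    move=> p _; rewrite normrM norm_rsg /ac /= eqxx /= !mulr1 ger0_norm// ltW//.
    by rewrite mulr_gt0 ?sL_gt0 ?sT_gt0.
  by rewrite sumr_const card_ord -[_ *+ L]mulr_natr.
by rewrite sumr_const card_ord -[_ *+ T]mulr_natr natrM -!mulrA [T%:R * _]mulrC.
Qed.

(** For a unit vector the pure sign terms of [theta_decomp] are bounded by 1, 1/5 and 4/5, the last
    one from [residual]; this is the 2. All other terms carry a factor [sL], which is small when
    there are many rounds. *)
Lemma theta_sup (B : R) :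
  (forall om (w : 'I_D) x (k : 'I_T) c, 3/5 * weight R w * `|h k x| + sT * (`|f c om| + 3/5 * weight R w * `|flat_walk T h x|) <= B) ->
  forall (i : I) om (z : noise T L d D X),
   `|ph f (dlt (code i)) om + psi h (dlt (code i)) z| <= 2 + sL * B.
Proof.
move=> HB i om z; rewrite (theta_decomp h f (dlt (code i)) (om, z)) /=.
move: z => [[[r ga] w] x]; case: i => [[k p] c] /=.
set u := dlt _.
have s0 : 0 < sL by exact: sL_gt0.
have t0 : 0 < sT by exact: sT_gt0.
have W0 : 0 <= 3/5 * weight R w by apply: mulr_ge0; [rewrite divr_ge0|exact: sqrtr_ge0].
have a1 : `|rsum u r| <= 1.
  rewrite /rsum (bigD1 ((k, p), c))//= /u /delta eqxx mul1r big1 ?addr0 ?norm_rsg// => j ji.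
  by rewrite (inj_eq (@code_inj _ _ _)) (negPf ji) mul0r.
have vkE (F : 'I_T -> 'I_d -> R) : \sum_k' \sum_c' vk u k' c' * F k' c' = sL * F k c.
  rewrite (bigD1 k)//= (bigD1 c)//= [X in _ + X + _]big1 => [|c' c'c]; last first.
    by rewrite ek_delta /ek /= eqxx [c == _]eq_sym (negPf c'c) /= mulr0 mul0r.
  rewrite [X in _ + X]big1 => [|k' k'k]; last first.
    by apply: big1 => c' _; rewrite ek_delta /ek /= [k == _]eq_sym (negPf k'k) /= mulr0 mul0r.
  by rewrite !addr0 ek_delta /ek /= !eqxx mulr1.
have a2 : `|\sum_k \sum_c vk u k c * gbar R k c r| <= 1.
  rewrite (vkE (fun k c => gbar R k c r)) normrM gtr0_norm//.
  apply: (@le_trans _ _ (sL * (sL * L%:R))); first by rewrite ler_wpM2l ?(ltW s0)// gbar_le.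
  by rewrite mulrA -expr2 sL2.
have a3 : \sum_(k < T) h k x * (\sum_c vk u k c * rsg R (ga c)) = sL * (h k x * rsg R (ga c)).
  rewrite -(vkE (fun k c => h k x * rsg R (ga c))); apply: eq_bigr => k' _.
  by rewrite mulr_sumr; apply: eq_bigr => c' _; rewrite mulrCA.
have a4 : \sum_c' tc u c' * residual h f (om, (r, ga, w, x)) c' = sT * sL * residual h f (om, (r, ga, w, x)) c.
  rewrite (bigD1 c)//= tc_delta /= eqxx mulr1 big1 ?addr0// => c' c'c.
  by rewrite tc_delta /= eq_sym (negPf c'c) mulr0 mul0r.
rewrite a3 a4 /residual /= -/(flat_walk T h x).
have a5 : sT * sL * `|rsum (@ac R T L d c) r| <= 1.
  apply: (@le_trans _ _ (sT * sL * (sT * sL * (T * L)%:R))).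
    by rewrite ler_wpM2l ?mulr_ge0 ?(ltW s0) ?(ltW t0)// rsum_ac_le.
  rewrite (_ : _ * _ = sT ^+ 2 * T%:R * (sL ^+ 2 * L%:R)); last by rewrite natrM; ring.
  by rewrite sT2// sL2// mulr1.
have g1 (y : R) : `|y * rsg R (ga c)| = `|y| by rewrite normrM norm_rsg mulr1.
have b3 : `|3/5 * weight R w * (sL * (h k x * rsg R (ga c)))| <= sL * (3/5 * weight R w * `|h k x|).
  by rewrite normrM (ger0_norm W0) normrM (gtr0_norm s0) g1 mulrCA lexx.
have c1 : `|sT * sL * f c om| = sL * (sT * `|f c om|).
  by rewrite !normrM (gtr0_norm s0) (gtr0_norm t0) mulrA [sL * _]mulrC.
have c3 : `|sT * sL * (3/5 * weight R w * flat_walk T h x * rsg R (ga c))| = sL * (sT * (3/5 * weight R w * `|flat_walk T h x|)).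
  by rewrite normrM g1 (gtr0_norm (mulr_gt0 t0 s0)) normrM (ger0_norm W0); ring.
have c2 : `|sT * sL * rsum (@ac R T L d c) r| <= 1 by rewrite !normrM (gtr0_norm s0) (gtr0_norm t0).
have hB := ler_wpM2l (ltW s0) (HB om w x k c); rewrite !mulrDr in hB.
rewrite !mulrBr.
move: a1 a2 b3 c2 (lexx `|sT * sL * f c om|) (lexx `|sT * sL * (3/5 * weight R w * flat_walk T h x * rsg R (ga c))|).
rewrite {2}c1 {2}c3 !ler_norml => /andP[? ?] /andP[? ?] /andP[? ?] /andP[? ?] /andP[? ?] /andP[? ?].
by apply/andP; split; lra.
Qed.

End Sup.

(** * Blocks over finite sets, with all parameters chosen *)

Section BlockSpec.
Variable R : realType.

Definition lin (N : nat) (u : nat -> R) (q : nat -> nat -> R) (j : nat) : R :=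
  \sum_(i < N) u i * q i j.
Definition mean_sqr (M N : nat) (u : nat -> R) (q : nat -> nat -> R) : R :=
  avg (fun j : 'I_M => lin N u q j ^+ 2).

(* One block of the system: [theta_i (om, xi) = ph_i om + ps_i xi], where [om]
   ranges over the [M] atoms of the past and [xi] over [m] fresh values. *)
Record block_spec (s M m N : nat) (ph ps : nat -> nat -> R) : Prop := {
  bs_size : (N < m)%N;
  bs_gt0 : (0 < N)%N;
  bs_mean : forall u, avg (fun xi : 'I_m => lin N u ps xi) = 0;
  bs_energy : forall u : nat -> R, \sum_(i < N) u i ^+ 2 = mean_sqr M N u ph + mean_sqr m N u ps;
  bs_weak : forall (u : nat -> R) (lam : R), 0 < lam ->
    avg (fun om : 'I_M => prob R (fun xi : 'I_m => [exists k : 'I_N.+1,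
      lam < `|lin k u ph om + lin k u ps xi|])) <=
    730 * (\sum_(i < N) u i ^+ 2) / lam ^+ 2;
  bs_spike : forall (u : nat -> R) (C : R) (om : 'I_M), 1 <= C -> 32 * C <= (s + 9)%:R ->
    mean_sqr m N u ps <= C * mean_sqr M N u ph -> (1/2) ^+ s <= mean_sqr M N u ph ->
    (1/2) ^+ 30 / C ^+ 2 * Num.min 1 (mean_sqr M N u ph) <=
    prob R (fun xi : 'I_m => [exists k : 'I_N.+1, 1 <= `|lin k u ph om + lin k u ps xi|]);
  bs_test : forall u : nat -> R, exists Y : nat -> R,
    [/\ avg (fun xi : 'I_m => Y xi) = 0,
        16/25 * mean_sqr m N u ps <= avg (fun xi : 'I_m => Y xi * lin N u ps xi),
        avg (fun xi : 'I_m => Y xi ^+ 2) <= mean_sqr m N u ps &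
        avg (fun xi : 'I_m => Y xi ^+ 4) <= 3 * mean_sqr m N u ps ^+ 2];
  bs_sup : forall i om xi, (i < N)%N -> (om < M)%N -> (xi < m)%N ->
    `|ph i om + ps i xi| <= 1 + Num.sqrt 2 }.

Lemma avg_enum (T : finType) (x0 : T) (F : T -> R) :
  avg (fun j : 'I_#|T| => F (nth x0 (enum T) j)) = avg F.
Proof.
rewrite /avg card_ord; congr (_ / _).
rewrite [RHS](reindex (@enum_val T T)) /=; last first.
  by apply: onW_bij; exact: enum_val_bij.
by apply: eq_bigr => j _; rewrite (enum_val_nth x0).
Qed.

Lemma prob_enum (T : finType) (x0 : T) (A : pred T) :
  prob R (fun j : 'I_#|T| => A (nth x0 (enum T) j)) = prob R A.
Proof. exact: (avg_enum x0 (fun z => (A z)%:R)). Qed.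

(** Doubling the range adds between 1/2 and 1 to the harmonic sum. The upper bound serves [spike],
    the lower one [weak_type]. *)
Lemma harm_pow2 q : harm R (2 ^ q) <= q.+1%:R /\ q.+2%:R <= 2 * harm R (2 ^ q).
Proof.
elim: q => [|q [IH1 IH2]].
  by rewrite expn0 /harm big_ord1 invr1 mulr1; split.
have -> : harm R (2 ^ q.+1) = harm R (2 ^ q) + \sum_(w < 2 ^ q) (2 ^ q + w).+1%:R^-1.
  by rewrite /harm expnS mul2n -addnn big_split_ord.
have p0 : 0 < (2 ^ q)%:R :> R by rewrite ltr0n expn_gt0.
have up : \sum_(w < 2 ^ q) (2 ^ q + w).+1%:R^-1 <= 1 :> R.
  apply: (@le_trans _ _ (\sum_(w < 2 ^ q) (2 ^ q)%:R^-1)).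
    by apply: ler_sum => w _; rewrite lef_pV2 ?posrE ?ltr0n ?expn_gt0// ler_nat; lia.
  by rewrite sumr_const card_ord -[_ *+ _]mulr_natr mulVf// gt_eqF.
have lo : 1/2 <= \sum_(w < 2 ^ q) (2 ^ q + w).+1%:R^-1 :> R.
  apply: (@le_trans _ _ (\sum_(w < 2 ^ q) (2 * (2 ^ q)%:R)^-1)).
    rewrite sumr_const card_ord -[_ *+ (2 ^ q)]mulr_natr le_eqVlt; apply/orP; left; apply/eqP.
    by move: p0; set z := (2 ^ q)%:R => p0; field; rewrite gt_eqF.
  apply: ler_sum => w _; rewrite lef_pV2 ?posrE ?ltr0n ?mulr_gt0 ?ltr0n ?expn_gt0// -natrM ler_nat.
  by have := ltn_ord w; lia.
by split; rewrite -natr1; lra.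
Qed.

Theorem block_exists (s M d : nat) (f : nat -> nat -> R) : (0 < M)%N -> (0 < d)%N ->
  (forall c c', (c < d)%N -> (c' < d)%N -> avg (fun om : 'I_M => f c om * f c' om) = (c == c')%:R) ->
  exists m N (a : nat -> nat -> R) (U : nat -> nat -> R) (ps : nat -> nat -> R),
    let ph i om := \sum_(c < d) a i c * f c om in
    block_spec s M m N ph ps /\
    (forall c om xi, (c < d)%N -> (om < M)%N -> (xi < m)%N ->
       f c om = lin N (U c) ph om + lin N (U c) ps xi).
Proof.
move=> M0 d0 fo.
have [T [X [h [mm [g [T0 g0 G]]]]]] := menshov_gadget R (s + 8).
have [hle hge] := harm_pow2 (s + 8).
(* With a gadget of [n = s + 9] this gives [harm <= n <= 2 * harm]; and [2^8 >= 178] yields the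
   threshold of [spike] as soon as [tau >= (1/2)^s]. *)
pose D := (2 ^ (s + 8))%N.
have D0 : (0 < D)%N by rewrite expn_gt0.
pose fo' (c : 'I_d) (om : 'I_M) := f c om.
have f_ortho (c c' : 'I_d) : avg (fun om => fo' c om * fo' c' om) = (c == c')%:R by rewrite fo.
have [B HB] : exists B : R, forall om (w : 'I_D) x (k : 'I_T) c,
    3/5 * weight R w * `|h k x| + sT R T * (`|fo' c om| + 3/5 * weight R w * `|flat_walk T h x|) <= B.
  pose F (y : 'I_M * 'I_D * X * 'I_T * 'I_d) := 3/5 * weight R y.1.1.1.2 * `|h y.1.2 y.1.1.2| +
    sT R T * (`|fo' y.2 y.1.1.1.1| + 3/5 * weight R y.1.1.1.2 * `|flat_walk T h y.1.1.2|).
  exists (\sum_y `|F y|) => om w x k c.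
  rewrite (bigD1 (om, w, x, k, c))//= (le_trans (ler_norm _))// lerDl.
  by apply: sumr_ge0.
(* [L >= d] is for [weak_type]; [L > 9 * B^2] makes the error [sL * B] of [theta_sup] at most
   1/3. *)
pose L := (maxn d (Num.truncn (9 * B ^+ 2)).+1)%N.
have L0 : (0 < L)%N by rewrite /L leq_max orbT.
have dL : (d <= L)%N by rewrite /L leq_max leqnn.
have LB : sL R L * B <= 1/3.
  have s0 := sL_gt0 R L0.
  case: (lerP B 0) => B0; first by rewrite (le_trans (mulr_ge0_le0 (ltW s0) B0)) ?divr_ge0.
  have l0 : 0 <= sL R L * B by rewrite mulr_ge0 ?(ltW B0) ?(ltW s0).
  have r0 : 0 <= 1/3 :> R by rewrite divr_ge0.
  rewrite -ler_sqr ?nnegrE// exprMn.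
  have e : 9 * B ^+ 2 <= L%:R.
    apply: le_trans (ltW (truncnS_gt _)) _.
    by rewrite ler_nat leq_max leqnn orbT.
  have := ler_wpM2l (sqr_ge0 (sL R L)) e; rewrite sL2//; lra.
pose N := (T * L * d)%N.
pose noiseT : finType := noise T L d D X.
have cn : #|{: noise T L d D X}| = (2 ^ N * 2 ^ d * D * #|X|)%N by exact: card_noise.
have n0 : (0 < #|{: noise T L d D X}|)%N by apply: card_noise_gt0 G.
have /card_gt0P[z0 _] := n0.
pose m := #|{: noise T L d D X}|.
pose dec j := nth z0 (enum {: noise T L d D X}) j.
pose dl := @delta R T L d.
pose a i (c : nat) := if insub c is Some c' then tc (dl i) c' else 0.
pose ps i j := psi h (dl i) (dec j).
(* The vector [ac c], read through [code], whose remainder modulo [d] is the coordinate [c]. Its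
   [bb] and [yk] vanish, so the block reproduces the old function with no fresh part. *)
pose U c i := sT R T * sL R L * (i %% d == c)%N%:R.
have phE i om : \sum_(c < d) a i c * f c om = if insub om is Some om' then ph fo' (dl i) om' else \sum_(c < d) a i c * f c om.
  by case: insubP => // om' _ <-; apply: eq_bigr => c _; rewrite /a valK.
exists m, N, a, U, ps => ph'.
have ph'E i (om : 'I_M) : ph' i om = ph fo' (dl i) om.
  by rewrite /ph' phE valK.
have linph (u : nat -> R) k (om : 'I_M) : (k <= N)%N ->
    lin k u ph' om = ph fo' (cut (fun j : index T L d => u (code j)) k) om.
  move=> kN; rewrite ph_linear; transitivity (\sum_(i < k) u i * ph fo' (dl i) om).
    by apply: eq_bigr => i _; rewrite ph'E.
  exact: (@sum_cut_code R T L d u (fun i => ph fo' (dl i) om) k kN).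
have linps (u : nat -> R) k (j : nat) : (k <= N)%N ->
    lin k u ps j = psi h (cut (fun j : index T L d => u (code j)) k) (dec j).
  by move=> kN; rewrite psi_linear; exact: (@sum_cut_code R T L d u (fun i => psi h (dl i) (dec j)) k kN).
have linphN (u : nat -> R) (om : 'I_M) : lin N u ph' om = ph fo' (fun j : index T L d => u (code j)) om.
  by rewrite linph//; apply: eq_bigr => c _; rewrite (eq_tc _ (cut_full _)).
have linpsN (u : nat -> R) j : lin N u ps j = psi h (fun j : index T L d => u (code j)) (dec j).
  by rewrite linps// (eq_psi _ _ (cut_full _)).
have ttph (u : nat -> R) : mean_sqr M N u ph' = \sum_c tc (fun j : index T L d => u (code j)) c ^+ 2.
  by rewrite -(avg_ph2 f_ortho); apply: eq_avg => om; rewrite linphN.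
have ttps (u : nat -> R) : mean_sqr m N u ps = avg (fun z : noise T L d D X => psi h (fun j : index T L d => u (code j)) z ^+ 2).
  rewrite -(avg_enum z0 (fun z => psi h (fun j : index T L d => u (code j)) z ^+ 2)).
  by apply: eq_avg => j; rewrite linpsN.
have sumU (u : nat -> R) : \sum_(i < N) u i ^+ 2 = \sum_(j : index T L d) u (code j) ^+ 2.
  by rewrite -(sum_code T L d (fun i => u i ^+ 2)).
have energyN (u : nat -> R) : \sum_(i < N) u i ^+ 2 = mean_sqr M N u ph' + mean_sqr m N u ps.
  by rewrite sumU energy// ttph ttps (avg_psi2 D0 G).
split; first split => //.
- rewrite /m cn -mulnA -mulnA; apply: (leq_trans (ltn_expl N (isT : (1 < 2)%N))).
  by rewrite leq_pmulr// !muln_gt0 expn_gt0 D0 (gadget_card G).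
- by rewrite !muln_gt0 T0 L0 d0.
- move=> u; rewrite (eq_avg (g := fun j : 'I_m => psi h (fun j : index T L d => u (code j)) (dec j))) => [|j]; last exact: linpsN.
  by rewrite (avg_enum z0 (psi h (fun j : index T L d => u (code j)))) avg_psi.
- move=> u lam lam0.
  have ge : (s + 8).+1%:R <= 2 * harm R D by apply: le_trans hge; rewrite ler_nat.
  have M0' : (0 < #|'I_M|)%N by rewrite card_ord.
  have := weak_type T0 L0 D0 G M0' f_ortho dL ge (fun j : index T L d => u (code j)) lam0.
  rewrite sumU; apply: le_trans; rewrite [leRHS]/prob avg_pair.
  rewrite le_eqVlt; apply/orP; left; apply/eqP; apply: eq_avg => om.
  rewrite -(avg_enum z0); apply: eq_avg => j; congr (nat_of_bool _)%:R.
  by apply: eq_existsb => k; rewrite linph ?linps// -ltnS.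
- move=> u C om C1 Cn tC ts.
  have D0' : 0 < D%:R :> R by rewrite ltr0n.
  have := spike T0 L0 D0 (ltn0Sn _) G g0 fo' hle (u := fun j : index T L d => u (code j)) om C1.
  rewrite -ttph -sumU energyN -(prob_enum z0) => H.
  apply: (le_trans (H _ _ _)).
  + by rewrite -addnS.
  + have : 0 <= mean_sqr M N u ph' by apply: avg_ge0 => ?; exact: sqr_ge0.
    have : mean_sqr M N u ph' <= C * mean_sqr M N u ph' by rewrite ler_peMl//; apply: avg_ge0 => ?; exact: sqr_ge0.
    lra.
  + apply: (@le_trans _ _ (D%:R * (1/2) ^+ s)); last by rewrite ler_wpM2l.
    by rewrite /D expnD natrM mulrAC natrX -exprMn mulrC (_ : 2 * (1/2) = 1) ?expr1n ?mul1r ?mulr1 ?ler_nat//; field.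
  rewrite le_eqVlt; apply/orP; left; apply/eqP; apply: eq_avg => j; congr (nat_of_bool _)%:R.
  by apply: eq_existsb => k; rewrite linph ?linps// -ltnS.
- move=> u; have [Y [Y1 Y2 Y3 Y4]] := psi_test L0 D0 G (fun j : index T L d => u (code j)).
  exists (fun j => Y (dec j)); rewrite ttps; split => //.
  + by rewrite (avg_enum z0).
  + apply: le_trans Y2 _; rewrite -(avg_enum z0 (fun z => Y z * psi h (fun j : index T L d => u (code j)) z)).
    by rewrite le_eqVlt; apply/orP; left; apply/eqP; apply: eq_avg => j; rewrite linpsN.
  + by rewrite (avg_enum z0 (fun z => Y z ^+ 2)).
  + by rewrite (avg_enum z0 (fun z => Y z ^+ 4)).
- move=> i om xi iN omM xim.
  have [j <-] : exists j : index T L d, code j = i.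
    have dpos := d0; have iTL : (i %/ d < T * L)%N by rewrite ltn_divLR.
    have p1 : (i %/ d %/ L < T)%N by rewrite ltn_divLR.
    have p2 : (i %/ d %% L < L)%N by rewrite ltn_mod.
    have p3 : (i %% d < d)%N by rewrite ltn_mod.
    by exists (Ordinal p1, Ordinal p2, Ordinal p3); rewrite /code /= -!divn_eq.
  rewrite (ph'E _ (Ordinal omM)) /ps.
  apply: le_trans (theta_sup T0 L0 HB _ _ _) _.
  have s2 : Num.sqrt 2 ^+ 2 = 2 :> R by rewrite sqr_sqrtr.
  have s0 : 0 <= Num.sqrt 2 :> R by exact: sqrtr_ge0.
  (* The bound so far is [2 + 1/3], which is at most [1 + sqrt 2] because [16/9 <= 2]. *)
  suff : 4/3 <= Num.sqrt 2 :> R by lra.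
  by rewrite -ler_sqr ?nnegrE ?divr_ge0// s2; lra.
- move=> c om xi cd omM xim.
  rewrite (linphN _ (Ordinal omM)) linpsN.
  have e : (fun j : index T L d => U c (code j)) =1 @ac R T L d (Ordinal cd).
    move=> [[k p] c']; rewrite /U /ac /code /= modnMDl modn_small//.
  have -> : psi h (fun j : index T L d => U c (code j)) (dec xi) = 0.
    rewrite (eq_psi _ _ e) /psi.
    rewrite [rsum (bb _) _]big1 => [|i _]; last by rewrite bb_ac// mul0r.
    rewrite [rsum (yh _ _ _) _]big1 ?mulr0 ?addr0// => c' _.
    by rewrite /yh big1 ?mul0r// => k _; rewrite yk_ac// mul0r.
  rewrite addr0 /ph (bigD1 (Ordinal cd))//= (eq_tc _ e) tc_ac// eqxx mul1r big1 ?addr0// => c' /negPf c'c.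
  by rewrite (eq_tc _ e) tc_ac// c'c mul0r.
Qed.

End BlockSpec.

(** * The sequence of blocks *)
Section Completion.
Variable R : realType.

Definition orthonormal (M n : nat) (g : nat -> nat -> R) : Prop :=
  forall i j, (i < n)%N -> (j < n)%N -> avg (fun om : 'I_M => g i om * g j om) = (i == j)%:R.

Lemma extend_orthonormal (M n : nat) (g : nat -> nat -> R) : (n < M)%N -> orthonormal M n g ->
  exists v : nat -> R, avg (fun om : 'I_M => v om * v om) = 1 /\
    forall i, (i < n)%N -> avg (fun om : 'I_M => g i om * v om) = 0.
Proof.
move=> nM go; have M0 : (0 < M)%N by apply: leq_ltn_trans nM.
pose A : 'M[R]_(n, M) := \matrix_(i, j) g i j.
have [K [K0 KA]] : exists K : 'M[R]_M, K != 0 /\ K *m A^T = 0.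
  exists (kermx A^T); rewrite mulmx_ker; split => //.
  rewrite -mxrank_eq0 mxrank_ker -lt0n subn_gt0 mxrank_tr.
  exact: leq_ltn_trans (rank_leq_row A) nM.
have /matrix0Pn[i0 [j0 wn0]] := K0.
pose w (j : nat) : R := if insub j is Some j' then K i0 j' else 0.
have wE (j : 'I_M) : w j = K i0 j by rewrite /w valK.
have w_orth i : (i < n)%N -> \sum_(j < M) g i j * w j = 0.
  move=> iltn; have e : (K *m A^T) i0 (Ordinal iltn) = 0 by rewrite KA mxE.
  by rewrite -[RHS]e mxE; apply: eq_bigr => j _; rewrite wE !mxE mulrC.
pose q := avg (fun om : 'I_M => w om * w om).
have q0 : 0 < q.
  rewrite /q /avg card_ord divr_gt0 ?ltr0n// (bigD1 j0)//= ltr_pwDl//.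
    by rewrite wE -expr2 exprn_even_gt0//= wn0.
  by apply: sumr_ge0 => j _; rewrite -expr2 sqr_ge0.
exists (fun j => (Num.sqrt q)^-1 * w j); split.
  rewrite (eq_avg (g := fun om : 'I_M => q^-1 * (w om * w om))).
    by rewrite avgZ -/q mulVf// gt_eqF.
  by move=> om; rewrite mulrACA -expr2 exprVn sqr_sqrtr// ltW.
move=> i iltn; rewrite /avg (eq_bigr (fun j : 'I_M => (Num.sqrt q)^-1 * (g i j * w j))).
  by rewrite -mulr_sumr w_orth// mulr0 mul0r.
by move=> j _; rewrite mulrCA.
Qed.

Lemma complete_orthonormal (M n : nat) (g : nat -> nat -> R) : (n <= M)%N -> orthonormal M n g ->
  exists G : nat -> nat -> R, orthonormal M M G /\ forall i, (i < n)%N -> G i = g i.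
Proof.
move=> nM; have [k] := ubnP (M - n)%N; elim: k n g nM => // k IH n g nM.
case: (ltngtP n M) nM => // [nM|->] _; last by move=> _ go; exists g.
move=> kn go; have [v [v1 v2]] := extend_orthonormal nM go.
pose g' i := if i == n then v else g i.
have go' : orthonormal M n.+1 g'.
  move=> i j; rewrite !ltnS /g' => iltn jltn.
  case: (eqVneq i n) iltn => [->|ni] iltn; case: (eqVneq j n) jltn => [->|nj] jltn.
  - by rewrite v1.
  - rewrite mulr0n -(v2 j); last by rewrite ltn_neqAle nj.
    by apply: eq_avg => om; rewrite mulrC.
  - by rewrite (negPf ni) v2// ltn_neqAle ni.
  - by apply: go; rewrite ltn_neqAle ?ni ?nj.
have [|G [GO Gg]] := IH _ _ nM _ go'; first by lia.
exists G; split => // i iltn; rewrite Gg ?(ltnW iltn)// ?ltnS ?(ltnW iltn)// /g' ltn_eqF//.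
Qed.

(** A square matrix with orthonormal rows has orthonormal columns ([mulmx1C]), and this is the
    expansion. *)
Lemma orthonormal_span (M : nat) (G : nat -> nat -> R) (phi : nat -> R) : (0 < M)%N ->
  orthonormal M M G -> forall om, (om < M)%N ->
  phi om = \sum_(c < M) avg (fun j : 'I_M => phi j * G c j) * G c om.
Proof.
move=> M0 GO om omM; have M0' : M%:R != 0 :> R by rewrite pnatr_eq0 -lt0n.
pose B : 'M[R]_M := \matrix_(i, j) G i j.
have BB : B *m (M%:R^-1 *: B^T) = 1%:M.
  apply/matrixP => i j; rewrite -scalemxAr !mxE; have := GO _ _ (ltn_ord i) (ltn_ord j).
  rewrite val_eqE => <-; rewrite /avg card_ord mulrC.
  by congr (_ / _); apply: eq_bigr => k _; rewrite !mxE.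
have {}BB := mulmx1C BB.
have E (j : 'I_M) : \sum_(c < M) M%:R^-1 * (G c j * G c om) = (j == Ordinal omM)%:R.
  have := congr1 (fun C : 'M[R]_M => C j (Ordinal omM)) BB; rewrite !mxE => <-.
  by apply: eq_bigr => c _; rewrite !mxE /= mulrA.
transitivity (\sum_(j < M) phi j * (j == Ordinal omM)%:R).
  by rewrite (bigD1 (Ordinal omM))//= eqxx mulr1 big1 ?addr0// => j /negPf ->; rewrite mulr0.
under eq_bigr do rewrite -E mulr_sumr.
rewrite exchange_big /=; apply: eq_bigr => c _; rewrite /avg card_ord !mulr_suml.
by apply: eq_bigr => j _; ring.
Qed.

End Completion.

(** * Appending one block *)

Section Step.
Variable R : realType.

Lemma avg_divmod (M m : nat) (F : nat -> nat -> R) :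
  avg (fun j : 'I_(M * m) => F (j %/ m)%N (j %% m)%N) =
  avg (fun om : 'I_M => avg (fun xi : 'I_m => F om xi)).
Proof.
rewrite /avg !card_ord -mulr_suml -mulrA -invfM -natrM [(m * M)%N]mulnC; congr (_ / _).
rewrite -(sum_mul_ord M m (fun j => F (j %/ m)%N (j %% m)%N)).
apply: eq_bigr => a _; apply: eq_bigr => b _.
by rewrite modnMDl modn_small// divnMDl ?divn_small ?addn0//; case: (m) b => [[]|].
Qed.

Definition glue (n m : nat) (g ph ps : nat -> nat -> R) (i j : nat) : R :=
  if (i < n)%N then g i (j %/ m)%N else ph (i - n)%N (j %/ m)%N + ps (i - n)%N (j %% m)%N.

Lemma lin1 (N i : nat) (q : nat -> nat -> R) j : (i < N)%N ->
  lin N (fun k => (k == i)%:R) q j = q i j.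
Proof.
move=> iN; rewrite /lin (bigD1 (Ordinal iN))//= eqxx mul1r big1 ?addr0// => k.
by rewrite -val_eqE /= => /negPf ->; rewrite mul0r.
Qed.

Lemma linD (N : nat) (u v : nat -> R) (q : nat -> nat -> R) j :
  lin N (fun k => u k + v k) q j = lin N u q j + lin N v q j.
Proof. by rewrite /lin -big_split; apply: eq_bigr => k _; rewrite mulrDl. Qed.

(** The block is built over the [M - n] functions that complete [g]. Its past part lies in their
    span, hence is orthogonal to [g]; and as [U] recovers them, the enlarged family spans all
    functions of the past atoms. The inequality [N < m] leaves room for a nonempty completion at the
    next level. *)
Lemma step_exists (s M n : nat) (g : nat -> nat -> R) : (n < M)%N -> orthonormal M n g ->
  exists m N ph ps,
  [/\ @block_spec R s M m N ph ps,
      forall i j, (j < n)%N -> avg (fun om : 'I_M => ph i om * g j om) = 0,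
      (n + N < M * m)%N, orthonormal (M * m) (n + N) (glue n m g ph ps) &
      forall phi : nat -> R, exists c : nat -> R, forall j, (j < M * m)%N ->
        phi (j %/ m)%N = \sum_(i < n + N) c i * glue n m g ph ps i j].
Proof.
move=> nM go; have M0 : (0 < M)%N by apply: leq_ltn_trans nM.
have [G [GO Gg]] := complete_orthonormal (ltnW nM) go.
pose d := (M - n)%N; pose f c := G (n + c)%N.
have d0 : (0 < d)%N by rewrite subn_gt0.
have fo c c' : (c < d)%N -> (c' < d)%N -> avg (fun om : 'I_M => f c om * f c' om) = (c == c')%:R.
  by rewrite /d => cd cd'; rewrite GO ?eqn_add2l//; lia.
have [m [N [a [U [ps [spec fU]]]]]] := block_exists s M0 d0 fo.
set ph := fun i om => _ in spec fU; have sz := bs_size spec.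
have m0 : (0 < m)%N by apply: leq_ltn_trans sz.
exists m, N, ph, ps.
have phg i j : (j < n)%N -> avg (fun om : 'I_M => ph i om * g j om) = 0.
  move=> jn; under eq_avg do rewrite /ph mulr_suml.
  rewrite avg_sum big1// => c _; under eq_avg do rewrite -mulrA -(Gg j)//.
  by rewrite avgZ GO; [rewrite (_ : (_ == _) = false) ?mulr0//; lia|have := ltn_ord c; lia|lia].
have M0' : (0 < #|'I_M|)%N by rewrite card_ord.
have m0' : (0 < #|'I_m|)%N by rewrite card_ord.
have ps0 i : (i < N)%N -> avg (fun xi : 'I_m => ps i xi) = 0.
  move=> iN; rewrite -(bs_mean spec (fun k => (k == i)%:R)).
  by apply: eq_avg => xi; rewrite lin1.
(* Polarization: [bs_energy] at two unit vectors and at their sum. *)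
have th i j : (i < N)%N -> (j < N)%N ->
   avg (fun om : 'I_M => ph i om * ph j om) + avg (fun xi : 'I_m => ps i xi * ps j xi) = (i == j)%:R.
  move=> iN jN; have e (q : nat -> nat -> R) K : mean_sqr K N (fun k => (k == i)%:R + (k == j)%:R) q =
      mean_sqr K N (fun k => (k == i)%:R) q + mean_sqr K N (fun k => (k == j)%:R) q + 2 * avg (fun x : 'I_K => q i x * q j x).
    rewrite /mean_sqr -avgZ -!avgD; apply: eq_avg => x; rewrite linD !lin1//; ring.
  have h1 := bs_energy spec (fun k => (k == i)%:R).
  have h2 := bs_energy spec (fun k => (k == j)%:R).
  have := bs_energy spec (fun k => (k == i)%:R + (k == j)%:R); rewrite !e.
  have -> : \sum_(k < N) (((k : nat) == i)%:R + ((k : nat) == j)%:R) ^+ 2 = \sum_(k < N) ((k : nat) == i)%:R ^+ 2 +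
      \sum_(k < N) ((k : nat) == j)%:R ^+ 2 + 2 * (i == j)%:R :> R.
    rewrite -(lin1 (fun a b => (a == b)%:R) j iN) /lin mulr_sumr -!big_split; apply: eq_bigr => k _ /=.
    ring.
  lra.
split => //.
- have : (M * N.+1 <= M * m)%N by rewrite leq_mul2l sz orbT.
  have : (N <= M * N)%N by rewrite leq_pmull.
  by rewrite mulnS; lia.
- move=> i j iN jN.
  pose F k om xi := if (k < n)%N then g k om else ph (k - n)%N om + ps (k - n)%N xi.
  rewrite (avg_divmod M m (fun om xi => F i om xi * F j om xi)) /F.
  have go' k l : (k < n)%N -> (n <= l)%N -> (l < n + N)%N ->
      avg (fun om : 'I_M => avg (fun xi : 'I_m => g k om * (ph (l - n)%N om + ps (l - n)%N xi))) = 0.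
    move=> kn nl lN; rewrite -(phg (l - n)%N k kn); apply: eq_avg => om.
    by rewrite avgZ avgD avg_cst// ps0 ?addr0 1?mulrC//; lia.
  case: (ltnP i n) => i1; case: (ltnP j n) => j1.
  + by under eq_avg do rewrite avg_cst//; exact: go.
  + by rewrite go'//; case: eqP => //; lia.
  + under eq_avg do under eq_avg do rewrite mulrC.
    by rewrite go'//; case: eqP => //; lia.
  + have -> : (i == j) = (i - n == j - n)%N by apply/eqP/eqP; lia.
    rewrite -th; [|lia..].
    rewrite -[X in _ = _ + X](avg_cst _ M0') -avgD; apply: eq_avg => om.
    rewrite -[X in _ = X + _](avg_cst _ m0') -avgD -[RHS]addr0 -[X in _ = _ + X](mulr0 (ph (i - n)%N om)).
    rewrite -[in X in _ = _ + X](ps0 (j - n)%N); last by lia.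
    rewrite -avgZ -avgD -[RHS]addr0 -[X in _ = _ + X](mulr0 (ph (j - n)%N om)) -[in X in _ = _ + X](ps0 (i - n)%N); last by lia.
    by rewrite -avgZ -avgD; apply: eq_avg => xi; ring.
- move=> phi.
  pose al c := avg (fun j : 'I_M => phi j * G c j).
  exists (fun i => if (i < n)%N then al i else \sum_(c < d) al (n + c)%N * U c (i - n)%N).
  move=> j jM; have jm : (j %/ m < M)%N by rewrite ltn_divLR.
  have jx : (j %% m < m)%N by rewrite ltn_mod.
  have -> : phi (j %/ m)%N = \sum_(c < M) al c * G c (j %/ m)%N := orthonormal_span phi M0 GO jm.
  rewrite -[in LHS](subnKC (ltnW nM)) -/d !big_split_ord /=.
  congr (_ + _).
    by apply: eq_bigr => c _; rewrite /glue ltn_ord Gg.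
  transitivity (\sum_(c < d) al (n + c)%N * \sum_(i < N) U c i * (ph i (j %/ m)%N + ps i (j %% m)%N)).
    apply: eq_bigr => c _; congr (_ * _); rewrite -/(f c) (fU c _ _ (ltn_ord c) jm jx) /lin -big_split.
    by apply: eq_bigr => i _; rewrite mulrDr.
  transitivity (\sum_(c < d) \sum_(i < N) al (n + c)%N * (U c i * (ph i (j %/ m)%N + ps i (j %% m)%N))).
    by apply: eq_bigr => c _; rewrite mulr_sumr.
  rewrite exchange_big /=; apply: eq_bigr => i _.
  rewrite /glue ltnNge leq_addr /= addKn mulr_suml.
  by apply: eq_bigr => c _; rewrite mulrA.
Qed.

End Step.

(** * Recursion over the blocks *)

Section System.
Variable R : realType.

Record system (M m n N : nat -> nat) (ph ps g : nat -> nat -> nat -> R) : Prop := {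
  sys_M0 : M 0%N = 1%N;
  sys_n0 : n 0%N = 0%N;
  sys_MS : forall s, M s.+1 = (M s * m s)%N;
  sys_nS : forall s, n s.+1 = (n s + N s)%N;
  sys_gS : forall s, g s.+1 = glue (n s) (m s) (g s) (ph s) (ps s);
  sys_block : forall s, block_spec s (M s) (m s) (N s) (ph s) (ps s);
  sys_ortho : forall s, orthonormal (M s) (n s) (g s);
  sys_perp : forall s i j, (j < n s)%N -> avg (fun om : 'I_(M s) => ph s i om * g s j om) = 0;
  sys_span : forall s (phi : nat -> R), exists c : nat -> R, forall j, (j < M s.+1)%N ->
    phi (j %/ m s)%N = \sum_(i < n s.+1) c i * g s.+1 i j }.

Theorem system_exists : exists M m n N ph ps g, system M m n N ph ps g.
Proof.
pose St := {st : nat * nat * (nat -> nat -> R) | (st.1.2 < st.1.1)%N /\ orthonormal st.1.1 st.1.2 st.2}.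
pose Dt := (nat * nat * (nat -> nat -> R) * (nat -> nat -> R))%type.
have H (p : nat * St) : exists q : Dt * St,
  let: (s, st) := p in let: (M, n, g) := sval st in
  let: (m, N, ph, ps) := q.1 in
  [/\ @block_spec R s M m N ph ps,
      forall i j, (j < n)%N -> avg (fun om : 'I_M => ph i om * g j om) = 0,
      sval q.2 = ((M * m)%N, (n + N)%N, glue n m g ph ps) &
      forall phi : nat -> R, exists c : nat -> R, forall j, (j < M * m)%N ->
        phi (j %/ m)%N = \sum_(i < n + N) c i * glue n m g ph ps i j].
  case: p => s [[[M n] g] [/= nM go]].
  have [m [N [ph [ps [b p nM' go' sp]]]]] := step_exists s nM go.
  by exists (m, N, ph, ps, exist _ ((M * m)%N, (n + N)%N, glue n m g ph ps) (conj nM' go')).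
have [F HF] := choice H.
(* One atom and no function yet: the completion at level 0 is a constant. *)
pose z0 : nat * nat * (nat -> nat -> R) := (1%N, 0%N, fun _ _ => 0%R).
have P0 : (z0.1.2 < z0.1.1)%N /\ orthonormal z0.1.1 z0.1.2 z0.2 by split.
pose st0' : St := exist _ z0 P0.
pose fix st (s : nat) {struct s} : St := if s is s'.+1 then (F (s', st s')).2 else st0'.
pose M s := (sval (st s)).1.1; pose n s := (sval (st s)).1.2; pose g s := (sval (st s)).2.
pose dt s := (F (s, st s)).1.
pose m s := (dt s).1.1.1; pose N s := (dt s).1.1.2; pose ph s := (dt s).1.2; pose ps s := (dt s).2.
have K s : [/\ block_spec s (M s) (m s) (N s) (ph s) (ps s),
      forall i j, (j < n s)%N -> avg (fun om : 'I_(M s) => ph s i om * g s j om) = 0,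
      sval (st s.+1) = ((M s * m s)%N, (n s + N s)%N, glue (n s) (m s) (g s) (ph s) (ps s)) &
      forall phi : nat -> R, exists c : nat -> R, forall j, (j < M s * m s)%N ->
        phi (j %/ m s)%N = \sum_(i < n s + N s) c i * glue (n s) (m s) (g s) (ph s) (ps s) i j].
  have := HF (s, st s); rewrite /M /n /g /m /N /ph /ps /dt /=.
  case: (F (s, st s)) => -[[[m' N'] ph'] ps'] st' /=.
  by case: (sval (st s)) => -[M' n'] g'.
exists M, m, n, N, ph, ps, g; split.
- by [].
- by [].
- by move=> s; have [_ _ e _] := K s; rewrite {1}/M e.
- by move=> s; have [_ _ e _] := K s; rewrite {1}/n e.
- by move=> s; have [_ _ e _] := K s; rewrite {1}/g e.
- by move=> s; have [b _ _ _] := K s.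
- by move=> s; have [_ o] := svalP (st s).
- by move=> s i j; have [_ p _ _] := K s; exact: p.
- move=> s phi; have [_ _ e sp] := K s; have [c cE] := sp phi; exists c => j.
  by rewrite /M /n /g e; exact: cE.
Qed.

(** By [sys_span] the indicator of an atom of level [s] is a combination of the [g s.+1], to which
    [ph s.+1] is orthogonal by [sys_perp]. So the past parts also form martingale differences, one
    level behind the fresh parts. *)
Lemma system_martingale M m n N ph ps g : system M m n N ph ps g ->
  forall s i om, (om < M s)%N ->
  avg (fun xi : 'I_(m s) => ph s.+1 i (om * m s + xi)%N) = 0.
Proof.
move=> S s i om omM.
have m0 : (0 < m s)%N by apply: leq_ltn_trans (bs_size (sys_block S s)).
have [c cE] := sys_span S s (fun a => (a == om)%:R).
have : avg (fun j : 'I_(M s.+1) => ph s.+1 i j * (j %/ m s == om)%N%:R) = 0.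
  rewrite (eq_avg (g := fun j : 'I_(M s.+1) => \sum_(k < n s.+1) c k * (ph s.+1 i j * g s.+1 k j))).
    by rewrite avg_sum big1// => k _; rewrite avgZ (sys_perp S) ?mulr0.
  move=> j; rewrite (cE _ (ltn_ord j)) mulr_sumr; apply: eq_bigr => k _; exact: mulrCA.
rewrite (sys_MS S) (eq_avg (g := fun j : 'I_(M s * m s) => ph s.+1 i (j %/ m s * m s + j %% m s)%N * (j %/ m s == om)%N%:R)).
  rewrite (avg_divmod (M s) (m s) (fun a b => ph s.+1 i (a * m s + b)%N * (a == om)%:R)).
  under eq_avg do rewrite avgZr.
  rewrite /avg !card_ord (bigD1 (Ordinal omM))//= eqxx mulr1 [X in _ + X]big1 ?addr0.
    move/eqP; rewrite mulf_eq0 invr_eq0 pnatr_eq0 => /orP[/eqP //|/eqP M0].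
    by rewrite M0 in omM.
  by move=> a; rewrite -val_eqE /= => /negPf ->; rewrite mulr0.
by move=> j; rewrite -divn_eq.
Qed.

End System.

(** * Convergence and divergence at finite levels *)
Section Levels.
Variables (R : realType) (M m n N : nat -> nat) (ph ps g : nat -> nat -> nat -> R).
Hypothesis S : system M m n N ph ps g.
Variables (T : Type) (w : nat -> T -> nat) (pt : nat -> nat -> T).
Hypothesis wS : forall s x, w s x = (w s.+1 x %/ m s)%N.
Hypothesis wpt : forall s j, (j < M s)%N -> w s (pt s j) = j.

Definition xi (s : nat) (x : T) : nat := (w s.+1 x %% m s)%N.
Definition lev (s : nat) (Y : Type) (f : T -> Y) := forall x y, w s x = w s y -> f x = f y.
(** The points [pt s j] represent the atoms of level [s], so this is the mean of [f] when
    [lev s f]. *)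
Definition level_avg (s : nat) (f : T -> R) : R := avg (fun j : 'I_(M s) => f (pt s j)).
Definition level_prob (s : nat) (A : pred T) : R := level_avg s (fun x => (A x)%:R).

Lemma m_gt0 s : (0 < m s)%N.
Proof. by apply: leq_ltn_trans (bs_size (sys_block S s)). Qed.

Lemma M_gt0 s : (0 < M s)%N.
Proof. by elim: s => [|s IH]; rewrite ?(sys_M0 S)// (sys_MS S) muln_gt0 IH m_gt0. Qed.

Lemma levS s Y (f : T -> Y) : lev s f -> lev s.+1 f.
Proof. by move=> fs x y xy; apply: fs; rewrite (wS s x) (wS s y) xy. Qed.

Lemma lev_le s s' Y (f : T -> Y) : (s <= s')%N -> lev s f -> lev s' f.
Proof.
move=> /subnKC <-; elim: (s' - s)%N => [|k IH]; first by rewrite addn0.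
by move=> /IH h; rewrite addnS; exact: levS.
Qed.

Lemma lev_w s Y (f : nat -> Y) : lev s (fun x => f (w s x)).
Proof. by move=> x y ->. Qed.

Lemma lev_xi s Y (f : nat -> Y) : lev s.+1 (fun x => f (xi s x)).
Proof. by move=> x y e; rewrite /xi e. Qed.

(** Conditioning on level [s]. The independence of the fresh digit enters the estimates below
    through this identity. *)
Lemma level_avg_tower s (A : T -> R) (G : nat -> nat -> R) : lev s A ->
  level_avg s.+1 (fun x => A x * G (w s x) (xi s x)) =
  level_avg s (fun x => A x * avg (fun k : 'I_(m s) => G (w s x) k)).
Proof.
move=> As; rewrite /level_avg (sys_MS S).
rewrite (eq_avg (g := fun j : 'I_(M s * m s) => A (pt s (j %/ m s)%N) * G (j %/ m s)%N (j %% m s)%N)).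
  rewrite (avg_divmod (M s) (m s) (fun a b => A (pt s a) * G a b)).
  by apply: eq_avg => j; rewrite avgZ wpt.
move=> j; have jM : (j < M s.+1)%N by rewrite (sys_MS S).
have e : w s (pt s.+1 j) = (j %/ m s)%N by rewrite (wS s) wpt.
rewrite /xi wpt// e (As (pt s.+1 j) (pt s (j %/ m s)%N))// e wpt//.
by rewrite ltn_divLR ?m_gt0// -(sys_MS S).
Qed.

Lemma level_avg_lev s f : lev s f -> level_avg s.+1 f = level_avg s f.
Proof.
move=> fs; transitivity (level_avg s.+1 (fun x => f x * 1)).
  by apply: eq_avg => j; rewrite mulr1.
rewrite (level_avg_tower (fun _ _ => 1) fs); apply: eq_avg => j.
by rewrite avg_cst ?card_ord ?m_gt0// mulr1.
Qed.

Lemma level_avg_lev_le s s' f : (s <= s')%N -> lev s f -> level_avg s' f = level_avg s f.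
Proof.
move=> /subnKC <- fs; elim: (s' - s)%N => [|k IH]; first by rewrite addn0.
by rewrite addnS level_avg_lev// ; apply: lev_le fs; exact: leq_addr.
Qed.

Lemma level_avg_w s (f : nat -> R) : level_avg s (fun x => f (w s x)) = avg (fun j : 'I_(M s) => f j).
Proof. by apply: eq_avg => j; rewrite wpt. Qed.

Lemma level_avg_xi s (A : T -> R) (f : nat -> R) : lev s A ->
  level_avg s.+1 (fun x => A x * f (xi s x)) = level_avg s A * avg (fun k : 'I_(m s) => f k).
Proof. by move=> As; rewrite (level_avg_tower (fun _ => f))// /level_avg avgZr. Qed.

Lemma level_avg_xi0 s (f : nat -> R) : level_avg s.+1 (fun x => f (xi s x)) = avg (fun k : 'I_(m s) => f k).
Proof.
have := @level_avg_xi s (fun=> 1) f (fun _ _ _ => erefl).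
rewrite {2}/level_avg avg_cst ?card_ord ?M_gt0// mul1r => <-.
by apply: eq_avg => j; rewrite mul1r.
Qed.

Lemma level_avg_const s a : level_avg s (fun=> a) = a.
Proof. by rewrite /level_avg avg_cst// card_ord M_gt0. Qed.

Variable c : nat -> R.
Definition block_coef (s i : nat) : R := c (n s + i)%N.
Definition past_part s x : R := lin (N s) (block_coef s) (ph s) (w s x).
Definition fresh_part s x : R := lin (N s) (block_coef s) (ps s) (xi s x).
Definition part s k x : R := lin k (block_coef s) (ph s) (w s x) + lin k (block_coef s) (ps s) (xi s x).
Definition tau s : R := mean_sqr (M s) (N s) (block_coef s) (ph s).
Definition nu s : R := mean_sqr (m s) (N s) (block_coef s) (ps s).

Lemma tau_ge0 s : 0 <= tau s. Proof. by apply: avg_ge0 => ?; exact: sqr_ge0. Qed.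
Lemma nu_ge0 s : 0 <= nu s. Proof. by apply: avg_ge0 => ?; exact: sqr_ge0. Qed.

Lemma lev_past_part s : lev s (past_part s).
Proof. exact: (@lev_w s R (lin (N s) (block_coef s) (ph s))). Qed.

Lemma lev_fresh_part s : lev s.+1 (fresh_part s).
Proof. exact: (@lev_xi s R (lin (N s) (block_coef s) (ps s))). Qed.

Lemma lev_part s k : lev s.+1 (part s k).
Proof.
have h1 : lev s.+1 (fun x => lin k (block_coef s) (ph s) (w s x)).
  by apply: levS; exact: (@lev_w s R (lin k (block_coef s) (ph s))).
have h2 : lev s.+1 (fun x => lin k (block_coef s) (ps s) (xi s x)).
  exact: (@lev_xi s R (lin k (block_coef s) (ps s))).
by move=> x y e; rewrite /part (h1 _ _ e) (h2 _ _ e).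
Qed.

Lemma level_avg_past2 s : level_avg s (fun x => past_part s x ^+ 2) = tau s.
Proof. exact: (level_avg_w s (fun j => lin (N s) (block_coef s) (ph s) j ^+ 2)). Qed.

Lemma level_avg_fresh2 s : level_avg s.+1 (fun x => fresh_part s x ^+ 2) = nu s.
Proof. exact: (level_avg_xi0 s (fun j => lin (N s) (block_coef s) (ps s) j ^+ 2)). Qed.

Lemma level_avg_past0 s (A : T -> R) : lev s A -> level_avg s.+1 (fun x => A x * past_part s.+1 x) = 0.
Proof.
move=> As; transitivity (level_avg s.+1 (fun x => A x * lin (N s.+1) (block_coef s.+1) (ph s.+1) (w s x * m s + xi s x)%N)).
  by apply: eq_avg => j; rewrite /past_part /xi (wS s) -divn_eq.
rewrite (level_avg_tower (fun a b => lin (N s.+1) (block_coef s.+1) (ph s.+1) (a * m s + b)%N))//.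
rewrite -(level_avg_const s 0); apply: eq_avg => j.
rewrite avg_sum big1 ?mulr0// => i _; rewrite avgZ (system_martingale S) ?mulr0//.
by rewrite wpt.
Qed.

Lemma level_avg_fresh0 s (A : T -> R) : lev s A -> level_avg s.+1 (fun x => A x * fresh_part s x) = 0.
Proof.
by move=> As; rewrite level_avg_xi// (bs_mean (sys_block S s)) mulr0.
Qed.

Lemma level_prob_part s lam : 0 < lam ->
  level_prob s.+1 (fun x => [exists k : 'I_(N s).+1, lam < `|part s k x|]) <= 730 * (tau s + nu s) / lam ^+ 2.
Proof.
move=> lam0; have := bs_weak (sys_block S s) (block_coef s) lam0.
rewrite (bs_energy (sys_block S s)) -/(tau s) -/(nu s); apply: le_trans.
rewrite le_eqVlt; apply/orP; left; apply/eqP.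
pose G a b : R := [exists k : 'I_(N s).+1, lam < `|lin k (block_coef s) (ph s) a + lin k (block_coef s) (ps s) b|]%:R.
transitivity (level_avg s.+1 (fun x => 1 * G (w s x) (xi s x))).
  by apply: eq_avg => j; rewrite mul1r.
by rewrite (level_avg_tower (A := fun=> 1) G)//; apply: eq_avg => j; rewrite mul1r wpt.
Qed.

Lemma lev_prob s (A : T -> bool) : lev s A -> lev s (fun x => (A x)%:R : R).
Proof. by move=> As x y /As ->. Qed.

Lemma level_prob_lev_le s s' (A : pred T) : (s <= s')%N -> lev s A -> level_prob s' A = level_prob s A.
Proof. by move=> ss' As; apply: level_avg_lev_le => //; exact: lev_prob. Qed.

Lemma le_level_prob s (A B : pred T) : (forall x, A x -> B x) -> level_prob s A <= level_prob s B.
Proof. by move=> AB; apply: ler_avg => j; case: (A _) (AB (pt s j)) => [->|] //; case: (B _). Qed.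

Lemma level_prob_exists s K (A : 'I_K -> pred T) :
  level_prob s (fun x => [exists i : 'I_K, A i x]) <= \sum_(i < K) level_prob s (A i).
Proof.
rewrite /level_prob /level_avg -avg_sum; apply: ler_avg => j; case: existsP => [[i Ai]|_]; last exact: sumr_ge0.
by rewrite (bigD1 i)//= Ai lerDl sumr_ge0.
Qed.

Lemma level_kolmogorov (b K : nat) (D : nat -> T -> R) lam : 0 < lam ->
  (forall k, (k < K)%N -> lev (b + k).+1 (D k)) ->
  (forall k A, (k < K)%N -> lev (b + k) A -> level_avg (b + k).+1 (fun x => A x * D k x) = 0) ->
  level_prob (b + K) (fun x => [exists k : 'I_K.+1, lam < `|\sum_(j < k) D j x|]) <=
  (\sum_(j < K) level_avg (b + j).+1 (fun x => D j x ^+ 2)) / lam ^+ 2.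
Proof.
move=> lam0 Dlev D0.
apply: le_trans (@kolmogorov R 'I_(M (b + K)) (fun j x => D j (pt (b + K) x)) K lam lam0 _) _.
- move=> k z kK zloc; pose A x := z (fun j => D j x).
  have Alev : lev (b + k) A.
    move=> x y e; apply: zloc => j jk; apply: (lev_le (s := (b + j).+1)) e; last exact/Dlev/(ltn_trans jk).
    by rewrite -addnS leq_add2l.
  rewrite -[RHS](D0 k A kK Alev) -(level_avg_lev_le (s := (b + k).+1) (s' := (b + K)%N))//.
    by rewrite -addnS leq_add2l.
  by move=> x y e; rewrite (Dlev k kK x y e) (levS Alev e).
- rewrite ler_wpM2r ?invr_ge0 ?sqr_ge0//; apply: ler_sum => j _.
  rewrite -(level_avg_lev_le (s := (b + j).+1) (s' := (b + K)%N))//.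
    by rewrite -addnS leq_add2l.
  by move=> x y e; rewrite (Dlev j (ltn_ord j) x y e).
Qed.

Definition block_value s x : R := past_part s x + fresh_part s x.
Definition block_energy s : R := tau s + nu s.

Lemma block_energy_ge0 s : 0 <= block_energy s. Proof. by rewrite addr_ge0 ?tau_ge0 ?nu_ge0. Qed.

Lemma block_energyE s : block_energy s = \sum_(i < N s) c (n s + i)%N ^+ 2.
Proof. by rewrite (bs_energy (sys_block S s) (block_coef s)). Qed.

(** Past sums, fresh sums and the current block each get [lam / 3]; the first two are martingales
    for shifted filtrations. The start at [b.+1] leaves out block 0, whose past part has no earlier
    level to be centred on. The constant covers [9 + 9 * 730]. *)
Lemma maximal_inequality b K lam : 0 < lam ->
  level_prob (b.+1 + K) (fun x => [exists s : 'I_K, [exists k : 'I_(N (b.+1 + s)).+1,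
     lam < `|\sum_(j < s) block_value (b.+1 + j) x + part (b.+1 + s) k x|]]) <=
  6600 * (\sum_(j < K) block_energy (b.+1 + j)) / lam ^+ 2.
Proof.
move=> lam0; have l3 : 0 < lam / 3 by rewrite divr_gt0.
have l2 : 0 < lam ^+ 2 by rewrite exprn_gt0.
pose A1 x := [exists k : 'I_K.+1, lam / 3 < `|\sum_(j < k) past_part (b.+1 + j) x|].
pose A2 x := [exists k : 'I_K.+1, lam / 3 < `|\sum_(j < k) fresh_part (b.+1 + j) x|].
pose A3 x := [exists s : 'I_K, [exists k : 'I_(N (b.+1 + s)).+1, lam / 3 < `|part (b.+1 + s) k x|]].
have levA1 : lev (b + K) A1.
  move=> x y e; apply: eq_existsb => k; congr (_ < `|_|); apply: eq_bigr => j _.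
  apply: (lev_le (s := (b.+1 + j)%N)) e; last exact: lev_past_part.
  by have := ltn_ord j; have := ltn_ord k; lia.
have p1 : level_prob (b.+1 + K) A1 <= 9 * (\sum_(j < K) tau (b.+1 + j)) / lam ^+ 2.
  rewrite addSn (level_prob_lev_le (leqnSn _) levA1).
  apply: le_trans (@level_kolmogorov b K (fun j => past_part (b.+1 + j)) _ l3 _ _) _.
  - by move=> k _; exact: lev_past_part.
  - by move=> k A _ Alev; rewrite addSn; exact: level_avg_past0.
  rewrite expr_div_n invf_div mulrA ler_wpM2r ?invr_ge0 ?(ltW l2)// mulrC.
  rewrite (_ : 3 ^+ 2 = 9 :> R); last by ring.
  by rewrite ler_wpM2l//; apply: ler_sum => j _; rewrite addSn level_avg_past2.
have p2 : level_prob (b.+1 + K) A2 <= 9 * (\sum_(j < K) nu (b.+1 + j)) / lam ^+ 2.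
  apply: le_trans (@level_kolmogorov b.+1 K (fun j => fresh_part (b.+1 + j)) _ l3 _ _) _.
  - by move=> k _; exact: lev_fresh_part.
  - by move=> k A _ Alev; exact: level_avg_fresh0.
  rewrite expr_div_n invf_div mulrA ler_wpM2r ?invr_ge0 ?(ltW l2)// mulrC.
  rewrite (_ : 3 ^+ 2 = 9 :> R); last by ring.
  by rewrite ler_wpM2l//; apply: ler_sum => j _; rewrite level_avg_fresh2.
have p3 : level_prob (b.+1 + K) A3 <= 6570 * (\sum_(j < K) block_energy (b.+1 + j)) / lam ^+ 2.
  apply: le_trans (level_prob_exists _ _) _; rewrite mulr_sumr mulr_suml; apply: ler_sum => s _.
  rewrite (level_prob_lev_le (s := (b.+1 + s).+1)); last 2 first.
  - by rewrite -addnS leq_add2l.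
  - by move=> x y e; apply: eq_existsb => k; rewrite (@lev_part (b.+1 + s) k x y e).
  apply: le_trans (level_prob_part _ l3) _.
  rewrite expr_div_n invf_div mulrA ler_wpM2r ?invr_ge0 ?(ltW l2)//.
  rewrite (_ : 3 ^+ 2 = 9 :> R); last by ring.
  by have := block_energy_ge0 (b.+1 + s); rewrite /block_energy; lra.
apply: (@le_trans _ _ (level_prob (b.+1 + K) A1 + level_prob (b.+1 + K) A2 + level_prob (b.+1 + K) A3)); last first.
  have : \sum_(j < K) block_energy (b.+1 + j) = \sum_(j < K) tau (b.+1 + j) + \sum_(j < K) nu (b.+1 + j).
    by rewrite -big_split.
  have t0 : 0 <= (\sum_(j < K) tau (b.+1 + j)) / lam ^+ 2.
    by rewrite divr_ge0 ?(ltW l2)// sumr_ge0// => j _; exact: tau_ge0.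
  have n0 : 0 <= (\sum_(j < K) nu (b.+1 + j)) / lam ^+ 2.
    by rewrite divr_ge0 ?(ltW l2)// sumr_ge0// => j _; exact: nu_ge0.
  move=> e; move: p3 p1 p2; rewrite e -!mulrA mulrDl; lra.
rewrite /level_prob /level_avg -!avgD; apply: ler_avg => z; set x := pt _ _.
case: existsP => [[s /existsP[k hk]]|_]; last by rewrite !addr_ge0.
suff : A1 x || A2 x || A3 x by case: (A1 x); case: (A2 x); case: (A3 x) => //= _; lra.
apply: contraLR hk; rewrite !negb_or !negb_exists -leNgt => /andP[/andP[/forallP n1 /forallP n2] /forallP n3].
have sK : (s < K.+1)%N by rewrite ltnS ltnW.
have := n1 (Ordinal sK); have := n2 (Ordinal sK); have := n3 s.
rewrite negb_exists => /forallP/(_ k); rewrite -!leNgt big_split /=.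
rewrite !ler_norml => /andP[? ?] /andP[? ?] /andP[? ?]; apply/andP; split; lra.
Qed.

Definition spiky s x : bool := [exists k : 'I_(N s).+1, 1 <= `|part s k x|].

Lemma lev_spiky s : lev s.+1 (spiky s).
Proof. by move=> x y e; apply: eq_existsb => k; rewrite (@lev_part s k x y e). Qed.

Definition spike_rate (C : R) s : R :=
  if (nu s <= C * tau s) && ((1/2) ^+ s <= tau s) && (32 * C <= (s + 9)%:R)
  then (1/2) ^+ 30 / C ^+ 2 * Num.min 1 (tau s) else 0.

Lemma spike_rate_ge0 C s : 0 <= spike_rate C s.
Proof.
rewrite /spike_rate; case: ifP => // _; rewrite mulr_ge0 ?le_min ?ler01 ?tau_ge0//.
by rewrite divr_ge0 ?sqr_ge0// exprn_ge0// divr_ge0.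
Qed.

Lemma spike_step C s (A : pred T) : 1 <= C -> lev s A ->
  level_prob s.+1 (fun x => A x && ~~ spiky s x) <= (1 - spike_rate C s) * level_prob s A.
Proof.
move=> C1 As.
pose G a b : R := (~~ [exists k : 'I_(N s).+1, 1 <= `|lin k (block_coef s) (ph s) a + lin k (block_coef s) (ps s) b|])%:R.
rewrite /level_prob (_ : level_avg s.+1 _ = level_avg s.+1 (fun x => (A x)%:R * G (w s x) (xi s x))); last first.
  by apply: eq_avg => j; rewrite /G -natrM mulnb.
rewrite (level_avg_tower G (lev_prob As)) mulrC -avgZr; apply: ler_avg => j.
rewrite ler_wpM2l//.
have jM := ltn_ord j; rewrite wpt//.
have -> : avg (fun k : 'I_(m s) => G j k) = 1 - prob R (fun b : 'I_(m s) =>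
   [exists k : 'I_(N s).+1, 1 <= `|lin k (block_coef s) (ph s) j + lin k (block_coef s) (ps s) b|]).
  have e1 : avg (fun _ : 'I_(m s) => 1) = 1 :> R by rewrite avg_cst// card_ord m_gt0.
  rewrite -[X in _ = X - _]e1 -avgB; apply: eq_avg => b; rewrite /G.
  by case: existsP => _ /=; rewrite ?mulr0n ?mulr1n ?subrr ?subr0.
rewrite lerB// /spike_rate; case: ifP => [/andP[/andP[h1 h2] h3]|_]; last exact: prob_ge0.
exact: (bs_spike (sys_block S s)).
Qed.

(** A quantitative second Borel-Cantelli lemma: [\prod (1 - q_j) <= 1 / (1 + \sum q_j)], by
    induction from [(1 - q) * (1 + s + q) <= 1 + s]. *)
Lemma spike_div C b K : 1 <= C ->
  level_prob (b + K) (fun x => [forall j : 'I_K, ~~ spiky (b + j) x]) *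
  (1 + \sum_(j < K) spike_rate C (b + j)) <= 1.
Proof.
move=> C1; elim: K => [|K IH].
  rewrite big_ord0 addr0 mulr1 -[leRHS](level_avg_const (b + 0)); apply: ler_avg => j.
  by rewrite lern1 leq_b1.
pose A x := [forall j : 'I_K, ~~ spiky (b + j) x].
have levA : lev (b + K) A.
  move=> x y e; apply: eq_forallb => j; congr (~~ _); apply: (lev_le (s := (b + j).+1)) e; last exact: lev_spiky.
  by rewrite -addnS leq_add2l.
have le : level_prob (b + K.+1) (fun x => [forall j : 'I_K.+1, ~~ spiky (b + j) x]) <= (1 - spike_rate C (b + K)) * level_prob (b + K) A.
  rewrite addnS; apply: le_trans (spike_step C1 levA); apply: le_level_prob => x /forallP h.
  apply/andP; split; last exact: (h ord_max).
  by apply/forallP => j; exact: (h (widen_ord (leqnSn K) j)).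
rewrite big_ord_recr /=; set q := spike_rate C (b + K) in le *; set s := \sum_(j < K) _ in IH *.
have q0 : 0 <= q by exact: spike_rate_ge0.
have s0 : 0 <= s by apply: sumr_ge0 => j _; exact: spike_rate_ge0.
have p0 : 0 <= level_prob (b + K) A by apply: avg_ge0.
apply: le_trans (ler_wpM2r _ le) _; first by rewrite !addr_ge0.
apply: le_trans IH; rewrite -/(level_prob _ A) [_ * level_prob _ A]mulrC -mulrA ler_wpM2l//.
by nra.
Qed.

Definition block_sums s x : R := \sum_(j < s) block_value j x.

Lemma lev_block_value s : lev s.+1 (block_value s).
Proof. by move=> x y e; rewrite /block_value (levS (@lev_past_part s) e) (@lev_fresh_part s x y e). Qed.

Lemma lev_block_sums s : lev s (block_sums s).
Proof.
by move=> x y e; apply: eq_bigr => j _; apply: (lev_le (ltn_ord j)) e; exact: lev_block_value.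
Qed.

Definition stay (K : R) s x : bool := [forall j : 'I_s.+1, `|block_sums j x| <= K].

Lemma lev_stay K s : lev s (stay K s).
Proof.
move=> x y e; apply: eq_forallb => j; congr (`|_| <= K).
by apply: (lev_le (s := j)) e; [rewrite -ltnS|exact: lev_block_sums].
Qed.

Section Test.
Variable Y : nat -> nat -> R.
Hypothesis Y0 : forall s, avg (fun k : 'I_(m s) => Y s k) = 0.
Hypothesis YP : forall s, 16/25 * nu s <= avg (fun k : 'I_(m s) => Y s k * lin (N s) (block_coef s) (ps s) k).
Hypothesis Y2 : forall s, avg (fun k : 'I_(m s) => Y s k ^+ 2) <= nu s.
Hypothesis Y4 : forall s, avg (fun k : 'I_(m s) => Y s k ^+ 4) <= 3 * nu s ^+ 2.
Variables (b : nat) (A : T -> R).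
Hypothesis levA : lev b A.
Hypothesis A0 : forall x, 0 <= A x.

Definition test_sum K x : R := \sum_(j < K) Y (b + j) (xi (b + j) x).
Definition past_sum K x : R := \sum_(j < K) past_part (b + j) x.
Definition fresh_sum K x : R := \sum_(j < K) fresh_part (b + j) x.
Definition fresh_energy K : R := \sum_(j < K) nu (b + j).
Definition past_energy K : R := \sum_(j < K) tau (b + j).

Let al : R := level_avg b A.
Let al0 : 0 <= al. Proof. by apply: avg_ge0. Qed.

Lemma lev_sum_ord s K (f : nat -> T -> R) : (forall j, (j < K)%N -> lev s (f j)) ->
  lev s (fun x => \sum_(j < K) f j x).
Proof. by move=> h x y e; apply: eq_bigr => j _; exact: (h j (ltn_ord j)). Qed.

Lemma lev_Y j : lev (b + j).+1 (fun x => Y (b + j) (xi (b + j) x)).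
Proof. exact: (@lev_xi (b + j) R (Y (b + j))). Qed.

Lemma lev_test_sum K : lev (b + K) (test_sum K).
Proof.
apply: (@lev_sum_ord _ K (fun j x => Y (b + j) (xi (b + j) x))) => j jK.
apply: (lev_le (s := (b + j).+1)); last exact: lev_Y.
by rewrite -addnS leq_add2l.
Qed.

Lemma lev_fresh_sum K : lev (b + K) (fresh_sum K).
Proof.
apply: (@lev_sum_ord _ K (fun j x => fresh_part (b + j) x)) => j jK.
apply: (lev_le (s := (b + j).+1)); last exact: lev_fresh_part.
by rewrite -addnS leq_add2l.
Qed.

Lemma levAK K : lev (b + K) A.
Proof. by apply: lev_le levA; exact: leq_addr. Qed.

Lemma lev_mul s (f f' : T -> R) : lev s f -> lev s f' -> lev s (fun x => f x * f' x).
Proof. by move=> h h' x y e; rewrite (h x y e) (h' x y e). Qed.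

Lemma lev_exp s (f : T -> R) i : lev s f -> lev s (fun x => f x ^+ i).
Proof. by move=> h x y e; rewrite (h x y e). Qed.

Lemma level_avg_step s (f : T -> R) (q : nat -> R) : lev s f ->
  level_avg s.+1 (fun x => f x * q (xi s x)) = level_avg s f * avg (fun k : 'I_(m s) => q k).
Proof. by move=> h; exact: level_avg_xi. Qed.

Lemma level_avg_past_event K : level_avg (b + K) A = al.
Proof. by rewrite (level_avg_lev_le (s := b))// leq_addr. Qed.

Lemma level_avgD s f f' : level_avg s (fun x => f x + f' x) = level_avg s f + level_avg s f'.
Proof. exact: avgD. Qed.

Lemma level_avgZ s (a : R) f : level_avg s (fun x => a * f x) = a * level_avg s f.
Proof. exact: avgZ. Qed.

Lemma eq_level_avg s f f' : f =1 f' -> level_avg s f = level_avg s f'.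
Proof. by move=> ff'; apply: eq_avg => j. Qed.

Lemma avg_test_sum K : level_avg (b + K) (fun x => A x * test_sum K x) = 0.
Proof.
elim: K => [|K IH].
  by rewrite (@eq_level_avg _ _ (fun=> 0)) ?level_avg_const// => x; rewrite /test_sum big_ord0 mulr0.
rewrite addnS (@eq_level_avg _ _ (fun x => A x * test_sum K x + A x * Y (b + K) (xi (b + K) x))).
  by rewrite level_avgD level_avg_step ?Y0 ?mulr0 ?addr0//; [rewrite level_avg_lev//; apply: lev_mul; [exact: levAK|exact: lev_test_sum]|exact: levAK].
by move=> x; rewrite /test_sum big_ord_recr /= mulrDr.
Qed.

Lemma avg_test_sum2 K : level_avg (b + K) (fun x => A x * test_sum K x ^+ 2) <= al * fresh_energy K.
Proof.
elim: K => [|K IH].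
  by rewrite (@eq_level_avg _ _ (fun=> 0)) ?level_avg_const /fresh_energy ?big_ord0 ?mulr0// => x; rewrite /test_sum big_ord0 expr0n mulr0.
rewrite addnS (@eq_level_avg _ _ (fun x => A x * test_sum K x ^+ 2 + (2 * (A x * test_sum K x * Y (b + K) (xi (b + K) x)) +
   A x * (Y (b + K) (xi (b + K) x) ^+ 2)))); last first.
  by move=> x; rewrite /test_sum big_ord_recr /= -/(test_sum K x); ring.
have l1 := @levAK K; have l2 := lev_mul l1 (@lev_test_sum K).
rewrite !level_avgD level_avgZ level_avg_step// Y0 mulr0 mulr0 add0r (level_avg_step (fun k => Y (b + K) k ^+ 2))//.
rewrite level_avg_lev; last by apply: lev_mul => //; exact/lev_exp/lev_test_sum.
rewrite /fresh_energy big_ord_recr /= mulrDr lerD// level_avg_past_event ler_wpM2l//.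
Qed.

Lemma fresh_energy_ge0 K : 0 <= fresh_energy K.
Proof. by apply: sumr_ge0 => j _; exact: nu_ge0. Qed.

(** The expansion of [avg_rsum4] with independent digits for signs: the terms linear in the new [Y]
    vanish by [Y0], the cubic one because [avg_test_sum] is zero. *)
Lemma avg_test_sum4 K : level_avg (b + K) (fun x => A x * test_sum K x ^+ 4) <= 3 * al * fresh_energy K ^+ 2.
Proof.
elim: K => [|K IH].
  by rewrite (@eq_level_avg _ _ (fun=> 0)) ?level_avg_const /fresh_energy ?big_ord0 ?expr0n ?mulr0// => x; rewrite /test_sum big_ord0 expr0n mulr0.
rewrite addnS (@eq_level_avg _ _ (fun x => A x * test_sum K x ^+ 4 + (4 * (A x * test_sum K x ^+ 3 * Y (b + K) (xi (b + K) x)) +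
   (6 * (A x * test_sum K x ^+ 2 * (Y (b + K) (xi (b + K) x) ^+ 2)) + (4 * (A x * test_sum K x * (Y (b + K) (xi (b + K) x) ^+ 3))
   + A x * (Y (b + K) (xi (b + K) x) ^+ 4)))))); last first.
  by move=> x; rewrite /test_sum big_ord_recr /= -/(test_sum K x); ring.
have l1 := @levAK K; have l2 i := lev_mul l1 (lev_exp i (@lev_test_sum K)).
have l3 := lev_mul l1 (@lev_test_sum K).
rewrite !level_avgD !level_avgZ level_avg_step// Y0 mulr0 mulr0 add0r.
rewrite (level_avg_step (fun k => Y (b + K) k ^+ 2) (l2 2)) (level_avg_step (fun k => Y (b + K) k ^+ 3) l3).
rewrite (level_avg_step (fun k => Y (b + K) k ^+ 4) l1) avg_test_sum mul0r mulr0 add0r level_avg_past_event (level_avg_lev (l2 4)).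
have h2 := avg_test_sum2 K; have v0 := nu_ge0 (b + K); have s0 := fresh_energy_ge0 K.
have q0 : 0 <= level_avg (b + K) (fun x => A x * test_sum K x ^+ 2) by apply: avg_ge0 => j; rewrite mulr_ge0 ?sqr_ge0.
have e2 : level_avg (b + K) (fun x => A x * test_sum K x ^+ 2) * avg (fun k : 'I_(m (b + K)) => Y (b + K) k ^+ 2) <= al * fresh_energy K * nu (b + K).
  by apply: ler_pM => //; apply: avg_ge0 => k; exact: sqr_ge0.
have e4 := ler_wpM2l al0 (Y4 (b + K)).
rewrite /fresh_energy big_ord_recr /= -/(fresh_energy K); move: IH e2 e4; rewrite -/(fresh_energy K); lra.
Qed.

Lemma avg_fresh_test K : al * (16/25 * fresh_energy K) <= level_avg (b + K) (fun x => A x * (fresh_sum K x * test_sum K x)).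
Proof.
elim: K => [|K IH].
  rewrite (@eq_level_avg _ _ (fun=> 0)) ?level_avg_const /fresh_energy ?big_ord0 ?mulr0// => x.
  by rewrite /fresh_sum big_ord0 mul0r mulr0.
rewrite addnS (@eq_level_avg _ _ (fun x => A x * (fresh_sum K x * test_sum K x) + (A x * fresh_sum K x * Y (b + K) (xi (b + K) x) +
   (A x * test_sum K x * fresh_part (b + K) x +
    A x * (Y (b + K) (xi (b + K) x) * lin (N (b + K)) (block_coef (b + K)) (ps (b + K)) (xi (b + K) x)))))); last first.
  by move=> x; rewrite /test_sum /fresh_sum !big_ord_recr /= -/(test_sum K x) -/(fresh_sum K x) -/(fresh_part (b + K) x); ring.
have l1 := @levAK K; have l2 := lev_mul l1 (@lev_test_sum K); have l3 := lev_mul l1 (@lev_fresh_sum K).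
rewrite !level_avgD level_avg_step// Y0 mulr0 add0r level_avg_fresh0// add0r.
rewrite (level_avg_step (fun k => Y (b + K) k * lin (N (b + K)) (block_coef (b + K)) (ps (b + K)) k) l1) level_avg_past_event.
rewrite level_avg_lev; last by apply: lev_mul => //; apply: lev_mul; [exact: lev_fresh_sum|exact: lev_test_sum].
by rewrite /fresh_energy big_ord_recr /= mulrDr mulrDr lerD// ler_wpM2l.
Qed.

Lemma avg_fresh_sum2 K : level_avg (b + K) (fun x => A x * fresh_sum K x ^+ 2) = al * fresh_energy K.
Proof.
elim: K => [|K IH].
  by rewrite (@eq_level_avg _ _ (fun=> 0)) ?level_avg_const /fresh_energy ?big_ord0 ?mulr0// => x; rewrite /fresh_sum big_ord0 expr0n mulr0.
rewrite addnS (@eq_level_avg _ _ (fun x => A x * fresh_sum K x ^+ 2 + (2 * (A x * fresh_sum K x * fresh_part (b + K) x) +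
   A x * (lin (N (b + K)) (block_coef (b + K)) (ps (b + K)) (xi (b + K) x) ^+ 2)))); last first.
  by move=> x; rewrite /fresh_sum big_ord_recr /= -/(fresh_sum K x) -/(fresh_part (b + K) x); ring.
have l1 := @levAK K; have l2 := lev_mul l1 (@lev_fresh_sum K).
rewrite !level_avgD level_avgZ level_avg_fresh0// mulr0 add0r.
rewrite (level_avg_step (fun k => lin (N (b + K)) (block_coef (b + K)) (ps (b + K)) k ^+ 2) l1) level_avg_past_event.
rewrite level_avg_lev; last by apply: lev_mul => //; exact/lev_exp/lev_fresh_sum.
by rewrite IH /fresh_energy big_ord_recr /= mulrDr.
Qed.

Lemma avg_past_sum2 K : level_avg (b + K) (fun x => past_sum K x ^+ 2) = past_energy K.
Proof.
elim: K => [|K IH].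
  by rewrite (@eq_level_avg _ _ (fun=> 0)) ?level_avg_const /past_energy ?big_ord0// => x; rewrite /past_sum big_ord0 expr0n.
rewrite addnS (level_avg_lev (s := (b + K)%N)); last first.
  apply: lev_exp; apply: (@lev_sum_ord _ K.+1 (fun j x => past_part (b + j) x)) => j jK; apply: (lev_le (s := (b + j)%N)); last exact: lev_past_part.
  by rewrite leq_add2l -ltnS.
rewrite (@eq_level_avg _ _ (fun x => past_sum K x ^+ 2 + (2 * (past_sum K x * past_part (b + K) x) + past_part (b + K) x ^+ 2))); last first.
  by move=> x; rewrite /past_sum big_ord_recr /= -/(past_sum K x); ring.
rewrite !level_avgD level_avgZ IH level_avg_past2 /past_energy big_ord_recr /= (_ : level_avg _ _ = 0) ?mulr0 ?add0r//.
case: K {IH} => [|K].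
  by rewrite (@eq_level_avg _ _ (fun=> 0)) ?level_avg_const// => x; rewrite /past_sum big_ord0 mul0r.
rewrite addnS; apply: level_avg_past0; apply: (@lev_sum_ord _ K.+1 (fun j x => past_part (b + j) x)) => j jK; apply: (lev_le (s := (b + j)%N)); last exact: lev_past_part.
by rewrite leq_add2l -ltnS.
Qed.

End Test.

(** Staying within [Kb] at levels [b] and [b + K] bounds the increment by [2 * Kb]. On [stay] at
    level [b], [paley_zygmund] makes a larger increment likely: the fresh sum contributes 16/25 to
    the correlation with the test sum, the past sum destroys at most [8/25], whose square is 64/625,
    and [2 * (4/25)] remains. The factor 625/4 makes [2 * Kb] small enough for that lemma. *)
Lemma test_step b K (Kb : R) : let al := level_prob b (stay Kb b) in
  0 <= Kb -> 0 < al -> 0 < fresh_energy b K -> past_energy b K <= 64/625 * al ^+ 2 * fresh_energy b K ->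
  625/4 * Kb ^+ 2 <= al ^+ 2 * fresh_energy b K ->
  level_prob (b + K) (stay Kb (b + K)) <= (1 - (4/25) ^+ 4 / 27) * al.
Proof.
move=> al Kb0 al0 snu0 taule nule.
have [Y HY] := choice (fun s => bs_test (sys_block S s) (block_coef s)).
have Y0 s : avg (fun k : 'I_(m s) => Y s k) = 0 by have [] := HY s.
have YP s : 16/25 * nu s <= avg (fun k : 'I_(m s) => Y s k * lin (N s) (block_coef s) (ps s) k) by have [] := HY s.
have Y2 s : avg (fun k : 'I_(m s) => Y s k ^+ 2) <= nu s by have [] := HY s.
have Y4 s : avg (fun k : 'I_(m s) => Y s k ^+ 4) <= 3 * nu s ^+ 2 by have [] := HY s.
pose A x : R := (stay Kb b x)%:R.
have levA : lev b A by apply: lev_prob; exact: lev_stay.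
have A0 x : 0 <= A x by exact: ler0n.
have AA x : A x ^+ 2 = A x by rewrite /A; case: stay; rewrite ?expr1n ?expr0n.
have A4 x : A x ^+ 4 = A x by rewrite (exprM _ 2 2) !AA.
have EA : level_avg b A = al by [].
have al1 : al <= 1.
  by rewrite -[leRHS](level_avg_const b); apply: ler_avg => j; rewrite lern1 leq_b1.
set v := fresh_energy b K in snu0 taule nule.
pose sg := Num.sqrt v; have sg2 : sg ^+ 2 = v by rewrite sqr_sqrtr// ltW.
have sg0 : 0 < sg by rewrite sqrtr_gt0.
have T2 := avg_test_sum2 Y0 Y2 levA A0 K; rewrite EA -/v in T2.
have T4 := avg_test_sum4 Y0 Y2 Y4 levA A0 K; rewrite EA -/v in T4.
have PT := avg_fresh_test Y0 YP levA A0 K; rewrite EA -/v in PT.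
have P2 := avg_fresh_sum2 levA K; rewrite EA -/v in P2.
have F2 := avg_past_sum2 b K.
pose Yf (j : 'I_(M (b + K))) := A (pt (b + K) j) * (past_sum b K (pt (b + K) j) + fresh_sum b K (pt (b + K) j)).
pose Zf (j : 'I_(M (b + K))) := A (pt (b + K) j) * test_sum Y b K (pt (b + K) j).
have Z2 : avg (fun j => Zf j ^+ 2) <= al * v.
  by apply: le_trans T2; apply: ler_avg => j; rewrite /Zf exprMn AA.
have Z4 : avg (fun j => Zf j ^+ 4) <= 3 * al * v ^+ 2.
  by apply: le_trans T4; apply: ler_avg => j; rewrite /Zf exprMn A4.
have FT : - (8/25 * al * v) <= avg (fun j : 'I_(M (b + K)) => past_sum b K (pt (b + K) j) * Zf j).
  have av0 : 0 < al * v by exact: mulr_gt0.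
  have l0 : 0 <= 8/25 * al * v by rewrite -mulrA; lra.
  suff : `|avg (fun j : 'I_(M (b + K)) => past_sum b K (pt (b + K) j) * Zf j)| <= 8/25 * al * v by rewrite ler_norml => /andP[].
  rewrite -[8/25 * al * v]ger0_norm// -ler_sqr ?nnegrE// !real_normK ?num_real//.
  apply: le_trans (avg_cauchy_schwarz _ _) _.
  have t0 : 0 <= past_energy b K by apply: sumr_ge0 => j _; exact: tau_ge0.
  apply: (@le_trans _ _ (past_energy b K * v)).
    rewrite ler_pM//; [by apply: avg_ge0 => j; exact: sqr_ge0|by apply: avg_ge0 => j; exact: sqr_ge0|by rewrite -F2|].
    by apply: le_trans Z2 _; rewrite ler_piMl// ltW.
  by have := ler_wpM2r (ltW snu0) taule; lra.
have a0 : 0 <= 4/25 * al * v by have := mulr_gt0 al0 snu0; rewrite -mulrA; lra.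
have YZ : 2 * (4/25 * al * v) <= avg (fun j => Yf j * Zf j).
  have -> : avg (fun j => Yf j * Zf j) = avg (fun j : 'I_(M (b + K)) => past_sum b K (pt (b + K) j) * Zf j) +
      level_avg (b + K) (fun x => A x * (fresh_sum b K x * test_sum Y b K x)).
    rewrite /level_avg -avgD; apply: eq_avg => j; rewrite /Yf /Zf.
    by transitivity (A (pt (b + K) j) ^+ 2 * ((past_sum b K (pt (b + K) j) + fresh_sum b K (pt (b + K) j)) * test_sum Y b K (pt (b + K) j))); [ring|rewrite AA; ring].
  by lra.
have k0 : 0 <= 2 * Kb by rewrite mulr_ge0.
have Zabs : 2 * Kb * avg (fun j => `|Zf j|) <= 4/25 * al * v.
  have z1 : avg (fun j => `|Zf j|) <= sg.
    rewrite -[sg]ger0_norm ?(ltW sg0)// -[leLHS]ger0_norm ?avg_ge0// -ler_sqr ?nnegrE ?(ltW sg0)// !real_normK ?num_real//.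
    apply: le_trans (avg_sqr_le _ _) _; first by rewrite card_ord M_gt0.
    rewrite sg2; apply: (@le_trans _ _ (al * v)); last by rewrite ler_piMl// ltW.
    by apply: le_trans Z2; apply: ler_avg => j; rewrite real_normK ?num_real.
  have k1 : 25/2 * Kb <= al * sg.
    have r0 : 0 <= al * sg by rewrite mulr_ge0 ?(ltW al0) ?(ltW sg0).
    have l0 : 0 <= 25/2 * Kb by lra.
    by rewrite -ler_sqr ?nnegrE// [leRHS]exprMn sg2 (_ : (25/2 * Kb) ^+ 2 = 625/4 * Kb ^+ 2)//; field.
  have := ler_wpM2l k0 z1; have := ler_wpM2r (ltW sg0) k1.
  have e : al * sg * sg = al * v by rewrite -mulrA -expr2 sg2.
  by rewrite e; lra.
have Yf2 : avg (fun j => Yf j ^+ 2) <= 3 * al * v.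
  apply: (@le_trans _ _ (level_avg (b + K) (fun x => 2 * past_sum b K x ^+ 2 + 2 * (A x * fresh_sum b K x ^+ 2)))).
    apply: ler_avg => j; rewrite /Yf exprMn AA; set x := pt _ _.
    have := sqr_ge0 (past_sum b K x - fresh_sum b K x); have := sqr_ge0 (past_sum b K x).
    by rewrite /A; case: stay; rewrite ?mul1r ?mul0r; lra.
  rewrite level_avgD !level_avgZ F2 P2.
  have : al ^+ 2 * v <= al * v by rewrite ler_wpM2r ?(ltW snu0)// expr2 ler_piMl// ltW.
  lra.
have := paley_zygmund a0 k0 YZ Zabs; set P := prob _ _ => PZ.
have P0 : 0 <= P by exact: prob_ge0.
have {}PZ : (4/25 * al * v) ^+ 4 <= (3 * al * v) ^+ 2 * (3 * al * v ^+ 2) * P.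
  apply: le_trans PZ _; rewrite ler_wpM2r// ler_pM ?sqr_ge0//.
    by apply: avg_ge0 => j; rewrite (exprM _ 2 2) sqr_ge0.
  rewrite lerXn2r ?nnegrE//; first by apply: avg_ge0 => j; exact: sqr_ge0.
  by have := mulr_gt0 al0 snu0; rewrite -mulrA; lra.
have {}PZ : (4/25) ^+ 4 / 27 * al <= P.
  move: PZ; rewrite (_ : (4/25 * al * v) ^+ 4 = ((4/25) ^+ 4 / 27 * al) * (27 * al ^+ 3 * v ^+ 4)); last by field.
  rewrite (_ : _ * P = P * (27 * al ^+ 3 * v ^+ 4)); last by ring.
  by rewrite ler_pM2r// mulr_gt0 ?exprn_gt0// mulr_gt0 ?exprn_gt0.
have split : level_prob (b + K) (stay Kb (b + K)) + P <= al.
  rewrite -EA -(level_avg_lev_le (s' := (b + K)%N) _ levA) ?leq_addr// /P /prob /level_prob /level_avg -avgD.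
  apply: ler_avg => j; set x := pt _ _; rewrite /A.
  have sub : stay Kb (b + K) x -> stay Kb b x.
    move=> /forallP h; apply/forallP => i; have ib := ltn_ord i.
    have ibK : (i < (b + K).+1)%N by rewrite (leq_trans ib)// ltnS leq_addr.
    exact: (h (Ordinal ibK)).
  have ex : stay Kb (b + K) x -> (2 * Kb < `|Yf j|) = false.
    move=> st; apply/negbTE; rewrite -leNgt /Yf -/x /A (sub st) mul1r.
    have -> : past_sum b K x + fresh_sum b K x = block_sums (b + K) x - block_sums b x.
      rewrite /block_sums big_split_ord /= addrAC subrr add0r -big_split; apply: eq_bigr => i _.
      by [].
    move/forallP: st => h; have := h ord_max; have bb1 : (b < (b + K).+1)%N by rewrite ltnS leq_addr.
    have := h (Ordinal bb1); rewrite /= !ler_norml => /andP[? ?] /andP[? ?]; apply/andP; split; lra.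
  case st : (stay Kb (b + K) x); first by rewrite ex// sub// addr0.
  rewrite add0r; case: ltP => // h; case sb : (stay Kb b x) => //.
  by move: h; rewrite /Yf -/x /A sb mul0r normr0 ltNge k0.
by lra.
Qed.

(** Iterating [test_step] gives [al * (1 + k * q) <= 1] after [k] steps. The energy needed for the
    next step depends on the current probability [al], so its length is chosen afterwards. *)
Lemma test_div (Kb e : R) : 0 <= Kb -> 0 < e ->
  (forall B : R, exists K, B <= \sum_(j < K) nu j) ->
  (forall d : R, 0 < d -> exists D : R, forall K, \sum_(j < K) tau j <= d * \sum_(j < K) nu j + D) ->
  exists s, level_prob s (stay Kb s) <= e.
Proof.
move=> Kb0 e0 unb small; pose q : R := (4/25) ^+ 4 / 27.
have q0 : 0 < q by apply: divr_gt0; [apply: exprn_gt0; lra|lra].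
have q1 : q <= 1.
  by have : (4/25 : R) ^+ 4 <= 1 by [apply: exprn_ile1; lra]; rewrite /q; lra.
have H k : exists s, level_prob s (stay Kb s) * (1 + k%:R * q) <= 1.
  elim: k => [|k [b IH]].
    exists 0%N; rewrite mul0r addr0 mulr1 -[leRHS](level_avg_const 0); apply: ler_avg => j.
    by rewrite lern1 leq_b1.
  set al := level_prob b (stay Kb b) in IH.
  have al0' : 0 <= al by apply: avg_ge0.
  move: al0'; rewrite le_eqVlt => /predU1P[al0|al0].
    by exists b; rewrite -/al -al0 mul0r.
  (* Half of the 64/625 allowed by [test_step]; the other half absorbs the additive constant
     [D']. *)
  have d0 : 0 < 32/625 * al ^+ 2 by apply: mulr_gt0; [lra|exact: exprn_gt0].
  have [D HD] := small _ d0.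
  pose D' := 32/625 * al ^+ 2 * \sum_(j < b) nu j + D.
  have [K0 HK0] := unb (\sum_(j < b) nu j + 1 + `|D'| / (32/625 * al ^+ 2) + 625/4 * Kb ^+ 2 / al ^+ 2).
  pose K := K0.
  have sp (f : nat -> R) : \sum_(j < b + K) f j = \sum_(j < b) f j + \sum_(j < K) f (b + j)%N.
    by rewrite big_split_ord.
  have big : 1 + `|D'| / (32/625 * al ^+ 2) + 625/4 * Kb ^+ 2 / al ^+ 2 <= fresh_energy b K.
    have : \sum_(j < K0) nu j <= \sum_(j < b + K) nu j.
      rewrite addnC big_split_ord /= lerDl; apply: sumr_ge0 => j _; exact: nu_ge0.
    by rewrite sp -/(fresh_energy b K); lra.
  have t1 : 0 <= `|D'| / (32/625 * al ^+ 2) by apply: divr_ge0; [exact: normr_ge0|exact: ltW].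
  have t2 : 0 <= 625/4 * Kb ^+ 2 / al ^+ 2 by apply: divr_ge0; [apply: mulr_ge0; [lra|exact: sqr_ge0]|exact: sqr_ge0].
  have v0 : 0 < fresh_energy b K by lra.
  have h1 : past_energy b K <= 64/625 * al ^+ 2 * fresh_energy b K.
    have := HD (b + K)%N; rewrite !sp -/(fresh_energy b K) -/(past_energy b K).
    have : 0 <= \sum_(j < b) tau j by apply: sumr_ge0 => j _; exact: tau_ge0.
    have : `|D'| <= 32/625 * al ^+ 2 * fresh_energy b K.
      by rewrite mulrC -ler_pdivrMr//; lra.
    have := ler_norm D'; rewrite /D'; lra.
  have h2 : 625/4 * Kb ^+ 2 <= al ^+ 2 * fresh_energy b K.
    by rewrite mulrC [al ^+ 2 * _]mulrC -ler_pdivrMr ?exprn_gt0// [Kb ^+ 2 * _]mulrC; lra.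
  exists (b + K)%N; have := test_step Kb0 al0 v0 h1 h2; rewrite -/q -/al => le.
  have k0 : 0 <= 1 + k.+1%:R * q by rewrite addr_ge0// mulr_ge0// ltW.
  apply: le_trans (ler_wpM2r k0 le) _; apply: le_trans IH.
  rewrite -subr_ge0 -natr1 (_ : _ - _ = al * ((k%:R + 1) * (q * q))); last by ring.
  by rewrite mulr_ge0 ?(ltW al0)// mulr_ge0 ?addr_ge0// mulr_ge0// ltW.
pose k := (Num.truncn (1 / (e * q))).+1.
have [s Hs] := H k; exists s.
have hk : 1 / (e * q) < k%:R by apply: truncnS_gt.
have p0 : 0 <= level_prob s (stay Kb s) by apply: avg_ge0.
have : 1 < k%:R * (e * q) by rewrite -ltr_pdivrMr// mulr_gt0.
rewrite leNgt => h; apply/negP => h'.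
have : e * (1 + k%:R * q) < level_prob s (stay Kb s) * (1 + k%:R * q).
  by rewrite ltr_pM2r// ltr_wpDr// mulr_ge0// ltW.
lra.
Qed.

(** Only finitely many terms can exceed 1, as each of them adds 1 to the truncated sum; beyond them
    truncation changes nothing. *)
Lemma bounded_of_min (a : nat -> R) B : (forall j, 0 <= a j) ->
  (forall K, \sum_(j < K) Num.min 1 (a j) <= B) ->
  exists D, forall K, \sum_(j < K) a j <= D.
Proof.
move=> a0 HB.
have m0 j : 0 <= Num.min 1 (a j) by rewrite le_min ler01 a0.
have [j0 Hj0] : exists j0, forall j, (j0 <= j)%N -> a j <= 1.
  apply: contrapT => nh.
  have big k : exists K, k%:R <= \sum_(j < K) Num.min 1 (a j).
    elim: k => [|k [K IH]]; first by exists 0%N; rewrite big_ord0.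
    apply: contrapT => nK; apply: nh; exists K => j Kj; rewrite leNgt; apply/negP => a1.
    apply: nK; exists j.+1; rewrite -natr1 big_ord_recr /= (min_idPl (ltW a1)) lerD//.
    apply: le_trans IH _; rewrite -(subnKC Kj) big_split_ord /= lerDl; exact: sumr_ge0.
  have [K HK] := big (Num.truncn B).+1.
  by have := truncnS_gt B; have := HB K; lra.
exists (\sum_(j < j0) a j + B) => K.
apply: (@le_trans _ _ (\sum_(j < j0 + K) a j)).
  by rewrite addnC big_split_ord /= lerDl; exact: sumr_ge0.
rewrite big_split_ord /= lerD2l; apply: le_trans (HB (j0 + K)%N).
rewrite big_split_ord /= ler_wpDl ?sumr_ge0//; apply: ler_sum => j _.
by rewrite (min_idPr _)// Hj0// leq_addr.
Qed.

Lemma sum_halves K : \sum_(j < K) (1/2 : R) ^+ j <= 2.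
Proof.
have -> : \sum_(j < K) (1/2 : R) ^+ j = 2 - 2 * (1/2) ^+ K.
  elim: K => [|K IH]; first by rewrite big_ord0 expr0; ring.
  by rewrite big_ord_recr /= IH exprS; field.
by have : 0 <= (1/2 : R) ^+ K by [apply: exprn_ge0; lra]; lra.
Qed.

(* Either spikes occur at a divergent rate, or the energy asymptotically sits
   in the martingale-difference parts [fresh_part]. *)
Lemma energy_dichotomy :
  (forall B, exists K, B <= \sum_(j < K) block_energy j) ->
  (exists2 C, 1 <= C & forall B, exists K, B <= \sum_(j < K) spike_rate C j) \/
  (forall B, exists K, B <= \sum_(j < K) nu j) /\
  (forall d : R, 0 < d -> exists D, forall K,
    \sum_(j < K) tau j <= d * \sum_(j < K) nu j + D).
Proof.
move=> unb; case: (pselect (exists2 C, 1 <= C & forall B, exists K, B <= \sum_(j < K) spike_rate C j)).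
  by left.
move=> nsp; right.
have small (d : R) : 0 < d -> exists D, forall K,
    \sum_(j < K) tau j <= d * \sum_(j < K) nu j + D.
  (* With this [C], a block with [nu > C * tau] satisfies [tau <= d * nu]. *)
  move=> d0; pose C := Num.max 1 d^-1.
  have C1 : 1 <= C by rewrite le_max lexx.
  have C0 : 0 < C by lra.
  have dC : 1 <= d * C.
    by rewrite mulrC -ler_pdivrMr// mul1r le_max lexx orbT.
  have [B HB] : exists B, forall K, \sum_(j < K) spike_rate C j <= B.
    apply: contrapT => nB; apply: nsp; exists C => // B.
    apply: contrapT => nK; apply: nB; exists B => K; apply: ltW; rewrite ltNge; apply/negP => h.
    by apply: nK; exists K.
  pose a j : R := if [&& nu j <= C * tau j, (1/2) ^+ j <= tau j & 32 * C <= (j + 9)%:R]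
    then tau j else 0.
  have a0 j : 0 <= a j by rewrite /a; case: ifP => // _; exact: tau_ge0.
  pose q : R := (1/2) ^+ 30 / C ^+ 2.
  have q0 : 0 < q by apply: divr_gt0; [apply: exprn_gt0; lra|exact: exprn_gt0].
  have ra j : q * Num.min 1 (a j) = spike_rate C j.
    rewrite /a /spike_rate -andbA; case: ifP => // _.
    by rewrite (min_idPr ler01) mulr0.
  have [D HD] : exists D, forall K, \sum_(j < K) a j <= D.
    apply: (@bounded_of_min a (B / q)) => // K.
    rewrite ler_pdivlMr// mulrC mulr_sumr.
    by rewrite (eq_bigr (fun j : 'I_K => spike_rate C j) (fun j _ => ra j)); exact: HB.
  pose s1 := (Num.truncn (32 * C)).+1.
  (* The three ways in which a spike rate can be absent or present: fresh energy dominates, [tau] is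
     below the summable [(1/2)^j], or [tau] equals [a j]. From [s1] on the condition on [32 * C]
     holds. *)
  have tj j : (s1 <= j)%N -> tau j <= d * nu j + a j + (1/2) ^+ j.
    move=> sj; have n0 := nu_ge0 j; have t0 := tau_ge0 j.
    have h0 : 0 <= (1/2 : R) ^+ j by apply: exprn_ge0; lra.
    have dn : 0 <= d * nu j by rewrite mulr_ge0// ltW.
    have j9 : 32 * C <= (j + 9)%:R.
      by apply: le_trans (ltW (truncnS_gt _)) _; rewrite ler_nat (leq_trans sj)// leq_addr.
    rewrite /a j9 andbT; case: (leP (nu j) (C * tau j)) => h1 /=; last first.
      rewrite addr0; suff : tau j <= d * nu j by lra.
      apply: (@le_trans _ _ (d * C * tau j)); first by rewrite -[leLHS]mul1r ler_wpM2r.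
      by rewrite -mulrA ler_wpM2l ?(ltW d0)// ltW.
    by case: (leP _ (tau j)) => h2; lra.
  exists (\sum_(j < s1) tau j + D + 2) => K.
  have pos (f : nat -> R) k : (forall j, 0 <= f j) -> 0 <= \sum_(j < k) f j.
    by move=> f0; exact: sumr_ge0.
  have n0 := pos nu; have t0 := pos tau K tau_ge0.
  have D0 : 0 <= D by apply: le_trans (HD 0%N); rewrite big_ord0.
  case: (leqP K s1) => Ks.
    have : \sum_(j < K) tau j <= \sum_(j < s1) tau j.
      by rewrite -(subnKC Ks) big_split_ord /= lerDl; apply: sumr_ge0 => j _; exact: tau_ge0.
    by have := mulr_ge0 (ltW d0) (n0 K nu_ge0); lra.
  rewrite -(subnKC (ltnW Ks)) big_split_ord /=; set k := (K - s1)%N.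
  have e1 : \sum_(j < k) tau (s1 + j) <= \sum_(j < s1 + k) (d * nu j + a j + (1/2) ^+ j).
    rewrite big_split_ord /= ler_wpDl//.
      apply: sumr_ge0 => j _; apply: addr_ge0; last by apply: exprn_ge0; lra.
      by apply: addr_ge0 => //; apply: mulr_ge0; [exact: ltW|exact: nu_ge0].
    by apply: ler_sum => j _; apply: tj; exact: leq_addr.
  rewrite !big_split /= -mulr_sumr in e1.
  by have := HD (s1 + k)%N; have := sum_halves (s1 + k); lra.
split=> // B; have [D HD] := small 1 ltr01.
have [K HK] := unb (2 * B + D); exists K.
move: HK; rewrite (eq_bigr (fun j : 'I_K => tau j + nu j))// big_split /=.
by have := HD K; lra.
Qed.

End Levels.

(** * Realization on the unit interval *)
Section UnitInterval.
Local Open Scope classical_set_scope.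
Local Open Scope ring_scope.
Variables (R : realType) (M m n N : nat -> nat) (ph ps g : nat -> nat -> nat -> R).
Hypothesis S : system M m n N ph ps g.
Local Notation mu := (leb01 R).

(* The atom of level [s] containing [x]; points outside [[0, 1[] are put in the
   atom [0] so that every point belongs to one of the [M s] atoms. *)
Definition atom (s : nat) (x : R) : nat :=
  if 0 <= x < 1 then Num.truncn (x * (M s)%:R) else 0%N.
Definition node (s j : nat) : R := j%:R / (M s)%:R.

Let M0 s : 0 < (M s)%:R :> R. Proof. by rewrite ltr0n (M_gt0 S). Qed.

Lemma atomS s x : atom s x = (atom s.+1 x %/ m s)%N.
Proof.
rewrite /atom; case: ifP => [/andP[x0 _]|_]; last by rewrite div0n.
have h0 : 0 <= x * (M s.+1)%:R by rewrite mulr_ge0.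
have m0 : 0 < (m s)%:R :> R by rewrite ltr0n (m_gt0 S).
have := truncn_itv h0; set a := Num.truncn (x * (M s.+1)%:R).
rewrite (sys_MS S) natrM mulrA => /andP[h1 h2]; apply: truncn_def.
rewrite -(ler_pM2r m0) -(ltr_pM2r m0) -!natrM; apply/andP; split.
  by apply: le_trans h1; rewrite ler_nat leq_divM.
by apply: lt_le_trans h2 _; rewrite ler_nat ltn_ceil// (m_gt0 S).
Qed.

Lemma atom_lt s x : (atom s x < M s)%N.
Proof.
rewrite /atom; case: ifP => [/andP[x0 x1]|_]; last exact: (M_gt0 S).
by rewrite truncn_lt_nat ?mulr_ge0// gtr_pMl.
Qed.

Lemma atom_node s j : (j < M s)%N -> atom s (node s j) = j.
Proof.
move=> jM; rewrite /atom /node divr_ge0//= ltr_pdivrMr// mul1r ltr_nat jM.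
by rewrite divfK ?natrK// gt_eqF.
Qed.

Lemma measurable_atom s j : measurable [set x : measurableTypeR R | atom s x = j].
Proof.
have -> : [set x | atom s x = j] =
    (`[0, 1[ `&` `[j%:R / (M s)%:R, j.+1%:R / (M s)%:R[) `|`
    (if j == 0%N then ~` `[0, 1[ else set0) :> set R.
  apply/seteqP; split => x /=; rewrite /atom !in_itv /=.
    case: ifP => [x01 xj|x01 <-] /=; last by right => /=; rewrite in_itv /= x01.
    left; split => //; have /andP[x0 _] := x01.
    have h0 : 0 <= x * (M s)%:R by rewrite mulr_ge0.
    by rewrite ler_pdivrMr// ltr_pdivlMr// -xj truncn_itv.
  case=> [[x01]|]; first by rewrite x01 ler_pdivrMr// ltr_pdivlMr//; exact: truncn_def.
  by case: eqP => [->|_] //=; rewrite in_itv /=; case: ifP.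
apply: measurableU; first by apply: measurableI; exact: measurable_itv.
by case: ifP => // _; apply: measurableC; exact: measurable_itv.
Qed.

Lemma leb01_atom s j : (j < M s)%N -> mu [set x | atom s x = j] = ((M s)%:R^-1)%:E.
Proof.
move=> jM; rewrite /leb01 /= /mrestr.
pose I : set (measurableTypeR R) := `[j%:R / (M s)%:R, j.+1%:R / (M s)%:R[%classic.
have mI : measurable I by exact: measurable_itv.
have I01 x : I x -> 0 <= x < 1.
  rewrite /I /= in_itv /= => /andP[h1 h2]; apply/andP; split.
    by apply: le_trans h1; rewrite divr_ge0.
  by apply: lt_le_trans h2 _; rewrite ler_pdivrMr// mul1r ler_nat.
(* The endpoint 1 falls into the atom 0 by convention; it is a null set. *)
have -> : [set x | atom s x = j] `&` `[0, 1] = I `|` (if j == 0%N then [set 1] else set0) :> set R.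
  apply/seteqP; split => x /=.
    rewrite in_itv /= => -[]; rewrite /atom; case: ifP => [/andP[x0 x1] xj _|x01 <- /andP[x0 x1]].
      left; rewrite /I /= in_itv /=.
      have h0 : 0 <= x * (M s)%:R by rewrite mulr_ge0.
      by rewrite ler_pdivrMr// ltr_pdivlMr// -xj truncn_itv.
    right => /=; apply/eqP; rewrite eq_le x1 leNgt /=; apply/negP => x1'.
    by rewrite x0 x1' in x01.
  rewrite in_itv /= => -[xI|].
    have x01 := I01 x xI; rewrite /atom x01; have /andP[x0 x1] := x01; split; last by rewrite x0 ltW.
    by move: xI; rewrite /I /= in_itv /= ler_pdivrMr// ltr_pdivlMr//; exact: truncn_def.
  by case: eqP => [->|_] //= ->; rewrite /atom ltxx andbF ler01 lexx.
rewrite measureU0//=; last by case: ifP => _; rewrite ?lebesgue_measure_set1 ?measure0.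
  rewrite /I lebesgue_measure_itv /= lte_fin ltr_pM2r ?invr_gt0// ltr_nat ltnSn.
  by rewrite -EFinD -mulrBl -natrB// subSnn mul1r.
by case: ifP => // _; exact: measurable_set1.
Qed.

Local Notation level s := (lev atom s).
Local Notation avg_level := (level_avg M node).
Local Notation prob_level := (level_prob R M node).

Lemma level_sum s (f : R -> R) x : level s f ->
  f x = \sum_(j < M s) f (node s j) * \1_[set y | atom s y = j] x.
Proof.
move=> fs; rewrite (bigD1 (Ordinal (atom_lt s x)))//= indicE mem_set// mulr1 big1 ?addr0.
  by apply: fs; rewrite atom_node// atom_lt.
move=> j jx; rewrite indicE memNset ?mulr0//= => xj.
by move/eqP: jx; apply; apply/val_inj; rewrite /= xj.
Qed.

Lemma measurable_level s (f : R -> R) : level s f ->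
  measurable_fun setT (f : measurableTypeR R -> measurableTypeR R).
Proof.
move=> fs; rewrite (_ : f = fun x => \sum_(j < M s) f (node s j) * \1_[set y | atom s y = j] x).
  apply: (@measurable_sum _ (measurableTypeR R)) => j; apply: measurable_funM => //.
  by apply: measurable_indic; exact: measurable_atom.
by apply/funext => x; exact: level_sum.
Qed.

Lemma leb01_setT : mu setT = 1%E.
Proof.
by rewrite /leb01 /= /mrestr setTI lebesgue_measure_itv /= lte_fin ltr01 -EFinB subr0.
Qed.

Lemma bounded_integrable (f : R -> R) K : measurable_fun setT (f : measurableTypeR R -> measurableTypeR R) ->
  (forall x, `|f x| <= K) -> mu.-integrable setT (fun x => (f x)%:E).
Proof.
move=> mf fK; apply: (@measurable_bounded_integrable _ (measurableTypeR R)) => //.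
  by rewrite leb01_setT ltry.
by exists K; split; [exact: num_real|move=> L KL x _; exact: le_trans (fK x) (ltW KL)].
Qed.

Lemma integral_level s (f : R -> R) : level s f ->
  (\int[mu]_x (f x)%:E = (avg_level s f)%:E)%E.
Proof.
move=> fs; transitivity (\int[mu]_x (\sum_(j < M s)
    ((f (node s j))%:E * (\1_[set y : measurableTypeR R | atom s y = j] x)%:E)))%E.
  by apply: eq_integral => x _; rewrite (level_sum x fs) -sumEFin; apply: eq_bigr => j _; rewrite EFinM.
have ic j : mu.-integrable setT (fun x => (\1_[set y | atom s y = j] x)%:E).
  apply: (@bounded_integrable _ 1); first by apply: measurable_indic; exact: measurable_atom.
  by move=> x; rewrite indicE; case: (_ \in _); rewrite ?normr1 ?normr0.
rewrite integral_sum//; last by move=> j; exact: integrableZl.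
rewrite /level_avg /avg mulr_suml -sumEFin; apply: eq_bigr => j _.
rewrite integralZl// integral_indic// ?setIT; last exact: measurable_atom.
by rewrite leb01_atom// -EFinM card_ord.
Qed.

Lemma measurable_level_set s (A : pred R) : level s A -> measurable [set x : measurableTypeR R | A x].
Proof.
move=> As; have h : level s (fun x => (A x)%:R : R) by move=> x y /As ->.
have -> : [set x | A x] = (fun x => (A x)%:R : R) @^-1` [set 1].
  by apply/seteqP; split => x /=; case: (A x) => // /eqP; rewrite eq_sym oner_eq0.
rewrite -[X in measurable X]setTI; apply: (measurable_level h) => //; exact: measurable_set1.
Qed.

Lemma leb01_level s (A : pred R) : level s A -> mu [set x | A x] = (prob_level s A)%:E.
Proof.
move=> As; rewrite -[LHS](_ : \int[mu]_x (\1_[set x | A x] x)%:E = _)%E; last first.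
  by rewrite integral_indic ?setIT//; exact: measurable_level_set As.
rewrite -integral_level; last by move=> x y /As ->.
apply: eq_integral => x _; rewrite indicE; case: (boolP (A x)) => [Ax|/negP Ax].
  by rewrite mem_set.
by rewrite memNset//; case: (A x) Ax.
Qed.

Lemma level_avg_ge0 s (f : R -> R) : (forall x, 0 <= f x) -> 0 <= avg_level s f.
Proof. by move=> f0; apply: avg_ge0. Qed.

Lemma block_index_lt s : (s <= n s)%N.
Proof.
elim: s => // s IH; rewrite (sys_nS S) (leq_ltn_trans IH)// -addn1 leq_add2l.
exact: bs_gt0 (sys_block S s).
Qed.

Lemma block_of i : exists s k, (k < N s)%N /\ i = (n s + k)%N.
Proof.
elim: i => [|i [s [k [kN ->]]]].
  by exists 0%N, 0%N; rewrite (bs_gt0 (sys_block S 0)) (sys_n0 S).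
case: (ltnP k.+1 (N s)) => h; first by exists s, k.+1; rewrite addnS.
exists s.+1, 0%N; rewrite (bs_gt0 (sys_block S s.+1)) (sys_nS S) addn0 -addnS; split=> //.
by congr (_ + _)%N; apply/eqP; rewrite eqn_leq kN.
Qed.

(** Level [i.+1] already contains the function [i], since every block is nonempty
    ([block_index_lt]); by [theta_level] any other level that contains it gives the same value. *)
Definition theta i x : R := g i.+1 i (atom i.+1 x).

Lemma theta_level s i x : (i < n s)%N -> theta i x = g s i (atom s x).
Proof.
have step t : (i < n t)%N -> g t.+1 i (atom t.+1 x) = g t i (atom t x).
  by move=> it; rewrite (sys_gS S) /glue it -atomS.
have up t k : (i < n t)%N -> g (t + k)%N i (atom (t + k) x) = g t i (atom t x).
  move=> it; elim: k => [|k IH]; first by rewrite addn0.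
  rewrite addnS step// (leq_trans it)//; elim: k {IH} => [|k IH]; first by rewrite addn0.
  by rewrite addnS (sys_nS S) (leq_trans IH)// leq_addr.
have i1 := block_index_lt i.+1; move=> is1; rewrite /theta.
by rewrite -(up i.+1 s i1) -(up s i.+1 is1) addnC.
Qed.

Lemma theta_block s k x : (k < N s)%N ->
  theta (n s + k) x = ph s k (atom s x) + ps s k (xi m atom s x).
Proof.
move=> kN; rewrite (@theta_level s.+1) ?(sys_nS S) ?ltn_add2l//.
by rewrite (sys_gS S) /glue ltnNge leq_addr /= addKn -atomS.
Qed.

Lemma level_theta s i : (i < n s)%N -> level s (theta i).
Proof. by move=> iN x y e; rewrite !(theta_level _ iN) e. Qed.

Lemma theta_bound i x : `|theta i x| <= 1 + Num.sqrt 2.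
Proof.
have [s [k [kN ->]]] := block_of i; rewrite theta_block//.
by apply: (bs_sup (sys_block S s)) => //; [exact: atom_lt|rewrite ltn_mod (m_gt0 S)].
Qed.

Lemma measurable_theta i : measurable_fun setT (theta i : measurableTypeR R -> measurableTypeR R).
Proof. exact: measurable_level (level_theta (block_index_lt i.+1)). Qed.

Lemma theta_orthonormal i j : (\int[mu]_x (theta i x * theta j x) = (i == j)%:R)%R.
Proof.
pose s := (maxn i j).+1.
have im : (i < n s)%N by apply: leq_trans (block_index_lt _); rewrite ltnS leq_maxl.
have jm : (j < n s)%N by apply: leq_trans (block_index_lt _); rewrite ltnS leq_maxr.
rewrite /Rintegral (@integral_level s); last first.
  by move=> x y e; rewrite (level_theta im e) (level_theta jm e).
rewrite /= -(sys_ortho S im jm); apply: eq_avg => k.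
by rewrite (theta_level _ im) (theta_level _ jm) atom_node.
Qed.

Lemma sup_theta i : ('N[mu]_+oo[EFin \o theta i] <= (1 + Num.sqrt 2)%:E)%E.
Proof.
rewrite unlock leb01_setT lte01; apply/ess_supP; apply: aeW => x /=.
by rewrite lee_fin theta_bound.
Qed.

Lemma bounded_L2 (f : R -> R) K : measurable_fun setT (f : measurableTypeR R -> measurableTypeR R) ->
  (forall x, `|f x| <= K) -> L2 f.
Proof.
move=> mf fK; rewrite /L2 /= inE; apply/andP; split; rewrite inE//=.
rewrite /finite_norm unlock; apply: poweR_lty.
apply: (@le_lt_trans _ _ (\int[mu]_x (K ^+ 2)%:E)%E).
  apply: ge0_le_integral => //.
  - by move=> x _ /=; rewrite lee_fin powR_ge0.
  - apply/measurable_EFinP/(@measurableT_comp _ _ _ _ _ _ (fun x : R => x `^ 2)%R) => //.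
    exact/measurableT_comp.
  - move=> x _ /=; rewrite lee_fin powR_mulrn// lerXn2r ?nnegrE//.
    exact: le_trans (fK x).
by rewrite integral_cst// leb01_setT mule1 ltry.
Qed.

Lemma negligible_small (B : set R) :
  (forall e : R, 0 < e -> exists A : set (measurableTypeR R),
     [/\ measurable A, B `<=` A & (mu A <= e%:E)%E]) -> mu.-negligible B.
Proof.
move=> HB; have [A HA] := choice (fun k : nat => HB k.+1%:R^-1 (ltac:(by rewrite invr_gt0))).
have mA : measurable (\bigcap_k A k) by apply: bigcapT_measurable => k; have [] := HA k.
exists (\bigcap_k A k); split=> //; last by move=> x Bx k _; have [_ h _] := HA k; exact: h.
apply/eqP; rewrite -measure_le0; apply/lee_addgt0Pr => e e0; rewrite add0e.
pose k := Num.truncn e^-1.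
have [mk _ lek] := HA k.
have := @le_measure _ _ _ mu (\bigcap_k A k) (A k).
rewrite !inE => /(_ mA mk (fun x h => h k I)) le1.
apply: le_trans le1 _; apply: le_trans lek _; rewrite lee_fin.
by rewrite -[leRHS]invrK lef_pV2 ?posrE ?invr_gt0// ltW// truncnS_gt.
Qed.

Lemma measure_bigcup_le (V : nat -> set (measurableTypeR R)) (e : R) :
  (forall k, measurable (V k)) -> (forall k, V k `<=` V k.+1) ->
  (forall k, (mu (V k) <= e%:E)%E) -> (mu (\bigcup_k V k) <= e%:E)%E.
Proof.
move=> mV VS Ve.
have hV : {homo V : i j / (i <= j)%N >-> (i <= j)%O}.
  by apply: homo_leq => [A|A B C|k]; [exact: lexx|exact: le_trans|rewrite subsetEset].
have cv := @nondecreasing_cvg_mu _ _ _ mu V mV (bigcupT_measurable _ mV) hV.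
rewrite -(cvg_lim _ cv)//; apply: lime_le; first by apply/cvg_ex; exists (mu (\bigcup_k V k)).
by apply: nearW => k; exact: Ve.
Qed.

(** * Almost everywhere convergence and divergence *)

Section Series.
Variable a : nat -> R.
Local Notation partial_block := (part m n ph ps atom a).
Local Notation block_sum := (block_sums m n N ph ps atom a).
Local Notation block := (block_value m n N ph ps atom a).
Local Notation energy_of_block := (block_energy M m n N ph ps a).
Local Notation sums x := (series (fun i => a i * theta i x)).

Lemma series_split (F : nat -> R) s k :
  series F (n s + k) = series F (n s) + \sum_(i < k) F (n s + i)%N.
Proof. by rewrite /series /= !big_mkord big_split_ord. Qed.

Lemma part_sum s k x : (k <= N s)%N ->
  \sum_(i < k) a (n s + i)%N * theta (n s + i) x = partial_block s k x.
Proof.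
move=> kN; rewrite /part /lin -big_split; apply: eq_bigr => i _ /=.
by rewrite theta_block ?mulrDr// (leq_trans (ltn_ord i)).
Qed.

Lemma series_block_sums s x : sums x (n s) = block_sum s x.
Proof.
elim: s => [|s IH]; first by rewrite (sys_n0 S) /block_sums big_ord0 /series /= big_geq.
by rewrite (sys_nS S) series_split IH part_sum// /block_sums big_ord_recr.
Qed.

Lemma series_part s k x : (k <= N s)%N -> sums x (n s + k)%N = block_sum s x + partial_block s k x.
Proof. by move=> kN; rewrite series_split series_block_sums part_sum. Qed.

Lemma block_sums_add b s x : block_sum (b + s) x = block_sum b x + \sum_(j < s) block (b + j) x.
Proof. by rewrite /block_sums big_split_ord. Qed.

Lemma series_sqr s : series (fun i => a i ^+ 2) (n s) = \sum_(j < s) energy_of_block j.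
Proof.
elim: s => [|s IH]; first by rewrite (sys_n0 S) big_ord0 /series /= big_geq.
by rewrite (sys_nS S) series_split IH big_ord_recr /= (block_energyE S).
Qed.

Lemma sqr_series_homo : {homo series (fun i => a i ^+ 2) : i j / (i <= j)%N >-> i <= j}.
Proof.
by move=> i j ij; rewrite -subr_ge0 sub_series_geq// sumr_ge0// => k _; exact: sqr_ge0.
Qed.

Lemma energy_tail e : l2 a -> 0 < e -> exists b, forall K, \sum_(j < K) energy_of_block (b.+1 + j) <= e.
Proof.
move=> al2 e0; rewrite /l2 /= in al2.
have le := nondecreasing_cvgn_le sqr_series_homo al2.
have /cvgrPdist_le /(_ e e0) [b _ Hb] := al2.
exists b => K; have -> : \sum_(j < K) energy_of_block (b.+1 + j) =
    series (fun i => a i ^+ 2) (n (b.+1 + K)) - series (fun i => a i ^+ 2) (n b.+1).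
  by rewrite !series_sqr big_split_ord /= addrAC subrr add0r.
have := Hb (n b.+1) (leq_trans (leqnSn b) (block_index_lt b.+1)).
by rewrite ler_norml => /andP[_ ?]; have := le (n (b.+1 + K)); lra.
Qed.

Lemma energy_unbounded : ~ l2 a -> forall B, exists K, B <= \sum_(j < K) energy_of_block j.
Proof.
move=> nl2 B; apply: contrapT => nK; apply: nl2; rewrite /l2 /=.
apply: nondecreasing_is_cvgn; first exact: sqr_series_homo.
exists B => _ [k _ <-]; apply: (le_trans (sqr_series_homo (block_index_lt k))).
by rewrite series_sqr leNgt; apply/negP => h; apply: nK; exists k; exact: ltW.
Qed.

Lemma homo_n : {homo n : i j / (i <= j)%N}.
Proof. by apply: homo_leq => [//|i j k|i]; [exact: leq_trans|rewrite (sys_nS S) leq_addr]. Qed.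

Definition osc (lam : R) b K x : bool := [exists s : 'I_K, [exists k : 'I_(N (b.+1 + s)).+1,
  lam < `|\sum_(j < s) block (b.+1 + j) x + partial_block (b.+1 + s) k x|]].

Lemma level_osc lam b K : level (b.+1 + K) (osc lam b K).
Proof.
move=> x y e; apply: eq_existsb => s; apply: eq_existsb => k; congr (_ < `|_|).
have lt t : (t < K)%N -> (b.+1 + t < b.+1 + K)%N by rewrite ltn_add2l.
congr (_ + _); last by apply: (lev_le atomS (lt s (ltn_ord s)) _ e); exact: (lev_part n ph ps atomS a k).
apply: eq_bigr => j _; have js := ltn_trans (ltn_ord j) (ltn_ord s).
by apply: (lev_le atomS (lt j js) _ e); exact: (lev_block_value n N ph ps atomS a).
Qed.

(** From index [n b.+1] on, a partial sum is a block sum plus a part of one block, so it stays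
    within [1 / (q + 1)] of the block sum at [b.+1]: the Cauchy criterion. *)
Lemma cvg_of_osc x : (forall q : nat, exists b, forall K, ~~ osc q.+1%:R^-1 b K x) -> cvgn (sums x).
Proof.
move=> H; apply/cauchy_cvgP/cauchy_exP => e e0.
pose q := Num.truncn e^-1; have [b Hb] := H q.
have q2 : q.+1%:R^-1 < e.
  by rewrite -[ltRHS]invrK ltf_pV2 ?posrE ?invr_gt0//; exact: truncnS_gt.
have close i : (n b.+1 <= i)%N -> `|sums x i - block_sum b.+1 x| <= q.+1%:R^-1.
  move=> bi; have [s [k [kN ei]]] := block_of i.
  have bs : (b.+1 <= s)%N.
    rewrite leqNgt; apply/negP => sb; have := homo_n sb; rewrite leqNgt => /negP; apply.
    by apply: leq_ltn_trans bi _; rewrite ei (sys_nS S) ltn_add2l.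
  rewrite ei series_part ?(ltnW kN)// -(subnKC bs) block_sums_add addrAC [block_sum _ _ + _]addrC addrK.
  set t := (s - b.+1)%N; have kN' : (k < (N (b.+1 + t)).+1)%N by rewrite /t subnKC// ltnS ltnW.
  have := Hb t.+1; rewrite negb_exists => /forallP /(_ ord_max).
  by rewrite negb_exists => /forallP /(_ (Ordinal kN')) /=; rewrite -leNgt.
exists (block_sum b.+1 x); exists (n b.+1) => // i /= bi.
by rewrite /ball /= distrC (le_lt_trans (close i bi)).
Qed.

Lemma theta_convergence : l2 a -> \forall x \ae mu, cvgn (sums x).
Proof.
move=> al2; apply: (@negligibleS _ _ _ mu
    (\bigcup_q [set x | forall b, exists K, osc q.+1%:R^-1 b K x])).
  move=> x /= nc; apply: contrapT => nq; apply: nc; apply: cvg_of_osc => q.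
  apply: contrapT => nb; apply: nq; exists q => // b; apply: contrapT => nK.
  by apply: nb; exists b => K; apply/negP => h; apply: nK; exists K.
apply: negligible_bigcup => q; apply: negligible_small => e e0.
have l0 : 0 < q.+1%:R^-1 :> R by rewrite invr_gt0.
have l2 : 0 < q.+1%:R^-1 ^+ 2 :> R by rewrite exprn_gt0.
have [|b Hb] := @energy_tail (e * q.+1%:R^-1 ^+ 2 / 6600) al2.
  by apply: divr_gt0; [exact: mulr_gt0|lra].
have mV K : measurable [set x : measurableTypeR R | osc q.+1%:R^-1 b K x].
  exact: measurable_level_set (@level_osc _ _ _).
exists (\bigcup_K [set x | osc q.+1%:R^-1 b K x]); split.
- exact: bigcupT_measurable.
- by move=> x /= /(_ b) [K h]; exists K.
apply: measure_bigcup_le => // K.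
  move=> x /= /existsP[s hs]; apply/existsP.
  by exists (widen_ord (leqnSn K) s).
rewrite (leb01_level (@level_osc _ b K)).
rewrite lee_fin; apply: le_trans (maximal_inequality S atomS atom_node a b K l0) _.
rewrite ler_pdivrMr//; have := Hb K; rewrite ler_pdivlMr; last by lra.
by rewrite mulrC.
Qed.

Local Notation is_spiky := (spiky m n N ph ps atom a).
Local Notation is_stay := (stay m n N ph ps atom a).

(** A spike is a difference of two partial sums, at [n s] and at [n s + k]. *)
Lemma no_spikes_of_cvg x : cvgn (sums x) -> exists b, forall s, (b <= s)%N -> ~~ is_spiky s x.
Proof.
move=> /cvgrPdist_lt /(_ (1/2) ltac:(lra)) [b _ Hb]; exists b => s bs.
rewrite negb_exists; apply/forallP => k; rewrite -ltNge.
have bn : (b <= n s)%N := leq_trans bs (block_index_lt s).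
have kN : (k <= N s)%N by rewrite -ltnS.
have := Hb (n s + k)%N (leq_trans bn (leq_addr _ _)); have := Hb (n s) bn.
rewrite (series_part x kN) (series_block_sums s x) !ltr_norml => /andP[? ?] /andP[? ?].
by apply/andP; split; lra.
Qed.

Lemma stay_of_cvg x : cvgn (sums x) -> exists K : nat, forall s, is_stay K%:R s x.
Proof.
move=> /cvg_seq_bounded [B [_ HB]].
pose K := (Num.truncn B).+1; exists K => s; apply/forallP => j; rewrite -series_block_sums.
by apply: (HB K%:R) => //; exact: truncnS_gt.
Qed.

Lemma theta_divergence : ~ l2 a -> \forall x \ae mu, ~ cvgn (sums x).
Proof.
move=> /energy_unbounded unb; case: (energy_dichotomy unb) => [[C C1 rate]|[unb_nu small]].
  apply: (@negligibleS _ _ _ mu (\bigcup_b [set x | forall s, (b <= s)%N -> ~~ is_spiky s x])).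
    by move=> x /= /contrapT /no_spikes_of_cvg [b Hb]; exists b.
  apply: negligible_bigcup => b; apply: negligible_small => e e0.
  (* The rates from [b] on must add up to at least [1 / e], which [spike_div] turns into a
     probability at most [e]. *)
  have [K HK] := rate (\sum_(j < b) spike_rate M m n N ph ps a C j + e^-1).
  pose A x := [forall j : 'I_K, ~~ is_spiky (b + j) x].
  have Al : level (b + K) A.
    move=> x y xy; apply: eq_forallb => j; congr (~~ _).
    have jK : ((b + j).+1 <= b + K)%N by rewrite -addnS leq_add2l.
    by apply: (lev_le atomS jK _ xy); exact: (lev_spiky n N ph ps atomS a).
  exists [set x | A x]; split.
  - exact: measurable_level_set Al.
  - by move=> x /= h; apply/forallP => j; apply: h; exact: leq_addr.
  rewrite (leb01_level Al) lee_fin.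
  have := spike_div S atomS atom_node a b K C1; rewrite -/A.
  have : e^-1 <= \sum_(j < K) spike_rate M m n N ph ps a C (b + j).
    have : \sum_(j < K) spike_rate M m n N ph ps a C j <= \sum_(j < b + K) spike_rate M m n N ph ps a C j.
      by rewrite addnC big_split_ord /= lerDl sumr_ge0// => j _; exact: spike_rate_ge0.
    by rewrite big_split_ord /=; lra.
  set r := \sum_(j < K) _ => re le.
  have P0 : 0 <= prob_level (b + K) A by apply: level_avg_ge0.
  have ie : 0 < e^-1 by rewrite invr_gt0.
  have : prob_level (b + K) A * e^-1 <= 1.
    by apply: le_trans le; rewrite ler_wpM2l//; lra.
  by rewrite ler_pdivrMr// mul1r.
apply: (@negligibleS _ _ _ mu (\bigcup_K [set x | forall s, is_stay K%:R s x])).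
  by move=> x /= /contrapT /stay_of_cvg [K HK]; exists K.
apply: negligible_bigcup => K; apply: negligible_small => e e0.
have [s Hs] := test_div S atomS atom_node (ler0n R K) e0 unb_nu small.
have Al : level s (is_stay K%:R s) by move=> x y; exact: (lev_stay n N ph ps atomS a K%:R).
exists [set x | is_stay K%:R s x]; split; first exact: measurable_level_set Al.
  by move=> x /=; exact.
by rewrite (leb01_level Al) lee_fin.
Qed.

End Series.

End UnitInterval.

(** * Completeness *)
Section Completeness.
Local Open Scope classical_set_scope.
Local Open Scope ring_scope.
Variables (R : realType) (M m n N : nat -> nat) (ph ps g : nat -> nat -> nat -> R).
Hypothesis S : system M m n N ph ps g.
Local Notation mu := (leb01 R).
Local Notation atom := (atom M).
Local Notation node := (node R M).
Local Notation theta := (theta M g).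

Local Notation mfun f := (measurable_fun setT (f : measurableTypeR R -> measurableTypeR R)).

Definition sqdist (f h : R -> R) : \bar R := (\int[mu]_x ((f x - h x) ^+ 2)%:E)%E.

(** Functions of an atom lie in the span of the system, so completeness amounts to their density in
    the mean. *)
Definition level_approximable (f : R -> R) := forall e : R, 0 < e ->
  exists s (phi : nat -> R), (sqdist f (phi \o atom s) < e%:E)%E.

Lemma measurable_sqr (f h : R -> R) : mfun f -> mfun h ->
  measurable_fun (setT : set (measurableTypeR R)) (fun x => ((f x - h x) ^+ 2)%:E).
Proof.
by move=> mf mh; apply/measurable_EFinP; apply: measurable_funX; exact: measurable_funB.
Qed.

Lemma measurable_atom_comp s (phi : nat -> R) : mfun (phi \o atom s).
Proof. by apply: (measurable_level S (s := s)) => x y /= ->. Qed.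

Lemma sqdist_triangle (f h k : R -> R) (e : R) : mfun f -> mfun h -> mfun k ->
  (sqdist f h < (e / 4)%:E)%E -> (sqdist h k < (e / 4)%:E)%E -> (sqdist f k < e%:E)%E.
Proof.
move=> mf mh mk fh hk.
have le : (sqdist f k <= 2%:E * sqdist f h + 2%:E * sqdist h k)%E.
  rewrite /sqdist -!ge0_integralZl//; last 4 first.
  - exact: measurable_sqr.
  - by move=> x _; rewrite lee_fin sqr_ge0.
  - exact: measurable_sqr.
  - by move=> x _; rewrite lee_fin sqr_ge0.
  rewrite -ge0_integralD//; last 4 first.
  - by move=> x _; rewrite -EFinM lee_fin mulr_ge0// sqr_ge0.
  - by apply: measurable_funeM; exact: measurable_sqr.
  - by move=> x _; rewrite -EFinM lee_fin mulr_ge0// sqr_ge0.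
  - by apply: measurable_funeM; exact: measurable_sqr.
  apply: ge0_le_integral => //.
  - by move=> x _; rewrite lee_fin sqr_ge0.
  - exact: measurable_sqr.
  - by apply: emeasurable_funD; apply: measurable_funeM; exact: measurable_sqr.
  move=> x _; rewrite -!EFinM -EFinD lee_fin.
  by have := sqr_ge0 ((f x - h x) - (h x - k x)); lra.
apply: le_lt_trans le _.
have -> : e%:E = (2%:E * (e / 4)%:E + 2%:E * (e / 4)%:E)%E.
  by rewrite -EFinM -EFinD; congr (_%:E); field.
by apply: lteD; rewrite lte_pmul2l.
Qed.

Lemma level_approximable_trans (f : R -> R) : mfun f ->
  (forall e : R, 0 < e -> exists h : R -> R, [/\ mfun h, level_approximable h & (sqdist f h < e%:E)%E]) ->
  level_approximable f.
Proof.
move=> mf H e e0; have e4 : 0 < e / 4 by rewrite divr_gt0.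
have [h [mh ah fh]] := H _ e4; have [s [phi hp]] := ah _ e4; exists s, phi.
by apply: sqdist_triangle fh hp => //; exact: measurable_atom_comp.
Qed.

(** Pointwise convergence on [[0, 1[] suffices: the measure ignores the outside of [[0, 1]], and the
    point 1 is null. *)
Lemma sqdist_dominated (f : R -> R) (h : nat -> R -> R) (G : R -> R) (e : R) : mfun f ->
  (forall k, mfun (h k)) -> (forall x, 0 <= x < 1 -> (h k x @[k --> \oo] --> f x)) ->
  mu.-integrable setT (fun x => (G x)%:E) -> (forall k x, (f x - h k x) ^+ 2 <= G x) -> 0 < e ->
  exists k, (sqdist f (h k) < e%:E)%E.
Proof.
move=> mf mh hf iG hG e0.
have [_ _ cv] : [/\ mu.-integrable setT (cst 0%E),
    ([sequence (\int[mu]_(x in setT) `|((f x - h k x) ^+ 2)%:E - 0|)%E]_k @ \oo --> 0%E) &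
    ([sequence (\int[mu]_(x in setT) ((f x - h k x) ^+ 2)%:E)%E]_k @ \oo --> (\int[mu]_(x in setT) cst 0 x)%E)].
  apply: (@dominated_convergence _ (measurableTypeR R) R mu setT measurableT _ _ (fun x => (G x)%:E)) => //.
  - by move=> k; exact: measurable_sqr.
  - exists (~` `[0, 1[%classic); split.
    + by apply: measurableC; exact: measurable_itv.
    + rewrite /leb01 /= /mrestr; apply/eqP; rewrite -measure_le0.
      rewrite -(lebesgue_measure_set1 (1 : R)); apply: le_measure; rewrite ?inE//.
      * by apply: measurableI; [apply: measurableC|]; exact: measurable_itv.
      * move=> x /= []; rewrite !in_itv /= => /negP nx /andP[x0 x1]; apply/eqP.
        by move: nx; rewrite x0 /= -leNgt eq_le x1 => ->.
    move=> x /= nx; rewrite in_itv /= => x01; apply: nx => _.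
    apply: cvg_EFin; first exact: nearW.
    have c := hf x x01.
    have -> : (0 : R) = (f x - f x) * (f x - f x) by rewrite subrr mul0r.
    rewrite [X in X @ _ --> _](_ : _ = (fun k => (f x - h k x) * (f x - h k x)))//.
    by apply: cvgM; apply: cvgB => //; exact: cvg_cst.
  - by apply: aeW => x k _; rewrite gee0_abs ?lee_fin ?sqr_ge0.
rewrite integral0 in cv.
have /fine_cvgP[_ /cvgrPdist_lt /(_ e e0)] := cv.
have /fine_cvgP[[i _ fin] _] := cv.
move=> [j _ Hj]; exists (maxn i j); have := Hj (maxn i j) (leq_maxr i j).
have := fin (maxn i j) (leq_maxl i j); rewrite /= sub0r normrN => fn.
rewrite ger0_norm; last by apply: fine_ge0; apply: integral_ge0 => x _; rewrite lee_fin sqr_ge0.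
by rewrite -lte_fin fineK.
Qed.

Definition clip (K y : R) : R := Num.max (- K) (Num.min K y).

Lemma clip_bound K y : 0 <= K -> `|clip K y| <= K.
Proof.
move=> K0; rewrite /clip ler_norml le_max lexx /= ge_max; apply/andP; split; first lra.
by rewrite ge_min lexx.
Qed.

Lemma clip_lipschitz K y z : 0 <= K -> `|clip K y - clip K z| <= `|y - z|.
Proof.
move=> K0; have lip : forall a b, a <= b -> 0 <= clip K b - clip K a <= b - a.
  move=> a b ab; rewrite /clip; case: (leP K a) => ?; case: (leP K b) => ?.
  - by rewrite subrr lexx subr_ge0.
  - by exfalso; lra.
  - by rewrite (max_idPr (_ : - K <= K)); [case: (leP (- K) a) => ?; apply/andP; split; lra|lra].
  by case: (leP (- K) a) => ?; case: (leP (- K) b) => ?; apply/andP; split; lra.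
wlog yz : y z / y <= z.
  by move=> H; case: (leP y z) => [|/ltW] /H //; rewrite distrC [in leRHS]distrC.
have /andP[h1 h2] := lip y z yz.
by rewrite distrC [leRHS]distrC !ger0_norm// subr_ge0.
Qed.

Lemma clip_id K y : `|y| <= K -> clip K y = y.
Proof.
by rewrite ler_norml => /andP[h1 h2]; rewrite /clip (min_idPr h2) (max_idPr h1).
Qed.

Lemma clip_residual K y : 0 <= K -> `|y - clip K y| <= `|y|.
Proof.
move=> K0; rewrite /clip; case: (leP K y) => Ky.
  by rewrite (max_idPr (_ : - K <= K)); [rewrite !ger0_norm; lra|lra].
case: (leP (- K) y) => yK; first by rewrite subrr normr0.
by rewrite !ler0_norm; lra.
Qed.

Lemma measurable_clip K (f : R -> R) : mfun f -> mfun (fun x => clip K (f x)).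
Proof. by move=> mf; apply: measurable_maxr => //; exact: measurable_minr. Qed.

Lemma lt_M s : (s < M s)%N.
Proof.
elim: s => [|s IH]; first by rewrite (sys_M0 S).
have := bs_size (sys_block S s); have := bs_gt0 (sys_block S s).
by rewrite (sys_MS S) => h1 h2; nia.
Qed.

Lemma node_atom_cvg x : 0 <= x < 1 -> node s (atom s x) @[s --> \oo] --> x.
Proof.
move=> x01; apply/cvgrPdist_lt => e e0; exists (Num.truncn e^-1) => // s /= es.
have M0 : 0 < (M s)%:R :> R by rewrite ltr0n (M_gt0 S).
have /andP[x0 x1] := x01.
have h0 : 0 <= x * (M s)%:R by rewrite mulr_ge0.
rewrite /node /atom x01; have := truncn_itv h0; set t := Num.truncn _ => /andP[t1 t2].
have Me : e^-1 < (M s)%:R.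
  by apply: lt_le_trans (truncnS_gt _) _; rewrite ler_nat (leq_ltn_trans es)// lt_M.
have {}Me : 1 < (M s)%:R * e by rewrite -ltr_pdivrMr// mul1r.
have -> : x - t%:R / (M s)%:R = (x * (M s)%:R - t%:R) / (M s)%:R.
  by field; rewrite gt_eqF.
rewrite ger0_norm; last by rewrite divr_ge0 ?subr_ge0.
by rewrite ltr_pdivrMr// [e * _]mulrC; move: t2; rewrite -natr1; lra.
Qed.

Lemma integrable_cst_leb01 (K : R) : mu.-integrable setT (fun=> K%:E).
Proof. exact: (@bounded_integrable R (fun=> K) `|K| (@measurable_cst _ _ _ _ _ _) (fun=> lexx _)). Qed.

Lemma level_approximable_continuous (f : R -> R) K : 0 <= K -> continuous f -> mfun f ->
  level_approximable (fun x => clip K (f x)).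
Proof.
move=> K0 cf mf e e0; pose h s (x : R) := clip K (f (node s (atom s x))).
have [||||||s Hs] := @sqdist_dominated (fun x => clip K (f x)) h (fun=> (2 * K) ^+ 2) e.
- exact: measurable_clip.
- by move=> s; exact: (@measurable_atom_comp s (fun j => clip K (f (node s j)))).
- move=> x x01; have c : f (node s (atom s x)) @[s --> \oo] --> f x.
    by apply: continuous_cvg; [exact: cf|exact: node_atom_cvg].
  apply/cvgrPdist_lt => d d0; have /cvgrPdist_lt /(_ d d0) := c.
  by apply: filterS => s; apply: le_lt_trans; exact: clip_lipschitz.
- exact: integrable_cst_leb01.
- move=> s x; have := clip_bound (f x) K0; have := clip_bound (f (node s (atom s x))) K0.
  rewrite !ler_norml -/(h s x) => /andP[a1 a2] /andP[b1 b2].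
  by rewrite -[leLHS]real_normK ?num_real// lerXn2r ?nnegrE//; [lra|rewrite ler_norml; apply/andP; split; lra].
- exact: e0.
by exists s, (fun j => clip K (f (node s j))).
Qed.

Lemma integral_leb01 (f : R -> R) : mfun f -> (forall x, 0 <= f x) ->
  (\int[mu]_x (f x)%:E = \int[lebesgue_measure]_(x in `[0%R, 1%R]) (f x)%:E)%E.
Proof.
move=> mf f0; have m01 : measurable (`[0%R, 1%R] : set (measurableTypeR R)) by exact: measurable_itv.
rewrite (@ge0_negligible_integral _ (measurableTypeR R) R mu setT (~` `[0, 1])) => //.
- rewrite setTD setCK; apply: eq_measure_integral => A mA A01.
  by rewrite /leb01 /= /mrestr setIidl.
- exact: measurableC.
- by apply/measurable_EFinP.
- by move=> x _; rewrite lee_fin.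
- by rewrite /leb01 /= /mrestr setICl measure0.
Qed.

(** Continuous functions approximate [f] in the mean of order 1. Clipping them at [K] does not
    increase the distance, since it fixes [f], and bounds the squared error by [2 * K] times the
    error. *)
Lemma level_approximable_bounded (f : R -> R) K : 0 < K -> mfun f -> (forall x, `|f x| <= K) ->
  level_approximable f.
Proof.
move=> K0 mf fK; apply: level_approximable_trans => // e e0.
have m01 : measurable (`[0%R, 1%R] : set (measurableTypeR R)) by exact: measurable_itv.
have fin : (lebesgue_measure (`[0%R, 1%R] : set (measurableTypeR R)) < +oo)%E.
  by rewrite lebesgue_measure_itv /= lte_fin ltr01 -EFinB ltry.
have intf : lebesgue_measure.-integrable `[0%R, 1%R] (EFin \o f).
  apply: measurable_bounded_integrable => //; first exact: measurable_funTS.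
  by exists K; split; [exact: num_real|move=> L KL x _; exact: le_trans (fK x) (ltW KL)].
have [h [ch ih hf]] := approximation_continuous_integrable m01 fin intf.
have e2 : 0 < e / (2 * K) by rewrite divr_gt0// mulr_gt0.
have /fine_cvgP[[i _ Hi] /cvgrPdist_lt /(_ _ e2) [j _ Hj]] := hf.
have := Hj (maxn i j) (leq_maxr i j); have := Hi (maxn i j) (leq_maxl i j).
set k := maxn i j => /= fn; rewrite sub0r normrN ger0_norm; last first.
  by apply: fine_ge0; apply: integral_ge0 => x _.
rewrite -lte_fin fineK// => lek.
have mh : mfun (h k) by exact: continuous_measurable_fun (ch k).
exists (fun x => clip K (h k x)); split; first exact: measurable_clip.
  by apply: level_approximable_continuous => //; exact: ltW.
have mfh : mfun (fun x => `|f x - h k x|).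
  by apply: measurableT_comp => //; exact: measurable_funB.
apply: (@le_lt_trans _ _ (\int[mu]_x ((2 * K)%:E * `|f x - h k x|%:E))%E).
  apply: ge0_le_integral => //.
  - by move=> x _; rewrite lee_fin sqr_ge0.
  - by apply: measurable_sqr => //; exact: measurable_clip.
  - by apply: measurable_funeM; apply/measurable_EFinP.
  move=> x _; rewrite -EFinM lee_fin -real_normK ?num_real// expr2.
  have c0 := clip_lipschitz (f x) (h k x) (ltW K0); rewrite (clip_id (fK x)) in c0.
  apply: ler_pM => //; have := fK x; have := clip_bound (h k x) (ltW K0).
  by rewrite !ler_norml => /andP[? ?] /andP[? ?]; apply/andP; split; lra.
rewrite ge0_integralZl//; last 2 first.
- exact/measurable_EFinP.
- by rewrite lee_fin mulr_ge0// ltW.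
rewrite integral_leb01//.
have -> : e%:E = ((2 * K)%:E * (e / (2 * K))%:E)%E.
  by rewrite -EFinM; congr (_%:E); field; rewrite gt_eqF.
by rewrite lte_pmul2l// lte_fin mulr_gt0.
Qed.

Lemma level_approximable_L2 (f : R -> R) : L2 f -> level_approximable f.
Proof.
move=> Lf; have mf : mfun f by move: Lf; rewrite /L2 /= inE => /andP[]; rewrite inE.
apply: level_approximable_trans => // e e0.
have [|||||k Hk] := @sqdist_dominated f (fun k x => clip k.+1%:R (f x)) (fun x => f x ^+ 2) e mf.
- by move=> k; exact: measurable_clip.
- move=> x _; apply: (cvg_near_cst (f x)); exists (Num.truncn `|f x|) => // k /= fk.
  by apply: clip_id; apply: (le_trans (ltW (truncnS_gt _))); rewrite ler_nat ltnS.
- exact: Lfun2_integrable_sqr.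
- move=> k x; rewrite -[leLHS]real_normK ?num_real// -[leRHS]real_normK ?num_real//.
  by rewrite lerXn2r ?nnegrE// clip_residual.
- exact: e0.
exists (fun x => clip k.+1%:R (f x)); split=> //; first exact: measurable_clip.
apply: (@level_approximable_bounded _ k.+1%:R) => //; first exact: measurable_clip.
by move=> x; exact: clip_bound.
Qed.

(** The functions of the system present at level [s.+1] represent every function of the atoms of
    level [s], because block [s] recovers the orthonormal completion it was built on. *)
Lemma level_in_span s (phi : nat -> R) : linear_span theta (phi \o atom s).
Proof.
have [c Hc] := sys_span S s phi; exists (n s.+1), c; apply/funext => x.
rewrite /= (atomS S) Hc ?(atom_lt S)// big_mkord; apply: eq_bigr => i _.
by rewrite (theta_level S x (ltn_ord i)).
Qed.

Lemma Lnorm2_lt (f h : R -> R) (e : R) : 0 < e -> (sqdist f h < (e ^+ 2)%:E)%E ->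
  ('N[mu]_2%:E[(fun x => (f x - h x)%:E)] < e%:E)%E.
Proof.
move=> e0 lt; rewrite ltNge; apply/negP => le; move: lt; rewrite ltNge => /negP; apply.
have -> : sqdist f h = ('N[mu]_2%:E[(fun x => (f x - h x)%:E)] `^ 2)%E.
  rewrite powR_Lnorm ?gt_eqF//; apply: eq_integral => x _ /=.
  by rewrite powR_mulrn// real_normK ?num_real.
have -> : (e ^+ 2)%:E = (e%:E `^ 2)%E by rewrite poweR_EFin powR_mulrn// ltW.
by apply: gt0_ler_poweR => //; rewrite in_itv /= leey ?lee_fin ?(ltW e0) ?Lnorm_ge0.
Qed.

Lemma theta_complete : complete_system theta.
Proof.
apply/seteqP; split=> [f []//|f Lf]; split=> // e e0.
have [|s [phi H]] := level_approximable_L2 Lf (e := e ^+ 2); first exact: exprn_gt0.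
exists (phi \o atom s); first exact: level_in_span.
exact: Lnorm2_lt.
Qed.

End Completeness.

Theorem theorem1 (R : realType) (M : R) (hM : 1 + Num.sqrt 2 < M) :
  exists theta : nat -> R -> R,
    [/\ orthonormal_system theta,
        complete_system theta,
        euclidean_system theta &
        forall n : nat, ('N[leb01 R]_+oo[EFin \o theta n] <= M%:E)%E].
Proof.
have [M' [m [n [N [ph [ps [g S]]]]]]] := system_exists R.
exists (theta M' g); split.
- split=> [i|i j]; last exact: theta_orthonormal S i j.
  exact: bounded_L2 (measurable_theta S i) (theta_bound S i).
- exact: theta_complete S.
- by split=> a; [exact: theta_convergence S a|exact: theta_divergence S a].
- by move=> i; apply: le_trans (sup_theta S i) _; rewrite lee_fin ltW.
Qed.
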